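(* Let $d\ge 1$, $N\ge 2$, let $m_i\in(0,+\infty]$ ($i=1,\dots,N$), and let $\hat\epsilon_i:\mathbb{Z}^d\to\mathbb{C}$ ($i=1,\dots,N$) and $\hat v_{ij}:\mathbb{Z}^d\to\mathbb{R}$ ($1\le i<j\le N$) satisfy: (a) $\hat\epsilon_i(y)=\overline{\hat\epsilon_i(-y)}$ for all $y\in\mathbb{Z}^d$, and there exists $\gamma>0$ with $\sum_{y\in\mathbb{Z}^d}|y|^\gamma|\hat\epsilon_i(y)|<+\infty$, for $i=1,\dots,N$; (b) $\hat v_{ij}\in\ell^1(\mathbb{Z}^d)$ and $\hat v_{ij}$ is even, for $1\le i<j\le N$. Let $H(K)$, $K\in\mathbb{T}^d$, be the associated $N$-particle discrete Schrödinger operator. Then for every $K\in\mathbb{T}^d$ the essential spectrum of $H(K)$ is an at most countable union of disjoint closed segments; more precisely, it is the union of the spectra of all two-cluster operators: $$\sigma_{\mathrm{ess}}(H(K))=\bigcup_{\mathcal{D}\in\Xi,\ \#\mathcal{D}=2}\sigma(H^{\mathcal{D}}(K)),$$ where $\Xi$ is the set of all cluster decompositions of $\{1,\dots,N\}$ and $\#\mathcal{D}$ is the number of clusters in $\mathcal{D}$. Moreover, $\sigma_{\mathrm{disc}}(H(K))$ can accumulate only at the edges of the constituent segments.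
   Context: $\mathbb{T}^d=\mathbb{R}^d/(2\pi\mathbb{Z})^d=(-\pi,\pi]^d$ is the $d$-torus with its Haar (Lebesgue) measure; $|x|=\sum_l|x^{(l)}|$ for $x\in\mathbb{Z}^d$; $p\cdot x=\sum_l p^{(l)}x^{(l)}$. Convention: $1/m_i=0$ if $m_i=+\infty$. Dispersion relations and kernels: for $p\in\mathbb{T}^d$, $$\epsilon_i(p)=(2\pi)^{-d/2}\sum_{x\in\mathbb{Z}^d}\hat\epsilon_i(x)e^{\mathrm{i}p\cdot x},\qquad v_{ij}(p)=(2\pi)^{-d/2}\sum_{x\in\mathbb{Z}^d}\hat v_{ij}(x)e^{\mathrm{i}p\cdot x}.$$ $N$-particle discrete Schrödinger operator: for $K\in\mathbb{T}^d$ let $\mathbb{F}_K=\{\mathbf{p}=(p_1,\dots,p_N)\in(\mathbb{T}^d)^N: p_1+\dots+p_N=K\}$, identified with $(\mathbb{T}^d)^{N-1}$ (with its Haar measure) by omitting the last coordinate. $H(K)=H_0(K)-\sum_{1\le i<j\le N}V_{ij}$ is the bounded self-adjoint operator on $L^2(\mathbb{F}_K)\cong L^2((\mathbb{T}^d)^{N-1})$ with $$(H_0(K)f)(\mathbf{p})=\Big(\sum_{i=1}^N\tfrac1{m_i}\epsilon_i(p_i)\Big)f(\mathbf{p}),$$ $$(V_{ij}f)(\mathbf{p})=(2\pi)^{-d/2}\int_{\mathbb{T}^d}v_{ij}(t)f(p_1,\dots,p_i-t,\dots,p_j+t,\dots,p_N)\,dt.$$ (Any unitarily equivalent representation may be used.)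 A cluster decomposition $\mathcal{C}=\{C_1,\dots,C_l\}$ is a partition of $\{1,\dots,N\}$ into nonempty disjoint subsets (clusters); $\#\mathcal{C}=l$; $ij\notin\mathcal{C}$ means that $i$ and $j$ lie in different clusters. The cluster operator is $H^{\mathcal{C}}(K)=H(K)+\sum_{i<j,\ ij\notin\mathcal{C}}V_{ij}$. $\sigma_{\mathrm{disc}}$ is the set of isolated eigenvalues of finite multiplicity and $\sigma_{\mathrm{ess}}=\sigma\setminus\sigma_{\mathrm{disc}}$. *)

(* Defs.v *)
From mathcomp Require Import all_boot all_order all_algebra.
From mathcomp Require Import all_classical all_reals all_analysis.
From mathcomp Require Import complex.

Set Implicit Arguments.
Unset Strict Implicit.
Unset Printing Implicit Defensive.

Import Order.TTheory GRing.Theory Num.Theory.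
Import numFieldNormedType.Exports.

Local Open Scope classical_set_scope.
Local Open Scope ring_scope.
Local Open Scope complex_scope.

Section ComplexSums.
Context {R : realType} {T : choiceType}.

(* Unordered sum of an absolutely summable family. *)
Definition rsum (g : T -> R) : R :=
  fine (\esum_(t in [set: T]) (Num.max (g t) 0)%:E)
  - fine (\esum_(t in [set: T]) (Num.max (- g t) 0)%:E).

Definition csum (g : T -> R[i]) : R[i] :=
  rsum (fun t => complex.Re (g t)) +i* rsum (fun t => complex.Im (g t)).

End ComplexSums.

Definition expi {R : realType} (t : R) : R[i] := cos t +i* sin t.

Section SpectralTheory.
Context {R : realType} {X : choiceType}.
Implicit Types (f g : X -> R[i]) (A B : (X -> R[i]) -> (X -> R[i])).

Definition l2 f : Prop := (\esum_(x in [set: X]) (Normc.normc (f x) ^+ 2)%:E < +oo)%E.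

Definition l2norm f : R :=
  Num.sqrt (fine (\esum_(x in [set: X]) (Normc.normc (f x) ^+ 2)%:E)).

(* Operators on l2 are maps on all functions X -> C of which only the values
   on l2 matter. *)
Definition bounded_operator B : Prop :=
  [/\ forall f, l2 f -> l2 (B f),
      forall (c : R[i]) f g, l2 f -> l2 g ->
        B (fun x => c * f x + g x) = (fun x => c * B f x + B g x)
    & exists M : R, forall f, l2 f -> l2norm (B f) <= M * l2norm f].

Definition resolvent_set A : set R[i] :=
  [set z | exists B, bounded_operator B /\
     forall f, l2 f ->
       B (fun x => A f x - z * f x) = f /\
       (fun x => A (B f) x - z * B f x) = f].

Definition spectrum A : set R[i] := ~` resolvent_set A.

Definition op_eigenspace A (z : R[i]) : set (X -> R[i]) :=
  [set f | l2 f /\ A f = (fun x => z * f x)].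

Definition op_eigenvalue A (z : R[i]) : Prop :=
  exists2 f, op_eigenspace A z f & f <> (fun=> 0).

(* For the self-adjoint operators considered here, algebraic and geometric
   multiplicities agree. *)
Definition finite_multiplicity A (z : R[i]) : Prop :=
  exists (k : nat) (e : 'I_k -> X -> R[i]),
    (forall j, op_eigenspace A z (e j)) /\
    forall f, op_eigenspace A z f ->
      exists c : 'I_k -> R[i], f = (fun x => \sum_(j < k) c j * e j x).

Definition disc_spectrum A : set R[i] :=
  [set z | [/\ isolated (spectrum A : set R[i]^o) z, op_eigenvalue A z
             & finite_multiplicity A z]].

Definition ess_spectrum A : set R[i] := spectrum A `\` disc_spectrum A.

End SpectralTheory.

Definition segment {R : realType} (a b : R) : set R[i] :=
  [set t%:C | t in `[a, b]].

(* Representatives of R^d / (2 pi Z)^d. *)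
Definition torus (R : realType) (d : nat) : set 'rV[R]_d :=
  [set K | forall l, K ord0 l \in `]- pi, pi]].

Definition l1norm {d : nat} (y : 'rV[int]_d) : nat :=
  (\sum_(l < d) `|y ord0 l|)%N.

Definition torus_dot {R : realType} {d : nat} (K : 'rV[R]_d) (y : 'rV[int]_d) :
    R := \sum_(l < d) K ord0 l * (y ord0 l)%:~R.

(* There are N = n.+1 particles, the last one having index ord_max.
   L^2(F_K) = L^2((T^d)^n), with the last momentum omitted, is represented by
   l2((Z^d)^n) through the unitary map
     f(p_1, .., p_n) = (2 pi)^(- d n / 2) sum_x f^(x) e^{i sum_k p_k . x_k};
   x : 'M[int]_(n, d) is the configuration whose k-th row is x_k. *)
Section NParticle.
Context {R : realType} {d n : nat}.
Variables (m : 'I_n.+1 -> \bar R) (eps : 'I_n.+1 -> 'rV[int]_d -> R[i]).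
Variables (v : 'I_n.+1 -> 'I_n.+1 -> 'rV[int]_d -> R).
Variable K : 'rV[R]_d.
Implicit Types (f : 'M[int]_(n, d) -> R[i]) (i j : 'I_n.+1).

(* The full configuration with the last particle at the origin. *)
Definition pin (x : 'M[int]_(n, d)) : 'M[int]_(n.+1, d) :=
  \matrix_(i < n.+1) (if unlift ord_max i is Some k then row k x else 0).

(* Fourier coefficient of f, as a function on F_K, at a full configuration:
   since p_N = K - p_1 - .. - p_n, it is the integral over p_1, .., p_n of
   f(p) e^{-i K . x_N} e^{-i sum_k p_k . (x_k - x_N)}. *)
Definition fibre_coef f (x : 'M[int]_(n.+1, d)) : R[i] :=
  expi (- torus_dot K (row ord_max x)) *
  f (\matrix_(k < n) (row (lift ord_max k) x - row ord_max x)).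

Definition translate (x : 'M[int]_(n.+1, d)) i (y : 'rV[int]_d) :
    'M[int]_(n.+1, d) :=
  \matrix_(k < n.+1) (row k x + (if k == i then y else 0)).

(* Multiplication by eps_i(p_i) is convolution with (2 pi)^(- d / 2) eps^_i
   in the variable x_i. *)
Definition dispersion i f : 'M[int]_(n, d) -> R[i] := fun x =>
  ((2 * pi) `^ (- (d%:R / 2)))%:C *
  csum (fun y : 'rV[int]_d => eps i y * fibre_coef f (translate (pin x) i (- y))).

Definition free_hamiltonian f : 'M[int]_(n, d) -> R[i] := fun x =>
  \sum_(i < n.+1) (fine (m i)^-1%E)%:C * dispersion i f x.

(* On e^{i sum_k p_k . x_k}, V_ij acts as the factor
   (2 pi)^(- d / 2) int v_ij(t) e^{-i t . (x_i - x_j)} dt = v^_ij(x_i - x_j). *)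
Definition pair_potential i j f : 'M[int]_(n, d) -> R[i] := fun x =>
  (v i j (row i (pin x) - row j (pin x)))%:C * f x.

Definition hamiltonian f : 'M[int]_(n, d) -> R[i] := fun x =>
  free_hamiltonian f x
  - \sum_(i < n.+1) \sum_(j < n.+1 | (i < j)%N) pair_potential i j f x.

Definition cluster_hamiltonian (D : {set {set 'I_n.+1}}) f :
    'M[int]_(n, d) -> R[i] := fun x =>
  hamiltonian f x
  + \sum_(i < n.+1)
      \sum_(j < n.+1 | (i < j)%N && (finset.pblock D i != finset.pblock D j))
        pair_potential i j f x.

End NParticle.

Definition cluster_decompositions (n : nat) : set {set {set 'I_n.+1}} :=
  [set D | finset.partition D [set: 'I_n.+1]%SET].

(* Main.v *)
(* The Hamiltonian is a convolution with a summable Hermitian kernel on Z^r plus a potential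
   W = sum_al w_al o pi_al, with w_al vanishing at infinity and pi_al additive. Spectra of symmetric
   operators are handled through lower bounds: lam is in the spectrum iff A - lam has no bound
   |(A - lam) f| >= c |f|, and in the essential spectrum iff there is no such bound on the functions
   vanishing on any given finite set.

   Essential spectrum: let A_J keep only the terms al in J. If J = {al | pi_al s = 0} for some s <> 0,
   approximate eigenfunctions of A_J translated by multiples of s are approximate eigenfunctions of A
   that leave every finite set. Conversely, f is cut by all the translates phi_t of an almost invariant
   (Folner) function phi; commutators are small on average, and far away the cut-off function phi_t f
   only sees one of the A_J. For two-cluster decompositions these A_J are the cluster operators.

   Countability: A_J commutes with translation by s, so after a change of basis of Z^r it decomposes
   into fibres on Z^(r-1), depending continuously on a parameter in the circle. An interval whose
   ends are not in the spectrum of A_J and which meets the spectrum of one fibre meets that of every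
   fibre; hence each point of the spectrum of A_J is joined to the spectrum of a single fibre, and
   induction on r shows that the spectrum is a union of countably many intervals. *)
Require Import Defs.
From mathcomp Require Import all_boot all_order all_algebra.
From mathcomp Require Import all_classical all_reals all_analysis.
From mathcomp Require Import complex.
From mathcomp Require Import ring lra.

Import Order.TTheory GRing.Theory Num.Theory.
Import numFieldNormedType.Exports.

Local Open Scope classical_set_scope.
Local Open Scope ring_scope.
Local Open Scope complex_scope.

Set Implicit Arguments.
Unset Strict Implicit.
Unset Printing Implicit Defensive.

(** * Unordered sums *)

(** Lower bounds replace functional calculus and spectral projections: off the real axis a symmetric
    operator is bounded below by the modulus of the imaginary part, and lower bounds at a point and
    at its conjugate yield a bounded inverse through a Neumann series. Nor is a direct integral
    formed over the circle: bounds pass from the operator to a fibre by almost invariant test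
    functions, and back by a finite Fourier transform. Each passage loses a factor 2, harmless where
    only positivity matters. That an interval meets the spectra of all fibres or of none rests on a
    jump. If each fibre keeps a distance c from the ends, the distance of the midpoint from its
    spectrum is either at least the half-length or at most the half-length minus c; a quantity
    continuous in the parameter cannot cross the forbidden range. Countability cannot be read off at
    a single level: a fibre of A_J has isolated eigenvalues, enumerated by rational intervals, and
    an essential spectrum coming from smaller sets of terms. Hops are indexed abstractly so that the
    class of operators is closed under this passage. *)

Section NonnegSums.
Context {R : realType} {T : choiceType}.
Implicit Types (g h u w : T -> R).

Definition nfin g := (\esum_(t in [set: T]) (g t)%:E < +oo)%E.
(* 0 when the sum is infinite, since fine +oo = 0. *)
Definition nsum g : R := fine (\esum_(t in [set: T]) (g t)%:E).

Lemma nsum_ge0 g : (forall t, 0 <= g t) -> 0 <= nsum g.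
Proof. by move=> g0; apply/fine_ge0/esum_ge0 => t _; rewrite lee_fin. Qed.

Lemma nsumE g : (forall t, 0 <= g t) -> nfin g ->
  (\esum_(t in [set: T]) (g t)%:E)%E = (nsum g)%:E.
Proof.
move=> g0 gf; rewrite fineK// ge0_fin_numE//.
by apply/esum_ge0 => t _; rewrite lee_fin.
Qed.

Lemma nfin_le g h : (forall t, g t <= h t) -> nfin h -> nfin g.
Proof.
by move=> gh; apply: le_lt_trans; apply: le_esum => t _; rewrite lee_fin.
Qed.

Lemma nsum_le g h : (forall t, 0 <= g t) -> (forall t, g t <= h t) -> nfin h ->
  nsum g <= nsum h.
Proof.
move=> g0 gh hf; have h0 t : 0 <= h t by exact: le_trans (gh t).
have gf := nfin_le gh hf.
rewrite -lee_fin -(nsumE g0 gf) -(nsumE h0 hf).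
by apply: le_esum => t _; rewrite lee_fin.
Qed.

Lemma esumDr g h : (forall t, 0 <= g t) -> (forall t, 0 <= h t) ->
  (\esum_(t in [set: T]) (g t + h t)%:E =
   \esum_(t in [set: T]) (g t)%:E + \esum_(t in [set: T]) (h t)%:E)%E.
Proof.
by move=> g0 h0; rewrite -esumD//= => t _; rewrite lee_fin.
Qed.

Lemma nfinD g h : (forall t, 0 <= g t) -> (forall t, 0 <= h t) ->
  nfin g -> nfin h -> nfin (fun t => g t + h t).
Proof.
move=> g0 h0 gf hf; rewrite /nfin esumDr// lte_add_pinfty//.
Qed.

Lemma nsumD g h : (forall t, 0 <= g t) -> (forall t, 0 <= h t) ->
  nfin g -> nfin h -> nsum (fun t => g t + h t) = nsum g + nsum h.
Proof.
move=> g0 h0 gf hf; apply: EFin_inj.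
rewrite -nsumE//; [|by move=> t; rewrite addr_ge0|exact: nfinD].
by rewrite esumDr// !nsumE.
Qed.

Lemma esumZ (c : R) g : 0 <= c -> (forall t, 0 <= g t) ->
  (\esum_(t in [set: T]) (c * g t)%:E =
   c%:E * \esum_(t in [set: T]) (g t)%:E)%E.
Proof.
have le_ (k : R) f : 0 <= k -> (forall t, 0 <= f t) ->
  (\esum_(t in [set: T]) (k * f t)%:E <=
   k%:E * \esum_(t in [set: T]) (f t)%:E)%E.
  move=> k0 f0; apply: ge_ereal_sup => _ [X [finX XI] <-].
  rewrite fsbig_finite//=.
  under eq_bigr do rewrite EFinM.
  rewrite -ge0_sume_distrr; last by move=> t _; rewrite lee_fin.
  apply: lee_wpmul2l; first by rewrite lee_fin.
  by apply: esum_ge; exists X => //; rewrite fsbig_finite.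
move=> c0 g0; apply/eqP; rewrite eq_le le_//=.
have [->|cN0] := eqVneq c 0.
  by rewrite mul0e esum_ge0// => t _; rewrite mul0r.
have {cN0}c0 : 0 < c by rewrite lt_def cN0.
have h0 t : 0 <= c * g t by rewrite mulr_ge0// ltW.
have cV0 : 0 <= c^-1 by rewrite invr_ge0 ltW.
(* The reverse inequality is [le_] for the factor [c^-1] and the family [c * g]. *)
have := le_ _ _ cV0 h0.
under eq_esum do rewrite mulrA mulVf ?gt_eqF// mul1r.
move=> /(lee_wpmul2l (ltW c0 : (0 <= c%:E)%E)).
by rewrite muleA -EFinM divff ?gt_eqF// mul1e.
Qed.

Lemma nfinZ (c : R) g : 0 <= c -> (forall t, 0 <= g t) -> nfin g ->
  nfin (fun t => c * g t).
Proof.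
move=> c0 g0 gf; rewrite /nfin esumZ// nsumE//.
by rewrite -EFinM ltry.
Qed.

Lemma nsumZ (c : R) g : 0 <= c -> (forall t, 0 <= g t) -> nfin g ->
  nsum (fun t => c * g t) = c * nsum g.
Proof. by move=> c0 g0 gf; rewrite /nsum esumZ// nsumE. Qed.

Lemma nfin_partial g (c : R) : (forall t, 0 <= g t) ->
  (forall s : seq T, uniq s -> \sum_(t <- s) g t <= c) ->
  nfin g /\ nsum g <= c.
Proof.
move=> g0 H.
have le_ : (\esum_(t in [set: T]) (g t)%:E <= c%:E)%E.
  apply: ge_ereal_sup => _ [X [finX XI] <-].
  by rewrite fsbig_finite//= sumEFin lee_fin H.
have gf : nfin g by apply: le_lt_trans le_ _; rewrite ltry.
by split => //; rewrite -lee_fin -nsumE.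
Qed.

Lemma partial_nsum g (s : seq T) : (forall t, 0 <= g t) -> nfin g -> uniq s ->
  \sum_(t <- s) g t <= nsum g.
Proof.
move=> g0 gf us; rewrite -lee_fin -nsumE// -sumEFin.
apply: esum_ge; exists [set` s]; first by split.
by rewrite fsbig_seq.
Qed.

Lemma nsum_term g t : (forall t, 0 <= g t) -> nfin g -> g t <= nsum g.
Proof. by move=> g0 gf; have := @partial_nsum g [:: t] g0 gf isT; rewrite big_seq1. Qed.

Lemma nsum_finsupp g (s : seq T) : (forall t, 0 <= g t) -> uniq s ->
  (forall t, t \notin s -> g t = 0) -> nfin g /\ nsum g = \sum_(t <- s) g t.
Proof.
move=> g0 us gs.
have [gf le_] : nfin g /\ nsum g <= \sum_(t <- s) g t.
  apply: nfin_partial => // s' us'.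
  rewrite (bigID (mem s))/= [X in _ + X]big1 ?addr0; last by move=> t /gs.
  rewrite -big_filter (perm_big [seq t <- s | t \in s']); last first.
    apply: uniq_perm; rewrite ?filter_uniq// => t.
    by rewrite !mem_filter andbC.
  rewrite big_filter [leRHS](bigID (mem s'))/= lerDl.
  by apply: sumr_ge0 => t _.
by split => //; apply/eqP; rewrite eq_le le_/= partial_nsum.
Qed.

Lemma nsum_tail g (e : R) : (forall t, 0 <= g t) -> nfin g -> 0 < e ->
  exists2 s : seq T, uniq s &
    nsum (fun t => if t \in s then 0 else g t) <= e.
Proof.
move=> g0 gf e0.
have : ((nsum g - e)%:E < \esum_(t in [set: T]) (g t)%:E)%E.
  by rewrite nsumE// lte_fin ltrBlDr ltrDl.
move=> /ereal_sup_gt[_ [X [finX _] <-]]; rewrite fsbig_finite//= sumEFin lte_fin.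
move=> lt_; set s : seq T := finmap.enum_fset (fset_set X) in lt_ *.
have us : uniq s by exact: finmap.fset_uniq.
exists s => //.
have p0 t : 0 <= (if t \in s then 0 else g t) by case: ifP.
have q0 t : 0 <= (if t \in s then g t else 0) by case: ifP.
have pf : nfin (fun t => if t \in s then 0 else g t).
  by apply: nfin_le gf => t; case: ifP.
have [qf qE] := @nsum_finsupp (fun t => if t \in s then g t else 0) s q0
  us (fun t ts => ifN _ _ ts).
have -> : nsum (fun t => if t \in s then 0 else g t) =
    nsum g - \sum_(t <- s) g t.
  rewrite (_ : \sum_(t <- s) g t = nsum (fun t => if t \in s then g t else 0)); last first.
    by rewrite qE; apply: eq_big_seq => t ->.
  apply/eqP; rewrite -subr_eq opprK -nsumD//.
  by apply/eqP; congr nsum; apply/funext => t; case: ifP; rewrite ?add0r ?addr0.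
by rewrite lerBlDl -lerBlDr ltW.
Qed.

End NonnegSums.

Lemma nsum_reindex {R : realType} {T T' : choiceType} (e : T -> T') (g : T' -> R) :
  bijective e ->
  (\esum_(t in [set: T']) (g t)%:E)%E = (\esum_(t in [set: T]) (g (e t))%:E)%E.
Proof.
move=> [e' eK e'K]; apply: (reindex_esum [set: T] [set: T'] e (fun t => (g t)%:E)).
by split => // [x y _ _ /(can_inj eK)//|y _]; exists (e' y).
Qed.

(** * Exchange of nonnegative sums *)

Section Tonelli.
Context {R : realType} {T T' : choiceType}.

Lemma esum_prod (g : T -> T' -> R) : (forall t t', 0 <= g t t') ->
  (\esum_(t in [set: T]) \esum_(t' in [set: T']) (g t t')%:E =
   \esum_(p in [set: (T * T')%type]) (g p.1 p.2)%:E)%E.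
Proof.
move=> g0; rewrite esum_esum; last by move=> *; rewrite lee_fin.
by congr esum; apply/seteqP; split => // -[].
Qed.

Lemma esum_exchange (g : T -> T' -> R) : (forall t t', 0 <= g t t') ->
  (\esum_(t in [set: T]) \esum_(t' in [set: T']) (g t t')%:E =
   \esum_(t' in [set: T']) \esum_(t in [set: T]) (g t t')%:E)%E.
Proof.
move=> g0; rewrite esum_prod//.
rewrite (@nsum_reindex _ _ _ (fun p : T' * T => (p.2, p.1))
   (fun p => g p.1 p.2)); last by exists (fun p : T * T' => (p.2, p.1)); case.
by rewrite esum_esum; [congr esum; apply/seteqP; split => // -[]|move=> *; rewrite lee_fin].
Qed.

End Tonelli.

(** * Absolutely summable real families *)

Section SignedSums.
Context {R : realType} {T : choiceType}.
Implicit Types (g h u w : T -> R).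

Definition abssum g := nfin (fun t => `|g t|).

(** With [p] and [q] the positive and negative parts of [u - w], the identity [p + w = q + u]
    between nonnegative families can be summed. Hence any splitting computes [rsum], and linearity
    follows from convenient splittings. *)
Lemma rsum_split u w : (forall t, 0 <= u t) -> (forall t, 0 <= w t) ->
  nfin u -> nfin w -> rsum (fun t => u t - w t) = nsum u - nsum w.
Proof.
move=> u0 w0 uf wf; rewrite /rsum.
rewrite -[fine _]/(nsum (fun t => Num.max (u t - w t) 0)).
rewrite -[X in _ - X]/(nsum (fun t => Num.max (- (u t - w t)) 0)).
set p := (fun t => Num.max (u t - w t) 0); set q := (fun t => Num.max (- (u t - w t)) 0).
have p0 t : 0 <= p t by rewrite /p le_max lexx orbT.
have q0 t : 0 <= q t by rewrite /q le_max lexx orbT.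
have pf : nfin p by apply: nfin_le uf => t; rewrite /p ge_max u0 andbT; have := w0 t; lra.
have qf : nfin q by apply: nfin_le wf => t; rewrite /q ge_max w0 andbT; have := u0 t; lra.
have : nsum (fun t => p t + w t) = nsum (fun t => q t + u t).
  congr nsum; apply/funext => t; rewrite /p /q.
  by case: (leP (u t - w t) 0) => h1; case: (leP (- (u t - w t)) 0) => h2; lra.
by rewrite !nsumD// => h; lra.
Qed.

Lemma rsum_pn g : rsum g = nsum (fun t => Num.max (g t) 0) - nsum (fun t => Num.max (- g t) 0).
Proof. by []. Qed.

Lemma abssum_pos g : abssum g -> nfin (fun t => Num.max (g t) 0).
Proof. by apply: nfin_le => t; rewrite ge_max normr_ge0 ler_norm. Qed.

Lemma abssum_neg g : abssum g -> nfin (fun t => Num.max (- g t) 0).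
Proof. by apply: nfin_le => t; rewrite ge_max normr_ge0 -normrN ler_norm. Qed.

Let pos0 g t : 0 <= Num.max (g t) 0.
Proof. by rewrite le_max lexx orbT. Qed.

Let neg0 g t : 0 <= Num.max (- g t) 0.
Proof. by rewrite le_max lexx orbT. Qed.

Let maxE (x : R) : x = Num.max x 0 - Num.max (- x) 0.
Proof. by case: (leP x 0) => ?; case: (leP (- x) 0) => ?; lra. Qed.

Lemma abssumD g h : abssum g -> abssum h -> abssum (fun t => g t + h t).
Proof.
move=> gf hf; have : nfin (fun t => `|g t| + `|h t|) by apply: nfinD.
by apply: nfin_le => t; exact: ler_normD.
Qed.

Lemma rsumD g h : abssum g -> abssum h ->
  rsum (fun t => g t + h t) = rsum g + rsum h.
Proof.
move=> gf hf; rewrite [rsum g]rsum_pn [rsum h]rsum_pn.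
have -> : (fun t => g t + h t) =
    (fun t => (Num.max (g t) 0 + Num.max (h t) 0) -
              (Num.max (- g t) 0 + Num.max (- h t) 0)).
  apply/funext => t; have := maxE (g t); have := maxE (h t); lra.
have := abssum_pos gf; have := abssum_neg gf; have := abssum_pos hf; have := abssum_neg hf.
move=> *; rewrite rsum_split//; do ?[exact: nfinD | by move=> t; rewrite addr_ge0].
by rewrite !nsumD//; lra.
Qed.

Lemma rsumN g : rsum (fun t => - g t) = - rsum g.
Proof.
rewrite !rsum_pn opprB; congr (_ - _).
by congr nsum; apply/funext => t; rewrite opprK.
Qed.

Lemma abssumN g : abssum g -> abssum (fun t => - g t).
Proof. by apply: nfin_le => t; rewrite normrN. Qed.

Lemma abssumZ c g : abssum g -> abssum (fun t => c * g t).
Proof.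
move=> gf; have := @nfinZ _ _ `|c| (fun t => `|g t|) (normr_ge0 _) (fun t => normr_ge0 _) gf.
by apply: nfin_le => t; rewrite normrM.
Qed.

Lemma rsumZ c g : abssum g -> rsum (fun t => c * g t) = c * rsum g.
Proof.
have pos (k : R) : 0 <= k -> abssum g -> rsum (fun t => k * g t) = k * rsum g.
  move=> k0 gf; rewrite [rsum g]rsum_pn mulrBr -!nsumZ//; do ?[exact: abssum_pos|exact: abssum_neg].
  rewrite rsum_pn; congr (_ - _); congr nsum; apply/funext => t;
    by rewrite maxr_pMr ?mulr0 ?mulrN.
move=> gf; case: (leP 0 c) => c0; first exact: pos.
have -> : (fun t => c * g t) = (fun t => - ((- c) * g t)) by apply/funext => t; ring.
by rewrite rsumN pos ?oppr_ge0 ?ltW//; ring.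
Qed.

Lemma rsum_nonneg g : (forall t, 0 <= g t) -> rsum g = nsum g.
Proof.
move=> g0; rewrite rsum_pn.
have -> : (fun t => Num.max (- g t) 0) = (fun=> 0).
  by apply/funext => t; apply: max_r; rewrite oppr_le0.
have -> : nsum (fun _ : T => 0 : R) = 0 by rewrite /nsum esum1.
by rewrite subr0; congr nsum; apply/funext => t; apply: max_l.
Qed.

Lemma rsum_norm g : abssum g -> `|rsum g| <= nsum (fun t => `|g t|).
Proof.
move=> gf; have p := abssum_pos gf; have n := abssum_neg gf.
have : nsum (fun t => `|g t|) = nsum (fun t => Num.max (g t) 0) + nsum (fun t => Num.max (- g t) 0).
  rewrite -nsumD//; congr nsum; apply/funext => t.
  by case: (leP (g t) 0) => ?; case: (leP (- g t) 0) => ?;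
    [rewrite ler0_norm//|rewrite ler0_norm//|rewrite gtr0_norm//|]; lra.
have := nsum_ge0 (fun t => pos0 g t); have := nsum_ge0 (fun t => neg0 g t).
by rewrite rsum_pn ler_norml => *; apply/andP; split; lra.
Qed.

Lemma rsum_finsupp g (s : seq T) : uniq s -> (forall t, t \notin s -> g t = 0) ->
  abssum g /\ rsum g = \sum_(t <- s) g t.
Proof.
move=> us gs.
have [|af _] := @nsum_finsupp _ _ (fun t => `|g t|) s (fun t => normr_ge0 _) us.
  by move=> t /gs ->; rewrite normr0.
split => //; rewrite rsum_pn.
have [|_ ->] := @nsum_finsupp _ _ (fun t => Num.max (g t) 0) s (fun t => pos0 g t) us.
  by move=> t /gs ->; rewrite maxxx.
have [|_ ->] := @nsum_finsupp _ _ (fun t => Num.max (- g t) 0) s (fun t => neg0 g t) us.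
  by move=> t /gs ->; rewrite oppr0 maxxx.
by rewrite -sumrB; apply: eq_bigr => t _; rewrite -maxE.
Qed.

End SignedSums.

Lemma rsum_reindex {R : realType} {T T' : choiceType} (e : T -> T') (g : T' -> R) :
  bijective e -> rsum g = rsum (fun t => g (e t)).
Proof.
move=> be; rewrite /rsum (nsum_reindex (fun t => Num.max (g t) 0) be).
by rewrite (nsum_reindex (fun t => Num.max (- g t) 0) be).
Qed.

(** * The Hilbert space l2 *)

Section Dotc.
Context {R : realType}.
Implicit Types z w : R[i].

(** The real part of [z * w^*]. The real part alone still determines the adjoint of a complex-linear
    operator, since multiplying one argument by ['i] recovers the imaginary part. *)
Definition dotc z w : R := complex.Re z * complex.Re w + complex.Im z * complex.Im w.

Lemma normc2 z : Normc.normc z ^+ 2 = dotc z z.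
Proof. by case: z => a b; rewrite /dotc /= sqr_sqrtr ?addr_ge0 ?sqr_ge0// !expr2. Qed.

Lemma normc_ge0 z : 0 <= Normc.normc z.
Proof. by case: z => a b; exact: sqrtr_ge0. Qed.

Lemma dotcC z w : dotc z w = dotc w z.
Proof. by rewrite /dotc; ring. Qed.

Lemma dotcDl z z' w : dotc (z + z') w = dotc z w + dotc z' w.
Proof. by case: z z' w => [a b] [c e] [g h]; rewrite /dotc /=; ring. Qed.

Lemma dotc_mul c z w : dotc (c * z) w = dotc z (c^*%C * w).
Proof. by case: c z w => [a b] [c e] [g h]; rewrite /dotc /=; ring. Qed.

Lemma dotc_sqr c z : dotc (c * z) (c * z) = Normc.normc c ^+ 2 * dotc z z.
Proof. by rewrite normc2; case: c z => [a b] [c e]; rewrite /dotc /=; ring. Qed.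

Lemma dotc_ge0 z : 0 <= dotc z z.
Proof. by rewrite -normc2 sqr_ge0. Qed.

Lemma dotc_le z w : `|dotc z w| <= dotc z z + dotc w w.
Proof.
case: z w => [a b] [c e]; rewrite /dotc /= ler_norml.
have := sqr_ge0 (a + c); have := sqr_ge0 (b + e).
have := sqr_ge0 (a - c); have := sqr_ge0 (b - e); have := sqr_ge0 a; have := sqr_ge0 b.
have := sqr_ge0 c; have := sqr_ge0 e; rewrite !expr2 => *.
by apply/andP; split; nra.
Qed.

Lemma normc_dotcD z w : dotc (z + w) (z + w) <= 2 * dotc z z + 2 * dotc w w.
Proof.
case: z w => [a b] [c e]; rewrite /dotc /=.
have := sqr_ge0 (a - c); have := sqr_ge0 (b - e); rewrite !expr2 => *; nra.
Qed.

Lemma normc_real (r : R) : Normc.normc r%:C = `|r|.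
Proof. by rewrite /= expr0n/= addr0 sqrtr_sqr. Qed.

Lemma normc_conj z : Normc.normc z^* = Normc.normc z.
Proof. by case: z => a b; rewrite /= sqrrN. Qed.

Lemma ler_normcD z w : Normc.normc (z + w) <= Normc.normc z + Normc.normc w.
Proof. exact: le_normcD. Qed.

Lemma normcN' z : Normc.normc (- z) = Normc.normc z.
Proof. exact: normcN. Qed.

Lemma Re_normc z : `|complex.Re z| <= Normc.normc z.
Proof.
rewrite -(@ler_pXn2r _ 2) ?nnegrE ?normc_ge0// normc2 /dotc real_normK ?num_real//.
by rewrite expr2 lerDl -expr2 sqr_ge0.
Qed.

Lemma Im_normc z : `|complex.Im z| <= Normc.normc z.
Proof.
rewrite -(@ler_pXn2r _ 2) ?nnegrE ?normc_ge0// normc2 /dotc real_normK ?num_real//.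
by rewrite expr2 lerDr -expr2 sqr_ge0.
Qed.

Lemma normc_le_ReIm z : Normc.normc z <= `|complex.Re z| + `|complex.Im z|.
Proof.
rewrite -(@ler_pXn2r _ 2) ?nnegrE ?normc_ge0 ?addr_ge0// normc2 /dotc sqrrD.
rewrite !real_normK ?num_real// -!expr2 addrAC lerDl mulrn_wge0// mulr_ge0//.
Qed.

End Dotc.

Section L2.
Context {R : realType} {X : choiceType}.
Implicit Types (f g h : X -> R[i]).

Definition scal (c : R[i]) f : X -> R[i] := fun x => c * f x.

Definition ip f g : R := rsum (fun x => dotc (f x) (g x)).

Lemma l2E f : l2 f <-> nfin (fun x => dotc (f x) (f x)).
Proof.
by rewrite /l2 (eq_esum (fun x _ => congr1 EFin (normc2 (f x)))).
Qed.

Lemma l2normE f : l2norm f = Num.sqrt (nsum (fun x => dotc (f x) (f x))).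
Proof. by rewrite /l2norm (eq_esum (fun x _ => congr1 EFin (normc2 (f x)))). Qed.

Lemma l2norm_ge0 f : 0 <= l2norm f.
Proof. exact: sqrtr_ge0. Qed.

Lemma l2norm2 f : l2norm f ^+ 2 = ip f f.
Proof.
have h x : 0 <= dotc (f x) (f x) by exact: dotc_ge0.
by rewrite l2normE sqr_sqrtr ?nsum_ge0// /ip rsum_nonneg.
Qed.

Lemma l2_add f g : l2 f -> l2 g -> l2 (f + g).
Proof.
move=> /l2E fl /l2E gl; apply/l2E.
have : nfin (fun x => 2 * dotc (f x) (f x) + 2 * dotc (g x) (g x)).
  by apply: nfinD; do ?[apply: nfinZ => //]; move=> *; rewrite ?mulr_ge0// dotc_ge0.
by apply: nfin_le => x; exact: normc_dotcD.
Qed.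

Lemma l2_scal c f : l2 f -> l2 (scal c f).
Proof.
move=> /l2E fl; apply/l2E.
have : nfin (fun x => Normc.normc c ^+ 2 * dotc (f x) (f x)).
  by apply: nfinZ => //; [exact: sqr_ge0|move=> x; exact: dotc_ge0].
by apply: nfin_le => x; rewrite dotc_sqr.
Qed.

Lemma scalN1 f : scal (-1) f = - f.
Proof. by apply/funext => x; rewrite /scal mulN1r. Qed.

Lemma l2_opp f : l2 f -> l2 (- f).
Proof. by move=> fl; rewrite -scalN1; exact: l2_scal. Qed.

Lemma l2_sub f g : l2 f -> l2 g -> l2 (f - g).
Proof. by move=> fl gl; apply: l2_add => //; exact: l2_opp. Qed.

Lemma l2_0 : l2 (0 : X -> R[i]).
Proof.
apply/l2E; rewrite /nfin esum1 ?ltry// => x _.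
by rewrite /dotc /= !mulr0 addr0.
Qed.

Lemma l2_sum (I : Type) (s : seq I) (P : pred I) (F : I -> X -> R[i]) :
  (forall i, l2 (F i)) -> l2 (\sum_(i <- s | P i) F i).
Proof.
by move=> H; elim/big_ind: _ => // [|f g]; [exact: l2_0|exact: l2_add].
Qed.

Lemma l2_dotc f g : l2 f -> l2 g -> abssum (fun x => dotc (f x) (g x)).
Proof.
move=> /l2E fl /l2E gl.
have : nfin (fun x => dotc (f x) (f x) + dotc (g x) (g x)).
  by apply: nfinD => // *; exact: dotc_ge0.
by apply: nfin_le => x; exact: dotc_le.
Qed.

Lemma ipC f g : ip f g = ip g f.
Proof. by congr rsum; apply/funext => x; exact: dotcC. Qed.

Lemma ipDl f g h : l2 f -> l2 g -> l2 h -> ip (f + g) h = ip f h + ip g h.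
Proof.
move=> fl gl hl; rewrite -rsumD; [|exact: l2_dotc..].
by congr rsum; apply/funext => x; exact: dotcDl.
Qed.

Lemma ip_scall c f g : ip (scal c f) g = ip f (scal c^* g).
Proof. by congr rsum; apply/funext => x; exact: dotc_mul. Qed.

Lemma ip_real (r : R) f g : l2 f -> l2 g -> ip (scal r%:C f) g = r * ip f g.
Proof.
move=> fl gl; rewrite -rsumZ; last exact: l2_dotc.
by congr rsum; apply/funext => x; rewrite /dotc /scal; case: (f x) => a b /=; ring.
Qed.

Lemma ip_realr (r : R) f g : l2 f -> l2 g -> ip f (scal r%:C g) = r * ip f g.
Proof. by move=> fl gl; rewrite ipC ip_real// ipC. Qed.

Lemma ipNl f g : l2 f -> l2 g -> ip (- f) g = - ip f g.
Proof.
move=> fl gl; rewrite -rsumN; congr rsum; apply/funext => x.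
by change ((- f) x) with (- f x); rewrite /dotc; case: (f x) => a b /=; ring.
Qed.

Lemma ipBl f g h : l2 f -> l2 g -> l2 h -> ip (f - g) h = ip f h - ip g h.
Proof. by move=> fl gl hl; rewrite ipDl ?ipNl//; exact: l2_opp. Qed.

Lemma ipDr f g h : l2 f -> l2 g -> l2 h -> ip f (g + h) = ip f g + ip f h.
Proof. by move=> *; rewrite ipC ipDl// ![ip _ f]ipC. Qed.

Lemma ipBr f g h : l2 f -> l2 g -> l2 h -> ip f (g - h) = ip f g - ip f h.
Proof. by move=> *; rewrite ipC ipBl// ![ip _ f]ipC. Qed.

Lemma ip_lin f g (t : R) : l2 f -> l2 g ->
  l2norm (f + scal t%:C g) ^+ 2 =
  l2norm f ^+ 2 + 2 * t * ip f g + t ^+ 2 * l2norm g ^+ 2.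
Proof.
move=> fl gl; have tl : l2 (scal t%:C g) by exact: l2_scal.
rewrite !l2norm2 ipDl ?ipDr//; try exact: l2_add.
by rewrite !ip_real ?ip_realr// (ipC g f); ring.
Qed.

Lemma l2normD2 f g : l2 f -> l2 g ->
  l2norm (f + g) ^+ 2 = l2norm f ^+ 2 + 2 * ip f g + l2norm g ^+ 2.
Proof.
move=> fl gl; rewrite !l2norm2 ipDl ?ipDr//; last exact: l2_add.
by rewrite (ipC g f); ring.
Qed.

Lemma discr_le (a b c : R) : 0 <= a -> 0 <= c ->
  (forall t, 0 <= a + 2 * t * b + t ^+ 2 * c) -> b ^+ 2 <= a * c.
Proof.
move=> a0 c0 H; have [c00|cN0] := eqVneq c 0.
  rewrite c00 mulr0; have [->|bN0] := eqVneq b 0; first by rewrite expr0n.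
  (* For [c = 0] the expression is affine in [t], and its value at this [t] is [-1]. *)
  have := H (- (a + 1) / (2 * b)); rewrite c00 mulr0 addr0.
  have -> : 2 * (- (a + 1) / (2 * b)) * b = - (a + 1) by field.
  lra.
have c1 : 0 < c by rewrite lt_def cN0.
have := H (- b / c).
have -> : a + 2 * (- b / c) * b + (- b / c) ^+ 2 * c = (a * c - b ^+ 2) / c by field.
by rewrite pmulr_lge0 ?invr_gt0// subr_ge0.
Qed.

Lemma cauchy_schwarz f g : l2 f -> l2 g -> `|ip f g| <= l2norm f * l2norm g.
Proof.
move=> fl gl.
rewrite -(@ler_pXn2r _ 2) ?nnegrE ?mulr_ge0 ?l2norm_ge0// exprMn real_normK ?num_real//.
apply: discr_le; rewrite ?sqr_ge0// => t; rewrite -ip_lin//; exact: sqr_ge0.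
Qed.

Lemma l2normD f g : l2 f -> l2 g -> l2norm (f + g) <= l2norm f + l2norm g.
Proof.
move=> fl gl; have f0 := l2norm_ge0 f; have g0 := l2norm_ge0 g.
rewrite -(@ler_pXn2r _ 2) ?nnegrE ?addr_ge0 ?l2norm_ge0//.
rewrite l2normD2// sqrrD; have := cauchy_schwarz fl gl.
have := ler_norm (ip f g); lra.
Qed.

Lemma l2norm_scal c f : l2 f -> l2norm (scal c f) = Normc.normc c * l2norm f.
Proof.
move=> fl; apply/eqP; rewrite -(@eqrXn2 _ 2) ?mulr_ge0 ?l2norm_ge0 ?normc_ge0//.
apply/eqP; rewrite exprMn !l2norm2 /ip -rsumZ; last exact: l2_dotc.
by congr rsum; apply/funext => x; exact: dotc_sqr.
Qed.

Lemma l2normN f : l2norm (- f) = l2norm f.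
Proof.
rewrite !l2normE; congr (Num.sqrt (nsum _)); apply/funext => x.
by change ((- f) x) with (- f x); rewrite /dotc; case: (f x) => a b /=; ring.
Qed.

Lemma l2normB f g : l2 f -> l2 g -> l2norm (f - g) <= l2norm f + l2norm g.
Proof. by move=> fl gl; rewrite -(l2normN g) l2normD//; exact: l2_opp. Qed.

Lemma l2norm_subC f g : l2norm (f - g) = l2norm (g - f).
Proof. by rewrite -l2normN opprB. Qed.

Lemma l2norm_lb f g : l2 f -> l2 g -> l2norm f - l2norm g <= l2norm (f - g).
Proof.
move=> fl gl; have := l2normD (l2_sub fl gl) gl; rewrite subrK; lra.
Qed.

Lemma l2norm_lbD f g : l2 f -> l2 g -> l2norm f - l2norm g <= l2norm (f + g).
Proof.
move=> fl gl; have := l2norm_lb fl (l2_opp gl); by rewrite l2normN opprK.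
Qed.

Lemma l2norm0 : l2norm (0 : X -> R[i]) = 0.
Proof.
have -> : (0 : X -> R[i]) = scal 0 0 by apply/funext => x; rewrite /scal mul0r.
by rewrite l2norm_scal ?Normc.normc0 ?mul0r//; exact: l2_0.
Qed.

Lemma l2norm_pt f x : l2 f -> Normc.normc (f x) <= l2norm f.
Proof.
move=> /l2E fl.
rewrite -(@ler_pXn2r _ 2) ?nnegrE ?normc_ge0 ?l2norm_ge0// normc2 l2norm2 /ip.
rewrite rsum_nonneg; last by move=> *; exact: dotc_ge0.
by apply: (@nsum_term _ _ (fun x => dotc (f x) (f x))) => // *; exact: dotc_ge0.
Qed.

Lemma l2norm_eq0 f : l2 f -> l2norm f <= 0 -> f = 0.
Proof.
move=> fl f0; apply/funext => x; apply: Normc.eq0_normc; apply/eqP.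
by rewrite eq_le normc_ge0 andbT (le_trans (l2norm_pt x fl)).
Qed.

Lemma l2norm_sum (I : Type) (s : seq I) (F : I -> X -> R[i]) :
  (forall i, l2 (F i)) -> l2norm (\sum_(i <- s) F i) <= \sum_(i <- s) l2norm (F i).
Proof.
move=> Fl; elim: s => [|i s IH]; first by rewrite !big_nil l2norm0.
rewrite !big_cons (le_trans (l2normD (Fl i) (l2_sum _ _ Fl)))//.
by rewrite lerD2l.
Qed.

Lemma l2_partial f (c : R) : 0 <= c ->
  (forall s : seq X, uniq s -> \sum_(x <- s) dotc (f x) (f x) <= c ^+ 2) ->
  l2 f /\ l2norm f <= c.
Proof.
move=> c0 H.
have [fl le_] := nfin_partial (fun x => dotc_ge0 (f x)) H.
split; first exact/l2E.
rewrite -(@ler_pXn2r _ 2) ?nnegrE ?l2norm_ge0// l2norm2 /ip rsum_nonneg//.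
by move=> x; exact: dotc_ge0.
Qed.

Lemma l2_le f g : (forall x, Normc.normc (f x) <= Normc.normc (g x)) -> l2 g ->
  l2 f /\ l2norm f <= l2norm g.
Proof.
move=> fg /l2E gl.
have le_ x : dotc (f x) (f x) <= dotc (g x) (g x).
  by rewrite -!normc2 ler_pXn2r ?nnegrE ?normc_ge0.
split; first by apply/l2E; exact: nfin_le gl.
rewrite !l2normE ler_sqrt ?nsum_ge0//; last by move=> x; exact: dotc_ge0.
by apply: nsum_le => // x; exact: dotc_ge0.
Qed.

Definition rest (P : pred X) f : X -> R[i] := fun x => if P x then f x else 0.

Lemma l2_rest P f : l2 f -> l2 (rest P f) /\ l2norm (rest P f) <= l2norm f.
Proof.
by apply: l2_le => x; rewrite /rest; case: ifP => // _; rewrite Normc.normc0 normc_ge0.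
Qed.

Lemma rest_split P f : f = rest P f + rest (fun x => ~~ P x) f.
Proof.
apply/funext => x; rewrite /rest.
change (f x = (if P x then f x else 0) + (if ~~ P x then f x else 0)).
by case: (P x); rewrite /= ?addr0 ?add0r.
Qed.

Lemma restB P f g : rest P (f - g) = rest P f - rest P g.
Proof.
apply/funext => x; rewrite /rest.
change ((if P x then f x - g x else 0) = (if P x then f x else 0) - (if P x then g x else 0)).
by case: (P x); rewrite ?subr0.
Qed.

Lemma l2_tail f (e : R) : l2 f -> 0 < e ->
  exists2 s : seq X, uniq s & l2norm (rest (fun x => x \notin s) f) <= e.
Proof.
move=> /[dup] fl /l2E fn e0.
have [s us le_] := nsum_tail (fun x => dotc_ge0 (f x)) fn (exprn_gt0 2 e0).
exists s => //.
rewrite -(@ler_pXn2r _ 2) ?nnegrE ?l2norm_ge0 ?(ltW e0)//.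
apply: le_trans le_; rewrite l2norm2 /ip rsum_nonneg => [|x]; last exact: dotc_ge0.
rewrite le_eqVlt; apply/orP; left; apply/eqP.
by congr nsum; apply/funext => x; rewrite /rest; case: (x \in s); rewrite //= /dotc/= !mulr0 addr0.
Qed.

(** The factor is not sharp; the bound is meant for a fixed [s] and [c] tending to 0. *)
Lemma l2norm_rest_le (s : seq X) f (c : R) : uniq s -> 0 <= c ->
  (forall x, Normc.normc (f x) <= c) ->
  l2 (rest (mem s) f) /\ l2norm (rest (mem s) f) <= (size s)%:R * c.
Proof.
move=> us c0 fc; apply: l2_partial; first by rewrite mulr_ge0.
move=> s' us'.
have le1 x : dotc (rest (mem s) f x) (rest (mem s) f x) <= (x \in s)%:R * c ^+ 2.
  rewrite /rest; case: ifP => /= [->|->]; last by rewrite mul0r /dotc/= !mulr0 addr0.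
  by rewrite mul1r -normc2 ler_pXn2r ?nnegrE ?normc_ge0.
apply: le_trans (ler_sum _ (fun x _ => le1 x)) _.
rewrite -mulr_suml exprMn ler_wpM2r ?sqr_ge0//.
have -> : \sum_(x <- s') (x \in s)%:R = (size [seq x <- s' | x \in s])%:R :> R.
  by rewrite size_filter -sum1_count natr_sum [RHS]big_mkcond /=; apply: eq_bigr => x _; case: (x \in s).
have : (size [seq x <- s' | x \in s] <= size s)%N.
  apply: uniq_leq_size; first exact: filter_uniq.
  by move=> x; rewrite mem_filter => /andP[].
case: s {us fc le1} => [|y s] h; first by move: h; rewrite leqn0 => /eqP ->; rewrite expr0n.
apply: (@le_trans _ _ (size (y :: s))%:R); first by rewrite ler_nat.
by rewrite -natrX ler_nat /= expnS expn1 leq_pmulr.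
Qed.

End L2.

(** Any two of the intervals of centre [a n] and radius [e n] share the centre of later index, so
    every left end lies below every right end, and the supremum of the left ends is common to
    all. *)
Lemma nested_limit {R : realType} (a e : nat -> R) :
  (forall n m, (n <= m)%N -> `|a n - a m| <= e n) -> exists l, forall n, `|a n - l| <= e n.
Proof.
move=> H; pose A := [set a n - e n | n in [set: nat]].
have ub m : ubound A (a m + e m).
  move=> _ [n _ <-].
  have h1 := H n (maxn n m) (leq_maxl _ _); have h2 := H m (maxn n m) (leq_maxr _ _).
  by move: h1 h2; rewrite !ler_norml => /andP[? ?] /andP[? ?]; lra.
have A0 : A !=set0 by exists (a 0%N - e 0%N); exists 0%N.
exists (sup A) => n; rewrite ler_norml.
have h1 : sup A <= a n + e n by apply: ge_sup.
have h2 : a n - e n <= sup A by apply: ub_le_sup; [exists (a 0%N + e 0%N); exact: ub|exists n].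
by apply/andP; split; lra.
Qed.

(** * Completeness of l2 *)

Section Complete.
Context {R : realType} {X : choiceType}.

(** The candidate is the coordinatewise limit. On a finite set [s], the difference [u n - f] is
    split at [u m]: the part [u n - u m] is at most [e n], and [u m - f] is at most [size s] times a
    pointwise error, negligible for a suitable late [m]. The bound is uniform in [s]. *)
Lemma l2_complete (u : nat -> X -> R[i]) (e : nat -> R) :
  (forall n, l2 (u n)) ->
  (forall n m, (n <= m)%N -> l2norm (u n - u m) <= e n) ->
  (forall d, 0 < d -> forall n, exists2 m, (n <= m)%N & e m <= d) ->
  exists2 f, l2 f & forall n, l2norm (u n - f) <= e n.
Proof.
move=> ul uc e0.
have pt n m x : (n <= m)%N -> Normc.normc (u n x - u m x) <= e n.
  by move=> nm; apply: le_trans (uc n m nm); apply: (l2norm_pt x (f := u n - u m)); exact: l2_sub.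
have en n : 0 <= e n by apply: le_trans (uc n n (leqnn _)); exact: l2norm_ge0.
have Re_ x : exists l, forall n, `|complex.Re (u n x) - l| <= e n.
  apply: nested_limit => n m nm; apply: le_trans (pt n m x nm).
  by apply: le_trans (Re_normc _); case: (u n x) (u m x) => [? ?] [? ?].
have Im_ x : exists l, forall n, `|complex.Im (u n x) - l| <= e n.
  apply: nested_limit => n m nm; apply: le_trans (pt n m x nm).
  by apply: le_trans (Im_normc _); case: (u n x) (u m x) => [? ?] [? ?].
have [fr frP] := choice Re_; have [fi fiP] := choice Im_.
pose f x : R[i] := fr x +i* fi x.
have fP n x : Normc.normc ((u n - f) x) <= e n *+ 2.
  apply: le_trans (normc_le_ReIm _) _; have := frP x n; have := fiP x n.
  change ((u n - f) x) with (u n x - f x); rewrite /f.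
  by case: (u n x) => a b /=; rewrite mulr2n; lra.
have key n : l2 (u n - f) /\ l2norm (u n - f) <= e n.
  apply: l2_partial => // s us.
  have rl m : l2 (rest (mem s) (u m - f)) /\ l2norm (rest (mem s) (u m - f)) <= (size s)%:R * (e m *+ 2).
    by apply: l2norm_rest_le => //; rewrite mulrn_wge0.
  have le1 : l2norm (rest (mem s) (u n - f)) <= e n.
    apply/ler_addgt0Pr => d d0.
    have d1 : 0 < d / ((size s)%:R *+ 2 + 1).
      by rewrite divr_gt0// ltr_wpDl// mulrn_wge0.
    have [m nm em] := e0 _ d1 n.
    have -> : rest (mem s) (u n - f) = rest (mem s) (u n - u m) + rest (mem s) (u m - f).
      by rewrite !restB addrA subrK.
    have [l1 n1] := l2_rest (mem s) (l2_sub (ul n) (ul m)).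
    have [l2' n2] := rl m.
    apply: le_trans (l2normD l1 l2') _; apply: lerD.
      by apply: le_trans n1 _; exact: uc.
    apply: le_trans n2 _.
    move: em; rewrite ler_pdivlMr; last by rewrite ltr_wpDl// mulrn_wge0.
    have := en m; have : 0 <= (size s)%:R :> R by [].
    rewrite !mulr2n; nra.
  have [rl1 _] := rl n.
  have : l2norm (rest (mem s) (u n - f)) ^+ 2 <= e n ^+ 2.
    by rewrite ler_pXn2r ?nnegrE ?l2norm_ge0.
  apply: le_trans; rewrite l2norm2 /ip rsum_nonneg => [|x]; last exact: dotc_ge0.
  have h := partial_nsum (fun x => dotc_ge0 (rest (mem s) (u n - f) x)) ((l2E _).1 rl1) us.
  apply: (le_trans _ h); rewrite le_eqVlt; apply/orP; left; apply/eqP.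
  by apply: eq_big_seq => x xs; rewrite /rest /= xs.
exists f; last by move=> n; exact: (key n).2.
have -> : f = u 0%N - (u 0%N - f) by rewrite opprB addrC subrK.
by apply: l2_sub => //; exact: (key 0%N).1.
Qed.

End Complete.

(** * Symmetric operators and their spectrum *)

Section Operators.
Context {R : realType} {X : choiceType}.
Implicit Types (f g h : X -> R[i]) (A T B : (X -> R[i]) -> (X -> R[i])).

(** Carrying the adjoint as data covers [A - z] for non-real [z], whose adjoint is [A - z^*]. The
    conditions are restricted to l2, outside which the values of the operators are arbitrary. *)
Record adjoint_pair T T' : Prop := AdjointPair {
  ap_l2 : forall f, l2 f -> l2 (T f);
  ap_l2' : forall f, l2 f -> l2 (T' f);
  ap_lin : forall c f g, l2 f -> l2 g -> T (scal c f + g) = scal c (T f) + T g;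
  ap_lin' : forall c f g, l2 f -> l2 g -> T' (scal c f + g) = scal c (T' f) + T' g;
  ap_bd : exists M : R, forall f, l2 f ->
    l2norm (T f) <= M * l2norm f /\ l2norm (T' f) <= M * l2norm f;
  ap_adj : forall f g, l2 f -> l2 g -> ip (T f) g = ip f (T' g) }.

Definition sym_op A := adjoint_pair A A.

Lemma adjoint_pairC T T' : adjoint_pair T T' -> adjoint_pair T' T.
Proof.
case=> l l' a a' [M b] d; split => //.
  by exists M => f fl; have [] := b f fl.
by move=> f g fl gl; rewrite ipC -d// ipC.
Qed.

Section AdjointPair.
Variables (T T' : (X -> R[i]) -> (X -> R[i])) (TT' : adjoint_pair T T').

Lemma scal0 c : scal c (0 : X -> R[i]) = 0.
Proof. by apply/funext => x; exact: mulr0. Qed.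

Lemma scal1 f : scal 1 f = f.
Proof. by apply/funext => x; exact: mul1r. Qed.

Lemma ap_add f g : l2 f -> l2 g -> T (f + g) = T f + T g.
Proof. by move=> fl gl; have := ap_lin TT' 1 fl gl; rewrite !scal1. Qed.

Lemma ap_0 : T 0 = 0.
Proof.
have := ap_add (l2_0 (X := X)) l2_0; rewrite addr0 => /eqP.
by rewrite addrC -subr_eq subrr => /eqP <-.
Qed.

Lemma ap_scal c f : l2 f -> T (scal c f) = scal c (T f).
Proof.
move=> fl; have := ap_lin TT' c fl (l2_0 (X := X)).
by rewrite ap_0 !addr0.
Qed.

Lemma ap_opp f : l2 f -> T (- f) = - T f.
Proof. by move=> fl; rewrite -!scalN1 ap_scal. Qed.

Lemma ap_sub f g : l2 f -> l2 g -> T (f - g) = T f - T g.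
Proof. by move=> fl gl; rewrite ap_add ?ap_opp//; exact: l2_opp. Qed.

Lemma ap_sum (I : Type) (s : seq I) (F : I -> X -> R[i]) :
  (forall i, l2 (F i)) -> T (\sum_(i <- s) F i) = \sum_(i <- s) T (F i).
Proof.
move=> Fl; elim: s => [|i s IH]; first by rewrite !big_nil ap_0.
by rewrite !big_cons ap_add ?IH//; exact: l2_sum.
Qed.

(** Taking [M] above a prescribed [c] keeps the ratio [c ^+ 2 / M ^+ 2] of the Neumann series at
    most 1. *)
Lemma ap_bound (c : R) : exists2 M : R, c <= M & 0 < M /\ forall f, l2 f ->
  l2norm (T f) <= M * l2norm f /\ l2norm (T' f) <= M * l2norm f.
Proof.
have [M H] := ap_bd TT'; exists (`|M| + `|c| + 1).
  by have := ler_norm c; have := normr_ge0 M; lra.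
split; first by rewrite ltr_wpDl// addr_ge0.
move=> f fl; have [h1 h2] := H f fl; have n0 := l2norm_ge0 f.
have : M * l2norm f <= (`|M| + `|c| + 1) * l2norm f.
  by rewrite ler_wpM2r//; have := ler_norm M; have := normr_ge0 c; lra.
by move=> h3; split; apply: le_trans h3.
Qed.

End AdjointPair.

Lemma scalB c f g : scal c (f - g) = scal c f - scal c g.
Proof. by apply/funext => x; exact: mulrBr. Qed.

Lemma scalD c f g : scal c (f + g) = scal c f + scal c g.
Proof. by apply/funext => x; exact: mulrDr. Qed.

Lemma scalA c d f : scal c (scal d f) = scal (c * d) f.
Proof. by apply/funext => x; exact: mulrA. Qed.

Lemma scalDl c d f : scal (c + d) f = scal c f + scal d f.
Proof. by apply/funext => x; exact: mulrDl. Qed.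

Lemma scalNl c f : scal (- c) f = - scal c f.
Proof. by apply/funext => x; exact: mulNr. Qed.

Lemma geometric_small (q C d : R) : 0 <= q -> q < 1 -> 0 <= C -> 0 < d ->
  forall n, exists2 m, (n <= m)%N & C * q ^+ m <= d.
Proof.
move=> q0 q1 C0 d0 n.
have : (fun m => C * q ^+ m) @ \oo --> (C * 0 : R).
  apply: cvgMr; apply: cvg_expr; by rewrite ger0_norm.
rewrite mulr0 => /cvgrPdist_le /(_ d d0) [m _ H].
exists (maxn n m); first exact: leq_maxl.
have := H (maxn n m) (leq_maxr _ _); rewrite /= sub0r normrN.
by apply: le_trans; exact: ler_norm.
Qed.

(* Neumann series of S = 1 - T'T / M^2, which contracts D because T is bounded below there. *)
Lemma neumann T T' (D : set (X -> R[i])) (c : R) : adjoint_pair T T' -> 0 < c ->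
  (forall g, D g -> l2 g) ->
  (forall (t : R) g, D g -> D (g - scal t%:C (T' (T g)))) ->
  (forall g, D g -> c * l2norm g <= l2norm (T g)) ->
  forall g, D g -> exists2 h, l2 h & T' (T h) = g.
Proof.
move=> TT' c0 Dl DS Dc g Dg.
have T'T := adjoint_pairC TT'.
have [M cM [M0 TM]] := ap_bound TT' c.
pose t : R := (M ^+ 2)^-1.
have M20 : 0 < M ^+ 2 by rewrite exprn_gt0.
have t0 : 0 < t by rewrite invr_gt0.
pose S f := f - scal t%:C (T' (T f)).
pose q := Num.sqrt (1 - c ^+ 2 * t).
have ct1 : c ^+ 2 * t <= 1.
  by rewrite ler_pdivrMr// mul1r ler_pXn2r// ?nnegrE ltW.
have q2 : q ^+ 2 = 1 - c ^+ 2 * t by rewrite sqr_sqrtr ?subr_ge0.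
have q0 : 0 <= q by exact: sqrtr_ge0.
have q1 : q < 1.
  rewrite -(@ltr_pXn2r _ 2) ?nnegrE// q2 expr1n ltrBlDr ltrDl.
  by rewrite mulr_gt0 ?exprn_gt0.
have Sq f : D f -> l2norm (S f) <= q * l2norm f.
  move=> Df; have fl := Dl _ Df.
  have l1 := ap_l2 TT' fl; have l2_ := ap_l2' TT' l1.
  rewrite -(@ler_pXn2r _ 2) ?nnegrE ?mulr_ge0 ?l2norm_ge0// exprMn q2.
  (* By expansion, |S f|^2 = |f|^2 - 2t |T f|^2 + t^2 |T' T f|^2. With t = M^-2 the last term is at
     most t |T f|^2, which leaves |f|^2 - t |T f|^2 <= (1 - c^2 t) |f|^2. *)
  have -> : S f = f + scal (- t)%:C (T' (T f)).
    by rewrite /S -scalNl rmorphN.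
  rewrite ip_lin//.
  have -> : ip f (T' (T f)) = l2norm (T f) ^+ 2 by rewrite -(ap_adj TT' fl l1) -l2norm2.
  have h1 : (c * l2norm f) ^+ 2 <= l2norm (T f) ^+ 2.
    by rewrite ler_pXn2r ?nnegrE ?mulr_ge0 ?l2norm_ge0 ?(ltW c0)// Dc.
  have h2 : l2norm (T' (T f)) ^+ 2 <= (M * l2norm (T f)) ^+ 2.
    rewrite ler_pXn2r ?nnegrE ?mulr_ge0 ?l2norm_ge0 ?(ltW M0)//.
    by have [] := TM _ l1.
  have h3 : t ^+ 2 * l2norm (T' (T f)) ^+ 2 <= t * l2norm (T f) ^+ 2.
    rewrite expr2 -mulrA ler_pM2l//.
    have : t * (M * l2norm (T f)) ^+ 2 = l2norm (T f) ^+ 2.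
      by rewrite exprMn mulrA mulVf ?mul1r// gt_eqF.
    by move=> <-; rewrite ler_pM2l.
  have h4 : t * (c * l2norm f) ^+ 2 <= t * l2norm (T f) ^+ 2 by rewrite ler_pM2l.
  have -> : (1 - c ^+ 2 * t) * l2norm f ^+ 2 = l2norm f ^+ 2 - t * (c * l2norm f) ^+ 2 by ring.
  rewrite sqrrN; lra.
pose G k := iter k S g.
have GD k : D (G k) by elim: k => // k IH; exact: DS.
have Gl k := Dl _ (GD k).
have Gq k : l2norm (G k) <= l2norm g * q ^+ k.
  elim: k => [|k IH]; first by rewrite expr0 mulr1.
  apply: le_trans (Sq _ (GD k)) _.
  by rewrite exprS mulrCA ler_wpM2l.
pose h n := scal t%:C (\sum_(k < n) G k).
have hl n : l2 (h n) by apply/l2_scal/l2_sum.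
have hB n m : (n <= m)%N -> l2norm (h n - h m) <= t * l2norm g / (1 - q) * q ^+ n.
  move=> nm; rewrite -(subnKC nm); move: (m - n)%N => p.
  rewrite /h -scalB l2norm_scal; last by apply: l2_sub; exact: l2_sum.
  rewrite normc_real (gtr0_norm t0) -!mulrA ler_pM2l//.
  have -> : \sum_(k < n) G k - \sum_(k < n + p) G k = - \sum_(k < p) G (n + k)%N.
    by rewrite big_split_ord/= opprD addrA subrr add0r.
  rewrite l2normN; apply: le_trans (l2norm_sum _ (fun k => Gl _)) _.
  apply: le_trans (ler_sum _ (fun (k : 'I_p) _ => Gq (n + k)%N)) _.
  rewrite -mulr_sumr ler_wpM2l ?l2norm_ge0//.
  under eq_bigr do rewrite exprD.
  rewrite -mulr_sumr mulrC ler_wpM2r ?exprn_ge0//.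
  have q1' : 1 - q != 0 by rewrite subr_eq0 eq_sym lt_eqF.
  have : (1 - q) * \sum_(k < p) q ^+ k = 1 - q ^+ p by rewrite -opprB mulNr -subrX1 opprB.
  move=> e; rewrite -(ler_pM2l (_ : 0 < 1 - q)) ?subr_gt0// e mulfV//.
  by rewrite gerBl exprn_ge0.
have C0 : 0 <= t * l2norm g / (1 - q).
  by rewrite divr_ge0 ?mulr_ge0 ?l2norm_ge0 ?(ltW t0) ?subr_ge0 ?(ltW q1).
have [u ul uP] := @l2_complete _ _ h _ hl hB
  (fun d d0 => geometric_small q0 q1 C0 d0).
exists u => //.
have Th n : T' (T (h n)) = g - G n.
  rewrite /h (ap_scal TT') ?(ap_sum TT')//; last exact: l2_sum.
  rewrite (ap_scal T'T); last by apply: l2_sum => k; exact: (ap_l2 TT' (Gl _)).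
  rewrite (ap_sum T'T); last by move=> k; exact: (ap_l2 TT' (Gl _)).
  elim: n => [|n IH]; first by rewrite big_ord0 scal0 /G/= subrr.
  rewrite big_ord_recr/= scalD IH /S /G/=; set w := scal _ (T' _).
  by rewrite opprB addrA addrAC; congr (_ + _); rewrite addrC.
apply/subr0_eq/l2norm_eq0; first by apply: l2_sub; [exact/(ap_l2' TT')/(ap_l2 TT')|exact: Dl].
apply/ler_addgt0Pr => d d0; rewrite add0r.
(* Since T' T u - g = - T' T (h m - u) - G m, with both terms of order q^m, [C] collects their
   constants. *)
pose C := M ^+ 2 * (t * l2norm g / (1 - q)) + l2norm g.
have C0' : 0 <= C by rewrite /C addr_ge0 ?l2norm_ge0// mulr_ge0// (ltW M20).
have [m _ Cm] := geometric_small q0 q1 C0' d0 0%N.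
apply: le_trans Cm.
have -> : T' (T u) - g = - (T' (T (h m - u))) - G m.
  rewrite (ap_sub TT')// (ap_sub T'T)//; do ?exact: (ap_l2 TT' _).
  by rewrite Th !opprB addrA addrAC addrK.
have l1 : l2 (h m - u) by exact: l2_sub.
have l3 := ap_l2 TT' l1; have l4 := ap_l2' TT' l3.
apply: le_trans (l2normB (l2_opp l4) (Gl m)) _.
rewrite l2normN /C mulrDl; apply: lerD; last exact: Gq.
have [_ b1] := TM _ l3; have [b2 _] := TM _ l1.
apply: le_trans b1 _; rewrite expr2 -!mulrA ler_pM2l//.
apply: le_trans b2 _; rewrite ler_pM2l//.
by rewrite !mulrA; exact: uP.
Qed.

Definition bdd_below A (lam c : R) :=
  forall f, l2 f -> c * l2norm f <= l2norm (A f - scal lam%:C f).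

Definition real_spectrum A : set R := [set lam | forall c, 0 < c -> ~ bdd_below A lam c].

Definition opshift A (z : R[i]) f := A f - scal z f.

Lemma adjoint_shift A z : sym_op A -> adjoint_pair (opshift A z) (opshift A z^*).
Proof.
have lin (w : R[i]) : sym_op A -> forall c f g, l2 f -> l2 g ->
   opshift A w (scal c f + g) = scal c (opshift A w f) + opshift A w g.
  move=> sA c f g fl gl; rewrite /opshift (ap_lin sA)// scalB scalD !scalA (mulrC w).
  by rewrite opprD addrACA.
have bd (w : R[i]) f M : l2 f -> l2 (A f) -> l2norm (A f) <= M * l2norm f ->
   l2norm (opshift A w f) <= (M + Normc.normc w) * l2norm f.
  move=> fl Afl h; apply: le_trans (l2normB Afl (l2_scal w fl)) _.
  by rewrite l2norm_scal// mulrDl lerD2r.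
move=> sA; split; [| | exact: lin| exact: lin| |].
- by move=> f fl; rewrite /opshift; apply: l2_sub; [exact: (ap_l2 sA fl)|exact: l2_scal].
- by move=> f fl; rewrite /opshift; apply: l2_sub; [exact: (ap_l2 sA fl)|exact: l2_scal].
- have [M H] := ap_bd sA; exists (M + Normc.normc z) => f fl.
  have [h _] := H f fl; have Al := ap_l2 sA fl.
  by split; [|rewrite -normc_conj]; exact: bd.
- move=> f g fl gl; have Afl := ap_l2 sA fl; have Agl := ap_l2 sA gl.
  rewrite /opshift ipBl ?ipBr//; do ?exact: l2_scal.
  by rewrite (ap_adj sA)// ip_scall.
Qed.

Lemma sym_shift A (lam : R) : sym_op A -> sym_op (opshift A lam%:C).
Proof. by move=> /(adjoint_shift lam%:C); rewrite conjc_real. Qed.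

Lemma sym_square T : sym_op T -> sym_op (T \o T).
Proof.
move=> sT; have l f := ap_l2 sT (f := f); split.
- by move=> f /l/l.
- by move=> f /l/l.
- by move=> c f g fl gl /=; rewrite !(ap_lin sT)//; exact: l.
- by move=> c f g fl gl /=; rewrite !(ap_lin sT)//; exact: l.
- have [M _ [M0 TM]] := ap_bound sT 0; exists (M ^+ 2) => f fl.
  suff h : l2norm (T (T f)) <= M ^+ 2 * l2norm f by [].
  apply: (le_trans (TM _ (l _ fl)).1); rewrite expr2 -mulrA ler_pM2l//.
  exact: (TM _ fl).1.
- by move=> f g fl gl /=; rewrite (ap_adj sT (l _ fl) gl) (ap_adj sT fl (l _ gl)).
Qed.

Lemma bdd_below_perturb A lam mu c : sym_op A -> bdd_below A lam c -> bdd_below A mu (c - `|lam - mu|).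
Proof.
move=> sA H f fl; have := H f fl.
have Afl := ap_l2 sA fl.
have -> : A f - scal lam%:C f = (A f - scal mu%:C f) - scal (lam - mu)%:C f.
  by rewrite rmorphB scalDl scalNl opprB addrA subrK.
move=> h; have := l2normB (l2_sub Afl (l2_scal mu%:C fl)) (l2_scal (lam - mu)%:C fl).
rewrite l2norm_scal// normc_real => h2.
by rewrite mulrBl lerBlDr; apply: le_trans h _.
Qed.

Lemma bdd_below_le A lam c c' : c' <= c -> bdd_below A lam c -> bdd_below A lam c'.
Proof.
move=> cc H f fl; apply: le_trans (H f fl); exact: ler_wpM2r (l2norm_ge0 _) _ _ cc.
Qed.

Lemma not_real_spectrum A lam : ~ real_spectrum A lam -> exists2 c, 0 < c & bdd_below A lam c.
Proof.
move=> /existsNP[c] /not_implyP[c0] /contrapT H; by exists c.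
Qed.

(** Surjectivity uses the lower bound of the adjoint: with [T = A - z] and [T'] its adjoint, the
    Neumann series solves [T (T' h) = g]. The bound at [z] itself gives injectivity and the norm of
    the inverse. *)
Lemma resolvent_surj A z c : sym_op A -> 0 < c ->
  (forall f, l2 f -> c * l2norm f <= l2norm (opshift A z f)) ->
  (forall f, l2 f -> c * l2norm f <= l2norm (opshift A z^* f)) ->
  resolvent_set A z.
Proof.
move=> sA c0 H H'.
have TT' := adjoint_shift z sA; have T'T := adjoint_pairC TT'.
have surj g : l2 g -> exists2 h, l2 h & opshift A z h = g.
  move=> gl.
  have [//|t u ul|h hl <-] := @neumann _ _ (l2 (X := X)) c T'T c0 _ _ H' g gl.
  - by apply: l2_sub => //; apply/l2_scal/(ap_l2 TT')/(ap_l2 T'T).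
  - by exists (opshift A z^* h) => //; exact: (ap_l2 T'T hl).
have inj f g : l2 f -> l2 g -> opshift A z f = opshift A z g -> f = g.
  move=> fl gl e; apply/subr0_eq/l2norm_eq0; first exact: l2_sub.
  have := H _ (l2_sub fl gl); rewrite (ap_sub TT')// e subrr l2norm0.
  by rewrite pmulr_rle0.
have [B BP] : exists B, forall g, l2 g -> l2 (B g) /\ opshift A z (B g) = g.
  suff : forall g, exists h, l2 g -> l2 h /\ opshift A z h = g by move=> /choice[B BP]; exists B.
  move=> g; case: (pselect (l2 g)) => [/surj[h hl e]|n]; first by exists h.
  by exists 0.
exists B; split; last first.
  move=> f fl; split; last exact: (BP f fl).2.
  have Tl : l2 (opshift A z f) by exact: (ap_l2 TT' fl).
  by have [bl e] := BP _ Tl; exact: inj e.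
split.
- by move=> f /BP[].
- move=> k f g fl gl.
  have [Bf ef] := BP f fl; have [Bg eg] := BP g gl.
  have sl : l2 (scal k f + g) by apply: l2_add => //; exact: l2_scal.
  have [Bs es] := BP _ sl.
  apply: (inj _ _ Bs); first by apply: l2_add => //; exact: l2_scal.
  change (opshift A z (B (scal k f + g)) = opshift A z (scal k (B f) + B g)).
  by rewrite es (ap_lin TT')// ef eg.
- exists c^-1 => f fl; have [Bl e] := BP f fl.
  by rewrite ler_pdivlMl// -[in leRHS]e; exact: H.
Qed.

(** For z = a + ib, the vectors (A - a) f and ib f are orthogonal for the real scalar product
    because [A] is symmetric; Pythagoras then drops the first one. *)
Lemma shift_nonreal A (z : R[i]) f : sym_op A -> l2 f ->
  `|complex.Im z| * l2norm f <= l2norm (opshift A z f).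
Proof.
move=> sA fl; case: z => a b /=.
have sS := sym_shift a sA; set T := opshift A a%:C in sS *.
have Tl := ap_l2 sS fl; have il : l2 (scal 'i f) by exact: l2_scal.
have -> : opshift A (a +i* b) f = T f + scal (- b)%:C (scal 'i f).
  rewrite scalA /T /opshift -addrA; congr (_ + _).
  rewrite -!scalNl -scalDl; congr (scal _ f).
  by apply/eqP; rewrite eq_complex /=; apply/andP; split; apply/eqP; ring.
rewrite -(@ler_pXn2r _ 2) ?nnegrE ?mulr_ge0 ?l2norm_ge0// ip_lin//.
have -> : ip (T f) (scal 'i f) = 0.
  have h : ip (T f) (scal 'i f) = - ip (T f) (scal 'i f).
    rewrite [LHS](ap_adj sS fl il) (ap_scal sS)// [LHS]ipC ip_scall.
    have -> : ('i : R[i])^* = - 'i by apply/eqP; rewrite eq_complex /= oppr0 !eqxx.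
    by rewrite scalNl ipC (ipNl il Tl) ipC.
  lra.
rewrite l2norm_scal// exprMn real_normK ?num_real// mulr0 addr0 sqrrN.
have -> : Normc.normc ('i : R[i]) = 1 by rewrite /= expr0n expr1n add0r sqrtr1.
by rewrite mul1r lerDr sqr_ge0.
Qed.

Lemma spectrumE A : sym_op A -> spectrum A = [set lam%:C | lam in real_spectrum A].
Proof.
move=> sA; apply/seteqP; split => z /=; last first.
  move=> [lam lP <-] [B [[Bl _ [M BM]] BP]].
  have M1 : 0 < `|M| + 1 by rewrite ltr_wpDl.
  apply: (lP (`|M| + 1)^-1); first by rewrite invr_gt0.
  move=> f fl; have Tl := ap_l2 (sym_shift lam sA) fl.
  have [e _] := BP f fl; rewrite ler_pdivrMl//.
  have := BM _ Tl; rewrite -[X in B X]/(fun x => A f x - lam%:C * f x) e.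
  move=> /le_trans; apply; rewrite ler_wpM2r ?l2norm_ge0//.
  by have := ler_norm M; lra.
move=> zP; have [b0|b0] := eqVneq (complex.Im z) 0.
  have ez : z = (complex.Re z)%:C by case: z b0 {zP} => a b /= ->.
  exists (complex.Re z); last by rewrite -ez.
  move=> c c0 H; apply: zP; apply: (resolvent_surj sA c0); first by rewrite ez.
  by rewrite ez conjc_real.
exfalso; apply: zP; apply: (@resolvent_surj _ _ `|complex.Im z| sA).
- by rewrite normr_gt0.
- by move=> f fl; exact: shift_nonreal.
- move=> f fl; have -> : `|complex.Im z| = `|complex.Im z^*|.
    by clear; case: z => a b /=; rewrite normrN.
  exact: shift_nonreal.
Qed.

(** Cauchy-Schwarz for the semidefinite form [ip (T f) g], taken at [g = T f]; the factor |T f|^2 is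
    then divided out. *)
Lemma positive_form T (M : R) : sym_op T -> 0 <= M ->
  (forall f, l2 f -> 0 <= ip (T f) f) ->
  (forall f, l2 f -> l2norm (T f) <= M * l2norm f) ->
  forall f, l2 f -> l2norm (T f) ^+ 2 <= M * ip (T f) f.
Proof.
move=> sT M0 pos TM f fl; have Tl := ap_l2 sT fl; have TTl := ap_l2 sT Tl.
have h : (l2norm (T f) ^+ 2) ^+ 2 <= ip (T f) f * ip (T (T f)) (T f).
  rewrite [l2norm _ ^+ 2]l2norm2; apply: discr_le => [| |t]; [exact: pos..|].
  have tl : l2 (scal t%:C (T f)) by exact: l2_scal.
  have := pos _ (l2_add fl tl).
  have tTl : l2 (scal t%:C (T (T f))) by exact: l2_scal.
  rewrite (ap_add sT fl tl) (ap_scal sT _ Tl) (ipDl Tl tTl (l2_add fl tl)).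
  rewrite (ipDr Tl fl tl) (ipDr tTl fl tl) (ip_realr t Tl Tl).
  rewrite (ip_real t TTl fl) (ip_real t TTl tl) (ip_realr t TTl Tl) (ap_adj sT Tl fl).
  by rewrite expr2; lra.
have h2 : ip (T (T f)) (T f) <= M * l2norm (T f) ^+ 2.
  apply: le_trans (ler_norm _) _; apply: le_trans (cauchy_schwarz TTl Tl) _.
  by rewrite expr2 mulrA ler_wpM2r ?l2norm_ge0// TM.
have [e|n0] := eqVneq (l2norm (T f)) 0.
  by rewrite e expr0n mulr_ge0// pos.
have n1 : 0 < l2norm (T f) ^+ 2 by rewrite exprn_gt0// lt_def n0 l2norm_ge0.
rewrite -(ler_pM2l n1) -expr2; apply: le_trans h _.
have := ler_wpM2l (pos f fl) h2; lra.
Qed.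

(* The distance m from mu to the spectrum is the best lower bound of A - mu: (A - mu)^2 - m^2
   is a positive form that is not bounded below, hence mu - m or mu + m lies in the spectrum. *)
Lemma spectrum_near A mu rho : sym_op A -> 0 < rho -> ~ bdd_below A mu rho ->
  exists2 nu, real_spectrum A nu & `|nu - mu| < rho.
Proof.
move=> sA rho0 nb.
pose E := [set c : R | bdd_below A mu c].
have E0 : E 0 by move=> f fl; rewrite mul0r l2norm_ge0.
have Eub : ubound E rho.
  move=> c Ec; rewrite leNgt; apply/negP => /ltW h; exact: nb (bdd_below_le h Ec).
have supE : has_sup E by split; [exists 0|exists rho].
pose m := sup E.
have m0 : 0 <= m by exact: (ub_le_sup supE.2).
have mrho : m <= rho by exact: (ge_sup supE.1).
(* The supremum is attained, because for each [f] separately the condition on [c] is closed. *)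
have Em : E m.
  move=> f fl; have [e|n0] := eqVneq (l2norm f) 0; first by rewrite e mulr0 l2norm_ge0.
  have n1 : 0 < l2norm f by rewrite lt_def n0 l2norm_ge0.
  rewrite -ler_pdivlMr//; apply: ge_sup; first by exists 0.
  by move=> c /(_ f fl); rewrite -ler_pdivlMr.
have mlt : m < rho.
  rewrite lt_def mrho andbT; apply/eqP => e; apply: nb; by rewrite e.
have [h1|/not_real_spectrum[c1 c10 b1]] := pselect (real_spectrum A (mu + m)).
  by exists (mu + m) => //; rewrite addrAC subrr add0r ger0_norm.
have [h1|/not_real_spectrum[c2 c20 b2]] := pselect (real_spectrum A (mu - m)).
  by exists (mu - m) => //; rewrite addrAC subrr sub0r normrN ger0_norm.
exfalso.
have sT := sym_shift mu sA; set T := opshift A mu%:C in sT.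
pose P f := T (T f) - scal (m ^+ 2)%:C f.
have Pfac f : l2 f -> P f = opshift A (mu - m)%:C (opshift A (mu + m)%:C f).
  move=> fl; have Tl := ap_l2 sT fl.
  have e1 : opshift A (mu + m)%:C f = T f - scal m%:C f.
    by rewrite /T /opshift rmorphD scalDl opprD addrA.
  have e2 g : opshift A (mu - m)%:C g = T g + scal m%:C g.
    by rewrite /T /opshift rmorphB scalDl scalNl opprB addrA addrAC.
  rewrite e1 e2 (ap_sub sT)//; last exact: l2_scal.
  rewrite (ap_scal sT)// scalB scalA -rmorphM -expr2 /P.
  by rewrite addrA subrK.
have sP : sym_op P := sym_shift (m ^+ 2) (sym_square sT).
have Pip f : l2 f -> ip (P f) f = l2norm (T f) ^+ 2 - m ^+ 2 * l2norm f ^+ 2.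
  move=> fl; have l1 := ap_l2 sT fl; have l2' := ap_l2 sT l1.
  rewrite /P (ipBl l2' (l2_scal _ fl) fl).
  by rewrite (ap_adj sT l1 fl) (ip_real _ fl fl) !l2norm2.
have [K _ [K0 PK]] := ap_bound sP 0.
have Ppos f : l2 f -> 0 <= ip (P f) f.
  move=> fl; rewrite Pip// subr_ge0 -exprMn ler_pXn2r ?nnegrE ?mulr_ge0 ?l2norm_ge0//.
  exact: Em.
(* [P] is the product of the shifts by [mu - m] and [mu + m], both bounded below by assumption. As
   [P] is positive, [positive_form] turns the bound on its norm into a bound on its form. *)
have key f : l2 f -> (c2 * c1) ^+ 2 * l2norm f ^+ 2 <= K * (l2norm (T f) ^+ 2 - m ^+ 2 * l2norm f ^+ 2).
  move=> fl; rewrite -Pip//.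
  apply: le_trans (positive_form sP (ltW K0) Ppos (fun f fl => (PK f fl).1) fl).
  rewrite -exprMn ler_pXn2r ?nnegrE ?mulr_ge0 ?l2norm_ge0 ?(ltW c10) ?(ltW c20)//.
  rewrite Pfac//; have l1 := ap_l2 (sym_shift (mu + m) sA) fl.
  apply: le_trans (b2 _ l1); rewrite -mulrA ler_pM2l//; exact: b1.
(* A lower bound of [A - mu] exceeding [m], against the maximality of [m]. *)
pose m' := Num.sqrt (m ^+ 2 + (c2 * c1) ^+ 2 / K).
have k0 : 0 < (c2 * c1) ^+ 2 / K by rewrite divr_gt0// exprn_gt0// mulr_gt0.
have : E m'.
  move=> f fl.
  rewrite -(@ler_pXn2r _ 2) ?nnegrE ?mulr_ge0 ?l2norm_ge0 ?sqrtr_ge0// exprMn sqr_sqrtr; last first.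
    by rewrite addr_ge0 ?sqr_ge0// ltW.
  rewrite mulrDl -lerBrDl mulrAC ler_pdivrMr// mulrC mulrC; have := key f fl; rewrite -/T mulrC.
  by rewrite [X in _ <= X]mulrC.
move=> /(ub_le_sup supE.2); rewrite -/m leNgt => /negP; apply.
rewrite -(@ltr_pXn2r _ 2) ?nnegrE ?sqrtr_ge0// sqr_sqrtr ?ltrDl//.
by rewrite addr_ge0 ?sqr_ge0// ltW.
Qed.

(** Lower bounds are distances to the spectrum. A point of the spectrum between [al] and [be] is at
    distance at least [c] from both, hence within the half-length minus [c] of the midpoint; the
    bound weakened by [c / 2] already excludes it. So the full bound at the midpoint survives small
    perturbations. *)
Lemma bdd_below_gap A (al be c : R) : sym_op A -> al < be -> 0 < c ->
  bdd_below A al c -> bdd_below A be c ->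
  bdd_below A ((al + be) / 2) ((be - al) / 2 - c / 2) -> bdd_below A ((al + be) / 2) ((be - al) / 2).
Proof.
move=> sA ab c0 ba b_ bm; apply: contrapT => nb.
have [|nu nuP] := spectrum_near sA _ nb; first lra.
have away a k : bdd_below A a k -> k <= `|nu - a|.
  move=> H; rewrite leNgt; apply/negP => h.
  apply: (nuP (k - `|a - nu|)); first by rewrite subr_gt0 distrC.
  exact: bdd_below_perturb.
have := away _ _ ba; have := away _ _ b_; have := away _ _ bm.
rewrite ltr_norml !ler_normr => /orP h1 /orP h2 /orP h3 /andP[h4 h5].
by case: h1; case: h2; case: h3; lra.
Qed.

End Operators.

(** * Essential spectrum *)

Lemma archimed_small {R : realType} (d : R) : 0 < d -> exists m : nat, (m.+1%:R^-1 : R) <= d.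
Proof.
move=> d0; have [m _ /(_ m (leqnn m)) /= h] := near_infty_natSinv_lt (PosNum d0).
by exists m; exact: ltW.
Qed.

Section Essential.
Context {R : realType} {X : choiceType}.
Implicit Types (f g h : X -> R[i]) (A T : (X -> R[i]) -> (X -> R[i])).

Lemma ip_kernel_range T f e : sym_op T -> l2 f -> l2 e -> T e = 0 ->
  ip (T f) f = ip (T f) (f - e).
Proof.
move=> sT fl el Te; have Tfl := ap_l2 sT fl.
rewrite (ipBr Tfl fl el) (ap_adj sT fl el) Te.
suff -> : ip f 0 = 0 by rewrite subr0.
by have := ip_realr 0 fl (l2_0 (X := X)); rewrite scal0 mul0r.
Qed.

(** A substitute for the spectral projection at an isolated point. On its own range, [T = A - lam]
    is bounded below by [r]; solving [T (T h) = T f] there splits [f] into the kernel element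
    [f - T h] and the remainder [T h]. *)
Lemma isolated_kernel A lam (r : R) : sym_op A -> 0 < r ->
  (forall nu, 0 < `|nu - lam| -> `|nu - lam| < r -> ~ real_spectrum A nu) ->
  forall f, l2 f -> exists e, [/\ l2 e, opshift A lam%:C e = 0 &
    r * l2norm (f - e) <= l2norm (opshift A lam%:C f)].
Proof.
move=> sA r0 iso; have sT := sym_shift lam sA; set T := opshift A lam%:C in sT *.
have bbs (s : R) : 0 < `|s| -> `|s| <= r / 2 -> bdd_below A (lam + s) `|s|.
  move=> s0 sr; apply: contrapT => /(spectrum_near sA s0)[nu nuP h].
  apply: (iso nu _ _ nuP).
    rewrite normr_gt0 subr_eq0; apply/eqP => e; move: h.
    by rewrite e opprD addrA subrr sub0r normrN ltxx.
  have -> : nu - lam = (nu - (lam + s)) + s by ring.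
  by apply: le_lt_trans (ler_normD _ _) _; lra.
(* Squaring the lower bound [|s|] at [lam + s] cancels the terms in [s ^+ 2]. With [s] equal to plus
   or minus [r / 2], this bounds r |ip (T f) f| by |T f|^2. *)
have form (s : R) f : l2 f -> 0 < `|s| -> `|s| <= r / 2 -> 2 * s * ip (T f) f <= l2norm (T f) ^+ 2.
  move=> fl s0 sr; have Tl := ap_l2 sT fl; have := bbs s s0 sr f fl.
  have -> : A f - scal (lam + s)%:C f = T f + scal (- s)%:C f.
    by rewrite /T /opshift rmorphD rmorphN scalDl scalNl opprD addrA.
  rewrite -(@ler_pXn2r _ 2) ?nnegrE ?mulr_ge0 ?l2norm_ge0// (ip_lin _ Tl fl).
  rewrite exprMn real_normK ?num_real// sqrrN; lra.
have form1 f : l2 f -> r * ip (T f) f <= l2norm (T f) ^+ 2.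
  move=> fl; have := form (r / 2) f fl; rewrite ger0_norm; last lra.
  have -> : 2 * (r / 2) = r by field.
  by apply; lra.
have form2 f : l2 f -> - (r * ip (T f) f) <= l2norm (T f) ^+ 2.
  move=> fl; have := form (- (r / 2)) f fl; rewrite normrN ger0_norm; last lra.
  have -> : 2 * - (r / 2) = - r by field.
  by rewrite mulNr; apply; lra.
(* Adding [form1] at [f + T f / r] and [form2] at [f - T f / r] cancels everything except |T f|^2
   and |T T f|^2. *)
have rT f : l2 f -> r * l2norm (T f) <= l2norm (T (T f)).
  move=> fl; have Tl := ap_l2 sT fl; have TTl := ap_l2 sT Tl.
  pose t := r^-1.
  have gl (s : R) : l2 (scal s%:C (T f)) by exact: l2_scal.
  have Texp (s : R) : T (f + scal s%:C (T f)) = T f + scal s%:C (T (T f)).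
    by rewrite (ap_add sT fl (gl s)) (ap_scal sT _ Tl).
  have ipexp (s : R) : ip (T (f + scal s%:C (T f))) (f + scal s%:C (T f)) =
      ip (T f) f + 2 * s * l2norm (T f) ^+ 2 + s ^+ 2 * ip (T (T f)) (T f).
    rewrite Texp (ipDl Tl (l2_scal _ TTl) (l2_add fl (gl s))).
    rewrite (ipDr Tl fl (gl s)) (ipDr (l2_scal _ TTl) fl (gl s)) (ip_realr _ Tl Tl).
    rewrite (ip_real _ TTl fl) (ip_real _ TTl (gl s)) (ip_realr _ TTl Tl).
    by rewrite (ap_adj sT Tl fl) l2norm2; ring.
  have h1 := form1 _ (l2_add fl (gl t)); have h2 := form2 _ (l2_add fl (gl (- t))).
  rewrite ipexp Texp (ip_lin _ Tl TTl) in h1.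
  rewrite ipexp Texp (ip_lin _ Tl TTl) in h2.
  have rt : r * t = 1 by rewrite mulfV ?gt_eqF.
  have h3 : 2 * l2norm (T f) ^+ 2 <= l2norm (T f) ^+ 2 + t ^+ 2 * l2norm (T (T f)) ^+ 2.
    rewrite sqrrN in h2.
    have e1 : r * (2 * t * l2norm (T f) ^+ 2) = 2 * l2norm (T f) ^+ 2.
      by rewrite -[RHS]mulr1 -rt; ring.
    have e2 : r * (2 * - t * l2norm (T f) ^+ 2) = - (2 * l2norm (T f) ^+ 2).
      by rewrite mulrN mulNr mulrN e1.
    by rewrite !mulrDr e1 in h1; rewrite !mulrDr e2 in h2; lra.
  rewrite -(@ler_pXn2r _ 2) ?nnegrE ?mulr_ge0 ?l2norm_ge0 ?(ltW r0)// exprMn.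
  have r20 : 0 < r ^+ 2 by rewrite exprn_gt0.
  have h4 : r ^+ 2 * (t ^+ 2 * l2norm (T (T f)) ^+ 2) = l2norm (T (T f)) ^+ 2.
    by rewrite mulrA -exprMn rt expr1n mul1r.
  rewrite -h4 ler_pM2l//; lra.
move=> f fl; have Tl := ap_l2 sT fl.
pose D : set (X -> R[i]) := [set T u | u in l2 (X := X)].
have Dl g : D g -> l2 g by move=> [u ul <-]; exact: (ap_l2 sT ul).
have DS (t : R) g : D g -> D (g - scal t%:C (T (T g))).
  move=> [u ul <-]; have u1 := ap_l2 sT ul; have u2 := ap_l2 sT u1.
  exists (u - scal t%:C (T (T u))); first by apply: l2_sub => //; exact: l2_scal.
  by rewrite (ap_sub sT ul (l2_scal _ u2)) (ap_scal sT _ u2).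
have Dr g : D g -> r * l2norm g <= l2norm (T g) by move=> [u ul <-]; exact: rT.
have [|h hl Th] := @neumann _ _ _ _ D r sT r0 Dl DS Dr (T f); first by exists f.
have Thl := ap_l2 sT hl.
exists (f - T h); split; first exact: l2_sub.
  by rewrite (ap_sub sT fl Thl) Th subrr.
by rewrite opprB addrC subrK -Th; exact: rT.
Qed.

(** A finite-dimensional space of functions is determined by its values on a finite set [S], and [L]
    is a bounded reconstruction from these values. A new function [e0] adds a point where
    [e0 - L e0] does not vanish, or no point if [L] already reproduces it. *)
Lemma interpolation (k : nat) (e : 'I_k -> X -> R[i]) : (forall j, l2 (e j)) ->
  exists (S : seq X) (C : R) (L : (X -> R[i]) -> (X -> R[i])),
  [/\ 0 <= C, forall f g, L (f - g) = L f - L g,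
      forall c f g, L (scal c f + g) = scal c (L f) + L g,
      forall f, l2 f -> l2 (L f) /\ l2norm (L f) <= C * l2norm f
    & forall f, (forall x, x \in S -> f x = 0) -> L f = 0] /\
  forall j, L (e j) = e j.
Proof.
elim: k e => [|k IH] e el.
  exists [::], 0, (fun=> 0); split; last by case.
  split => //; first by move=> *; rewrite subrr.
  - by move=> c f g; rewrite scal0 addr0.
  - by move=> f fl; rewrite l2norm0 mul0r; split => //; exact: l2_0.
have [S [C [L [[C0 LB LZ Ll LS] Le]]]] := IH (fun j => e (lift ord0 j)) (fun j => el _).
pose e0 := e ord0; pose e' := e0 - L e0.
have [e'0|] := pselect (e' = 0).
  exists S, C, L; split => // j; case: (unliftP ord0 j) => [i ->|->]; first exact: Le.
  by move/eqP: e'0; rewrite subr_eq0 => /eqP <-.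
move=> /eqP/negP; rewrite -[~ _]/(~ _) => e'N.
have [x xN] : exists x, e' x != 0.
  apply: contrapT => /forallNP H; apply: e'N; apply/eqP/funext => x.
  by apply/eqP; apply: contrapT => /negP; exact: H.
have e'l : l2 e' by apply: l2_sub; [exact: el|exact: (Ll _ (el ord0)).1].
pose p f := (f x - L f x) / e' x.
have pB f g : p (f - g) = p f - p g.
  by rewrite /p LB -mulrBl; congr (_ / _); change ((f x - g x) - (L f x - L g x) = (f x - L f x) - (g x - L g x)); ring.
have pZ c f g : p (scal c f + g) = c * p f + p g.
  rewrite /p LZ mulrA -mulrDl; congr (_ / _).
  by change ((c * f x + g x) - (c * L f x + L g x) = c * (f x - L f x) + (g x - L g x)); ring.
exists (x :: S), (C + (1 + C) / Normc.normc (e' x) * l2norm e').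
exists (fun f => L f + scal (p f) e').
have n0 : 0 < Normc.normc (e' x).
  rewrite lt_def normc_ge0 andbT; apply: contra xN => /eqP/Normc.eq0_normc ->; exact: eqxx.
split; first split.
- by rewrite addr_ge0 ?mulr_ge0 ?l2norm_ge0 ?invr_ge0 ?(ltW n0)// addr_ge0.
- by move=> f g; rewrite LB pB scalDl scalNl opprD addrACA.
- move=> c f g; rewrite LZ pZ scalDl scalD scalA; exact: addrACA.
- move=> f fl; have [Lfl Lfn] := Ll f fl; split; first by apply: l2_add => //; exact: l2_scal.
  apply: le_trans (l2normD Lfl (l2_scal _ e'l)) _.
  rewrite mulrDl (l2norm_scal _ e'l); apply: lerD => //.
  rewrite mulrAC ler_wpM2r ?l2norm_ge0//.
  rewrite /p Normc.normcM Normc.normcV mulrAC ler_wpM2r ?invr_ge0 ?(ltW n0)//.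
  apply: le_trans (ler_normcD _ _) _; rewrite normcN' mulrDl mul1r; apply: lerD.
    exact: l2norm_pt.
  by apply: le_trans Lfn; exact: l2norm_pt.
- move=> f fS; have Lf : L f = 0 by apply: LS => y yS; apply: fS; rewrite in_cons yS orbT.
  rewrite /p Lf fS ?in_cons ?eqxx//.
  by apply/funext => y; rewrite /scal; change (0 + (0 - 0) / e' x * e' y = 0 :> R[i]); rewrite subrr !mul0r addr0.
- move=> j; case: (unliftP ord0 j) => [i ->|->].
    rewrite /p Le subrr mul0r; apply/funext => y.
    by change (e (lift ord0 i) y + 0 * e' y = e (lift ord0 i) y); rewrite mul0r addr0.
  have -> : p (e ord0) = 1 by rewrite /p; exact: divff.
  by rewrite scal1 /e' addrC subrK.
Qed.

Definition bdd_below_off A (lam : R) := exists (S : seq X) (c : R), 0 < c /\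
  forall f, l2 f -> (forall x, x \in S -> f x = 0) -> c * l2norm f <= l2norm (A f - scal lam%:C f).

(** If [f] vanishes on [S] and [u] is its kernel part, then [u = L (u - f)]: the kernel part is
    controlled by the remainder [f - u], which [isolated_kernel] bounds. *)
Lemma finite_isolated_bdd_below_off A lam (r : R) : sym_op A -> 0 < r ->
  (forall nu, 0 < `|nu - lam| -> `|nu - lam| < r -> ~ real_spectrum A nu) ->
  finite_multiplicity A lam%:C -> bdd_below_off A lam.
Proof.
move=> sA r0 iso [k [e [eE span]]].
have [S [C [L [[C0 LB LZ Ll LS] Le]]]] := interpolation (fun j => (eE j).1).
exists S, (r / (1 + C)); split; first by rewrite divr_gt0// ltr_wpDr.
move=> f fl fS.
have [u [ul Tu fu]] := isolated_kernel sA r0 iso fl.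
have [c uc] : exists c : 'I_k -> R[i], u = fun x => \sum_(j < k) c j * e j x.
  by apply: span; split => //; apply/subr0_eq.
have Lu : L u = u.
  have -> : u = \sum_(j < k) scal (c j) (e j).
    by rewrite uc; apply/funext => x; rewrite fct_sumE.
  elim/big_rec: _ => [|j w _ IH]; first by have := LB 0 0; rewrite !subrr.
  by rewrite LZ Le IH.
have ufl := l2_sub ul fl.
have un : l2norm u <= C * l2norm (f - u).
  have -> : u = L (u - f) by rewrite LB (LS f fS) subr0 Lu.
  by apply: le_trans (Ll _ ufl).2 _; rewrite LB (LS f fS) subr0 Lu l2norm_subC.
have h : l2norm f <= (1 + C) * l2norm (f - u).
  rewrite -[f in leLHS](subrK u); apply: le_trans (l2normD (l2_sub fl ul) ul) _.
  by rewrite mulrDl mul1r lerD2l.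
apply: le_trans fu; rewrite -mulrA ler_pM2l// ler_pdivrMl//.
by rewrite ltr_wpDr.
Qed.

(** If the bound fails once [x] is dropped, functions witnessing the failure do not vanish at [x]
    and can be scaled to 1 there. Differences of two of them vanish at [x], so the given bound makes
    a sequence of them Cauchy; its limit is [e]. *)
Lemma one_point_off T (L : seq X) x (c : R) : sym_op T -> 0 < c ->
  (forall f, l2 f -> (forall y, y \in x :: L -> f y = 0) -> c * l2norm f <= l2norm (T f)) ->
  (exists2 c' : R, 0 < c' & forall f, l2 f -> (forall y, y \in L -> f y = 0) ->
     c' * l2norm f <= l2norm (T f)) \/
  (exists e, [/\ l2 e, T e = 0, forall y, y \in L -> e y = 0 & e x = 1]).
Proof.
move=> sT c0 H; have [|nb] := pselect (exists2 c' : R, 0 < c' & forall f, l2 f ->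
  (forall y, y \in L -> f y = 0) -> c' * l2norm f <= l2norm (T f)); first by left.
right.
have small d : 0 < d -> d < c -> exists f, [/\ l2 f, forall y, y \in L -> f y = 0,
    f x = 1 & l2norm (T f) <= d * l2norm f].
  move=> d0 dc.
  have [f [fl fL lt_]] : exists f, [/\ l2 f, forall y, y \in L -> f y = 0 &
      l2norm (T f) < d * l2norm f].
    apply: contrapT => /forallNP N; apply: nb; exists d => // f fl fL.
    by rewrite leNgt; apply/negP => lt_; apply: (N f).
  have fx : f x != 0.
    apply/eqP => fx0; move: lt_; rewrite ltNge => /negP; apply.
    apply: (@le_trans _ _ (c * l2norm f)); first by rewrite ler_wpM2r ?l2norm_ge0// ltW.
    by apply: H => // y; rewrite in_cons => /orP[/eqP->//|/fL].
  exists (scal (f x)^-1 f); split.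
  - exact: l2_scal.
  - by move=> y /fL fy; rewrite /scal fy mulr0.
  - by rewrite /scal mulVf.
  - rewrite (ap_scal sT _ fl) !l2norm_scal//; last exact: (ap_l2 sT fl).
    by rewrite mulrCA ler_wpM2l ?normc_ge0// ltW.
have dist f g : l2 f -> l2 g -> (forall y, y \in L -> f y = 0) -> (forall y, y \in L -> g y = 0) ->
    f x = 1 -> g x = 1 -> c * l2norm (f - g) <= l2norm (T f) + l2norm (T g).
  move=> fl gl fL gL fx gx.
  apply: le_trans (H (f - g) (l2_sub fl gl) _) _.
    move=> y; rewrite in_cons => h; change (f y - g y = 0).
    by move: h => /orP[/eqP ->|yL]; [rewrite fx gx subrr|rewrite fL// gL// subrr].
  by rewrite (ap_sub sT fl gl); apply: l2normB; exact: (ap_l2 sT).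
have [f0 [f0l f0L f0x _]] : exists f, [/\ l2 f, forall y, y \in L -> f y = 0,
    f x = 1 & l2norm (T f) <= (c / 2) * l2norm f] by apply: small; lra.
(* From c |f - f0| <= |T f| + |T f0| and |T f| <= (c / 2) |f| follows |f| <= 2 (|f0| + |T f0| / c).
   The summand 1 makes [K] positive. *)
pose K := 2 * (l2norm f0 + l2norm (T f0) / c) + 1.
have K0 : 0 < K.
  by rewrite /K ltr_wpDl// mulr_ge0// addr_ge0 ?l2norm_ge0// divr_ge0 ?l2norm_ge0// ltW.
have small' d : 0 < d -> exists f, [/\ l2 f, forall y, y \in L -> f y = 0,
    f x = 1 & l2norm (T f) <= d].
  move=> d0; pose d' := Num.min (c / 2) (d / K).
  have d'0 : 0 < d' by rewrite lt_min !divr_gt0.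
  have d'c : d' <= c / 2 by rewrite ge_min lexx.
  have d'K : d' <= d / K by rewrite ge_min lexx orbT.
  have [f [fl fL fx Tf]] : exists f, [/\ l2 f, forall y, y \in L -> f y = 0,
    f x = 1 & l2norm (T f) <= d' * l2norm f] by apply: small => //; lra.
  exists f; split => //; apply: (le_trans Tf).
  have := dist f f0 fl f0l fL f0L fx f0x.
  have n0 := l2norm_ge0 f.
  have Tf' : l2norm (T f) <= c / 2 * l2norm f.
    apply: (le_trans Tf); exact: ler_wpM2r.
  have := l2norm_lb fl f0l => h1 h2.
  have fK : l2norm f <= K.
    have h3 : c * l2norm f <= c * (l2norm f / 2 + l2norm f0 + l2norm (T f0) / c).
      rewrite !mulrDr [c * (_ / c)]mulrC divfK ?gt_eqF//.
      have := ler_wpM2l (ltW c0) h1; rewrite mulrBr; lra.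
    by rewrite ler_pM2l// in h3; rewrite /K; lra.
  apply: (@le_trans _ _ (d / K * l2norm f)); first exact: ler_wpM2r.
  by rewrite mulrAC ler_pdivrMr// ler_pM2l.
pose dl (n : nat) : R := n.+1%:R^-1.
have dl0 n : 0 < dl n by rewrite invr_gt0 ltr0Sn.
have [u uP] := choice (fun n => small' (c / 2 * dl n) (mulr_gt0 (divr_gt0 c0 (ltr0Sn _ 1)) (dl0 n))).
have ul n : l2 (u n) by case: (uP n).
have dle n m : (n <= m)%N -> dl m <= dl n.
  by move=> nm; rewrite lef_pV2 ?posrE ?ltr0Sn// ler_nat.
have [||e el eP] := @l2_complete _ _ u dl ul.
- move=> n m nm; have [unl unL unx unT] := uP n; have [uml umL umx umT] := uP m.
  have := dist _ _ unl uml unL umL unx umx => h.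
  rewrite -(ler_pM2l c0); apply: le_trans h _.
  have := ler_wpM2l (ltW c0) (dle _ _ nm); lra.
- move=> d d0 n; have [m hm] := archimed_small d0.
  exists (maxn n m); first exact: leq_maxl.
  by apply: le_trans (dle _ _ (leq_maxr n m)) _; exact: hm.
have lim0 (a : R) : (forall n, a <= dl n) -> a <= 0.
  move=> h; apply/ler_addgt0Pr => d d0; rewrite add0r.
  by have [m hm] := archimed_small d0; exact: le_trans (h m) hm.
have pt y (v : R[i]) : (forall n, u n y = v) -> e y = v.
  move=> h; apply/esym/subr0_eq/Normc.eq0_normc/eqP; rewrite eq_le normc_ge0 andbT.
  apply: lim0 => n; apply: le_trans (eP n); rewrite -(h n).
  exact: (l2norm_pt y (l2_sub (ul n) el)).
exists e; split => //.
- apply: l2norm_eq0; first exact: (ap_l2 sT el).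
  have [M _ [M0 TM]] := ap_bound sT 0.
  apply/ler_addgt0Pr => d d0; rewrite add0r.
  have d1 : 0 < d / (M + c) by rewrite divr_gt0// addr_gt0.
  have [n hn] := archimed_small d1.
  have [unl _ _ unT] := uP n.
  have -> : T e = T (u n) - T (u n - e) by rewrite (ap_sub sT unl el) opprB addrC subrK.
  have l1 := l2_sub unl el.
  apply: le_trans (l2normB (ap_l2 sT unl) (ap_l2 sT l1)) _.
  have h1 := (TM _ l1).1; have h2 := eP n; have h3 := ler_wpM2l (ltW M0) h2.
  move: hn; rewrite -/(dl n) ler_pdivlMr ?addr_gt0// => h4.
  have := mulr_ge0 (ltW c0) (ltW (dl0 n)); lra.
- by move=> y yL; apply: pt => n; have [_ h _ _] := uP n; exact: h.
- by apply: pt => n; have [_ _ h _] := uP n.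
Qed.

(** The points of [S] are dropped one by one. Either a smaller bound holds without the point, or the
    point carries a kernel function with value 1 there, a multiple of which is subtracted from [f]
    to make it vanish at that point. *)
Lemma kernel_span T (S L : seq X) (c : R) : sym_op T -> 0 < c ->
  (forall f, l2 f -> (forall y, y \in S ++ L -> f y = 0) -> c * l2norm f <= l2norm (T f)) ->
  exists (k : nat) (e : 'I_k -> X -> R[i]) (c' : R),
  [/\ 0 < c', forall j, l2 (e j) /\ T (e j) = 0 &
      forall f, l2 f -> (forall y, y \in L -> f y = 0) -> exists a : 'I_k -> R[i],
        c' * l2norm (f - \sum_(j < k) scal (a j) (e j)) <= l2norm (T f)].
Proof.
move=> sT; elim: S L c => [|x S IH] L c c0 H.
  exists 0%N, (fun=> 0), c; split => //; first by case.
  by move=> f fl fL; exists (fun=> 0); rewrite big_ord0 subr0; exact: H.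
have [[c' c'0 H']|[e0 [e0l Te0 e0L e0x]]] := one_point_off sT c0 H; first exact: (IH L c').
have [|k [e [c' [c'0 eP spanP]]]] := IH (x :: L) c c0.
  move=> f fl fL; apply: H => // y yL; apply: fL; move: yL.
  by rewrite !(mem_cat, in_cons); case: (y == x); case: (y \in S).
exists k.+1, (fun j => if unlift ord0 j is Some i then e i else e0), c'; split => //.
  by move=> j; case: (unlift ord0 j) => [i|]; [exact: eP|].
move=> f fl fL; pose g := f - scal (f x) e0.
have e1l := l2_scal (f x) e0l.
have gl : l2 g by exact: l2_sub.
have [|a aP] := spanP g gl.
  move=> y; rewrite in_cons => h; change (f y - f x * e0 y = 0).
  move: h => /orP[/eqP ->|yL]; first by rewrite e0x mulr1 subrr.
  by rewrite fL// e0L ?mulr0 ?subr0// mem_cat yL orbT.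
exists (fun j => if unlift ord0 j is Some i then a i else f x).
rewrite big_ord_recl unlift_none.
under eq_bigr do rewrite liftK.
move: aP; rewrite /g (ap_sub sT fl e1l) (ap_scal sT _ e0l) Te0 scal0 subr0.
by rewrite opprD addrA.
Qed.

Lemma bdd_below_off_disc A lam : sym_op A -> bdd_below_off A lam -> real_spectrum A lam ->
  [/\ exists2 r : R, 0 < r & forall nu, 0 < `|nu - lam| -> `|nu - lam| < r -> ~ real_spectrum A nu,
      op_eigenvalue A lam%:C & finite_multiplicity A lam%:C].
Proof.
move=> sA [S [c [c0 H]]] lamP; have sT := sym_shift lam sA.
set T := opshift A lam%:C in sT.
have [|k [e [c' [c'0 eP spanP]]]] := @kernel_span T S [::] c sT c0.
  by move=> f fl; rewrite cats0; exact: H.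
have kerE f : l2 f -> T f = 0 -> op_eigenspace A lam%:C f.
  by move=> fl Tf; split => //; exact: (subr0_eq Tf).
have sl (a : 'I_k -> R[i]) : l2 (\sum_(j < k) scal (a j) (e j)).
  by apply: l2_sum => j; apply: l2_scal; exact: (eP j).1.
have Ts (a : 'I_k -> R[i]) : T (\sum_(j < k) scal (a j) (e j)) = 0.
  rewrite (ap_sum sT); last by move=> j; apply: l2_scal; exact: (eP j).1.
  by rewrite big1// => j _; rewrite (ap_scal sT _ (eP j).1) (eP j).2 scal0.
split.
- exists (c' / 2); first lra.
  (* The bound is |nu - lam|. In the expansion of |(T - (nu - lam)) f|^2 the cross term involves
     only the part of [f] off the kernel, so c' |ip (T f) f| <= |T f|^2, and |nu - lam| < c' / 2
     lets |T f|^2 absorb it. *)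
  move=> nu nu0 nur nuP; apply: (nuP `|nu - lam|) => // f fl.
  have [//|a aP] := spanP f fl.
  have Tl := ap_l2 sT fl; have fsl := l2_sub fl (sl a).
  have -> : A f - scal nu%:C f = T f + scal (- (nu - lam))%:C f.
    rewrite /T /opshift -addrA; congr (_ + _).
    by rewrite -!scalNl -scalDl -!rmorphN -rmorphD; congr (scal _%:C f); ring.
  rewrite -(@ler_pXn2r _ 2) ?nnegrE ?mulr_ge0 ?l2norm_ge0// (ip_lin _ Tl fl).
  rewrite exprMn real_normK ?num_real// sqrrN.
  have := cauchy_schwarz Tl fsl; rewrite -(ip_kernel_range sT fl (sl a) (Ts a)) => cs.
  have h1 : c' * `|ip (T f) f| <= l2norm (T f) ^+ 2.
    apply: (@le_trans _ _ (c' * (l2norm (T f) * l2norm (f - \sum_(j < k) scal (a j) (e j))))).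
      by rewrite ler_pM2l.
    by rewrite mulrCA expr2 ler_wpM2l ?l2norm_ge0.
  have h2 : `|2 * (nu - lam) * ip (T f) f| <= c' * `|ip (T f) f|.
    by rewrite 2!normrM ler_wpM2r// ger0_norm//; lra.
  have h3 : - `|2 * (nu - lam) * ip (T f) f| <= 2 * - (nu - lam) * ip (T f) f.
    rewrite mulrN mulNr lerN2; exact: ler_norm.
  lra.
- apply: contrapT => noe; apply: (lamP c' c'0) => f fl.
  have [//|a aP] := spanP f fl.
  suff e0 : \sum_(j < k) scal (a j) (e j) = 0 by move: aP; rewrite e0 subr0.
  rewrite big1// => j _; suff -> : e j = 0 by rewrite scal0.
  apply: contrapT => ej; apply: noe; exists (e j) => //.
  by apply: kerE; [exact: (eP j).1|exact: (eP j).2].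
- exists k, e; split; first by move=> j; apply: kerE; [exact: (eP j).1|exact: (eP j).2].
  move=> f [fl Af]; have [//|a aP] := spanP f fl; exists a.
  have Tf : T f = 0 by rewrite /T /opshift Af; exact: subrr.
  have := aP; rewrite Tf l2norm0 pmulr_rle0// => /(l2norm_eq0 (l2_sub fl (sl a)))/subr0_eq ->.
  by apply/funext => x; rewrite fct_sumE.
Qed.

Lemma nbhs_complexE (z : R[i]) (V : set R[i]) : nbhs (z : R[i]^o) V <->
  exists2 r : R, 0 < r & forall w, Normc.normc (w - z) < r -> V w.
Proof.
split.
  move=> /nbhs_ballP[e /= e0 H].
  have ee : e = (complex.Re e)%:C by move: e0; case: (e) => a b; rewrite ltcE /= => /andP[/eqP -> _].
  have r0 : 0 < complex.Re e by move: e0; rewrite ltcE => /andP[].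
  exists (complex.Re e) => // w wz; apply: H.
  rewrite -ball_normE /= ee -normrN opprB.
  by case: (w - z) wz => a b /= h; rewrite ltcR.
move=> [r r0 H]; apply/nbhs_ballP; exists r%:C => /=; first by rewrite ltcR.
move=> w; rewrite -ball_normE /= => h; apply: H.
by move: h; rewrite -normrN opprB; case: (w - z) => a b /=; rewrite ltcR.
Qed.

Lemma isolated_realE (E : set R) (lam : R) :
  isolated ([set nu%:C | nu in E] : set R[i]^o) lam%:C <->
  E lam /\ exists2 r : R, 0 < r & forall nu, 0 < `|nu - lam| -> `|nu - lam| < r -> ~ E nu.
Proof.
split.
  move=> [/set_mem[mu Emu] /complexI e [V /nbhs_complexE[r r0 VP] VE]]; subst mu.
  split=> //; exists r => // nu nu0 nur Enu.
  have : (V `&` [set nu%:C | nu in E]) nu%:C.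
    split; last by exists nu.
    by apply: VP; rewrite -rmorphB normc_real.
  by rewrite VE => /complexI e; move: nu0; rewrite e subrr normr0 ltxx.
move=> [El [r r0 H]]; split; first by apply/mem_set; exists lam.
exists [set w | Normc.normc (w - lam%:C) < r]; first by apply/nbhs_complexE; exists r.
apply/seteqP; split => w /=.
  move=> [wr [nu Enu ew]]; subst w; move: wr; rewrite -rmorphB normc_real => nur.
  apply: contrapT => ne; apply: (H nu) => //.
  rewrite normr_gt0 subr_eq0; apply/eqP => e; apply: ne; by rewrite e.
by move=> ->; split; [rewrite subrr Normc.normc0|exists lam].
Qed.

(** Weyl's criterion, with functions vanishing on finite sets in the place of weakly null
    sequences. *)
Lemma ess_spectrumE A : sym_op A ->
  ess_spectrum A = [set lam%:C | lam in [set lam | ~ bdd_below_off A lam]].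
Proof.
move=> sA; apply/seteqP; split => z /=.
  move=> [+ nd]; rewrite spectrumE// => -[lam lamP ez]; exists lam => // boff.
  have [iso ev fm] := bdd_below_off_disc sA boff lamP.
  apply: nd; rewrite -ez; split => //.
  by rewrite spectrumE//; apply/isolated_realE.
move=> [lam nb <-]; split.
  rewrite spectrumE//; exists lam => // c c0 H; apply: nb; exists [::], c; split => // f fl _.
  exact: H.
move=> [iso ev fm]; apply: nb.
move: iso; rewrite spectrumE// => /isolated_realE[_ [r r0 iso]].
exact: finite_isolated_bdd_below_off r0 iso fm.
Qed.

End Essential.

(** * Convolution operators *)

Lemma dotc_le_normc {R : realType} (z w : R[i]) : `|dotc z w| <= Normc.normc z * Normc.normc w.
Proof.
rewrite -(@ler_pXn2r _ 2) ?nnegrE ?mulr_ge0 ?normc_ge0// exprMn real_normK ?num_real// !normc2.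
by case: z w => [a b] [c e]; rewrite /dotc /=; have := sqr_ge0 (a * e - b * c); rewrite !expr2; lra.
Qed.

Lemma esum_term {R : realType} {T : choiceType} (b : T -> \bar R) t :
  (forall t, 0 <= b t)%E -> (b t <= \esum_(t in [set: T]) b t)%E.
Proof.
move=> b0; apply: esum_ge; exists [set t]; first by split.
by rewrite fsbig_set1.
Qed.

Lemma nsum_exchange {R : realType} {T T' : choiceType} (g : T -> T' -> R) :
  (forall t t', 0 <= g t t') -> (forall t', nfin (g ^~ t')) ->
  nfin (fun t' => nsum (g ^~ t')) ->
  [/\ forall t, nfin (g t), nfin (fun t => nsum (g t)) &
      nsum (fun t => nsum (g t)) = nsum (fun t' => nsum (g ^~ t'))].
Proof.
move=> g0 gf gF.
have E : (\esum_(t in [set: T]) \esum_(t' in [set: T']) (g t t')%:E =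
          (nsum (fun t' => nsum (g ^~ t')))%:E)%E.
  rewrite esum_exchange// -nsumE//; last by move=> t'; exact: nsum_ge0.
  by apply: eq_esum => t' _; rewrite -nsumE.
have gf1 t : nfin (g t).
  rewrite /nfin; apply: le_lt_trans (ltry (nsum (fun t' => nsum (g ^~ t')))).
  rewrite -E; apply: (esum_term (b := fun t => \esum_(t' in [set: T']) (g t t')%:E)%E) => s.
  by apply: esum_ge0 => t' _; rewrite lee_fin.
have E' : (\esum_(t in [set: T]) (nsum (g t))%:E =
          (nsum (fun t' => nsum (g ^~ t')))%:E)%E.
  by rewrite -E; apply: eq_esum => t _; rewrite -nsumE.
by split => //; [rewrite /nfin E' ltry|rewrite /nsum E'].
Qed.

Lemma rsum_exchange {R : realType} {T T' : choiceType} (g : T -> T' -> R) :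
  (forall t', abssum (g ^~ t')) -> nfin (fun t' => nsum (fun t => `|g t t'|)) ->
  (forall t, abssum (g t)) ->
  rsum (fun t => rsum (g t)) = rsum (fun t' => rsum (g ^~ t')).
Proof.
move=> gf gF gf'.
pose p t t' := Num.max (g t t') 0; pose n t t' := Num.max (- g t t') 0.
have p0 t t' : 0 <= p t t' by rewrite /p le_max lexx orbT.
have n0 t t' : 0 <= n t t' by rewrite /n le_max lexx orbT.
have ple t t' : p t t' <= `|g t t'| by rewrite /p ge_max normr_ge0 ler_norm.
have nle t t' : n t t' <= `|g t t'| by rewrite /n ge_max normr_ge0 -normrN ler_norm.
have [||p1 p2 p3] := @nsum_exchange _ _ _ p p0.
- by move=> t'; apply: nfin_le (gf t').
- by apply: nfin_le gF => t'; apply: nsum_le => //; exact: gf.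
have [||n1 n2 n3] := @nsum_exchange _ _ _ n n0.
- by move=> t'; apply: nfin_le (gf t').
- by apply: nfin_le gF => t'; apply: nsum_le => //; exact: gf.
have -> : (fun t => rsum (g t)) = (fun t => nsum (p t) - nsum (n t)) by [].
have -> : (fun t' => rsum (g ^~ t')) = (fun t' => nsum (p ^~ t') - nsum (n ^~ t')) by [].
rewrite !rsum_split ?p3 ?n3//; do ?[by move=> ?; exact: nsum_ge0].
  by apply: nfin_le gF => t'; apply: nsum_le => //; exact: gf.
by apply: nfin_le gF => t'; apply: nsum_le => //; exact: gf.
Qed.

(** * Absolutely summable complex families *)

Section ComplexSum.
Context {R : realType} {T : choiceType}.
Implicit Types (g h : T -> R[i]).

Definition csummable g := nfin (fun t => Normc.normc (g t)).

Lemma csummable_Re g : csummable g -> abssum (fun t => complex.Re (g t)).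
Proof. by apply: nfin_le => t; exact: Re_normc. Qed.

Lemma csummable_Im g : csummable g -> abssum (fun t => complex.Im (g t)).
Proof. by apply: nfin_le => t; exact: Im_normc. Qed.

Lemma csummable_le g (k : T -> R) : (forall t, Normc.normc (g t) <= k t) -> nfin k ->
  csummable g.
Proof. exact: nfin_le. Qed.

Lemma csummableZ c g : csummable g -> csummable (fun t => c * g t).
Proof.
move=> gf; apply: csummable_le (nfinZ (normc_ge0 c) _ gf) => t; rewrite ?normc_ge0//.
by rewrite Normc.normcM.
Qed.

(** The factor 2 comes from bounding real and imaginary parts separately; it reappears in the
    operator bounds for convolutions. *)
Lemma csum_dotc_le g : csummable g ->
  dotc (csum g) (csum g) <= 2 * nsum (fun t => Normc.normc (g t)) ^+ 2.
Proof.
move=> gf; rewrite /dotc /csum /= -!expr2.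
have h (k : T -> R) : abssum k -> (forall t, `|k t| <= Normc.normc (g t)) ->
    rsum k ^+ 2 <= nsum (fun t => Normc.normc (g t)) ^+ 2.
  move=> kf kg; rewrite -(real_normK (num_real (rsum k))) ler_pXn2r ?nnegrE ?nsum_ge0//; last first.
    by move=> t; exact: normc_ge0.
  by apply: le_trans (rsum_norm kf) _; exact: nsum_le.
have := h _ (csummable_Re gf) (fun t => Re_normc (g t)).
have := h _ (csummable_Im gf) (fun t => Im_normc (g t)); lra.
Qed.

Lemma csumD g h : csummable g -> csummable h ->
  csum (fun t => g t + h t) = csum g + csum h.
Proof.
move=> gf hf; rewrite /csum.
have -> : (fun t => complex.Re (g t + h t)) = (fun t => complex.Re (g t) + complex.Re (h t)).
  by apply/funext => t; case: (g t) (h t) => [? ?] [? ?].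
have -> : (fun t => complex.Im (g t + h t)) = (fun t => complex.Im (g t) + complex.Im (h t)).
  by apply/funext => t; case: (g t) (h t) => [? ?] [? ?].
by rewrite (rsumD (csummable_Re gf) (csummable_Re hf)) (rsumD (csummable_Im gf) (csummable_Im hf)).
Qed.

Lemma csumZ c g : csummable g -> csum (fun t => c * g t) = c * csum g.
Proof.
move=> gf; have gr := csummable_Re gf; have gi := csummable_Im gf.
case: c => a b; rewrite /csum; apply/eqP; rewrite eq_complex; apply/andP; split; apply/eqP => /=.
  rewrite -(rsumZ a gr) -(rsumZ b gi) -rsumN -(rsumD (abssumZ a gr) (abssumN (abssumZ b gi))).
  by congr rsum; apply/funext => t; case: (g t).
rewrite -(rsumZ a gi) -(rsumZ b gr) -(rsumD (abssumZ a gi) (abssumZ b gr)).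
by congr rsum; apply/funext => t; case: (g t) => ? ? /=.
Qed.

Lemma csum_finsupp g (s : seq T) : uniq s -> (forall t, t \notin s -> g t = 0) ->
  csummable g /\ csum g = \sum_(t <- s) g t.
Proof.
move=> us gs; split.
  have [|h _] := @nsum_finsupp _ _ (fun t => Normc.normc (g t)) s (fun t => normc_ge0 _) us.
    by move=> t /gs ->; rewrite Normc.normc0.
  exact: h.
rewrite /csum.
have [|_ e1] := @rsum_finsupp _ _ (fun t => complex.Re (g t)) s us.
  by move=> t /gs ->.
have [|_ e2] := @rsum_finsupp _ _ (fun t => complex.Im (g t)) s us.
  by move=> t /gs ->.
rewrite e1 e2 {e1 e2}.
elim: s {us gs} => [|t s IH]; first by rewrite !big_nil.
by rewrite !big_cons -IH; case: (g t).
Qed.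

Lemma dotc_csum g w : csummable g ->
  abssum (fun t => dotc (g t) w) /\ dotc (csum g) w = rsum (fun t => dotc (g t) w).
Proof.
move=> gf; have gr := csummable_Re gf; have gi := csummable_Im gf.
have h1 : abssum (fun t => complex.Re w * complex.Re (g t)) by exact: abssumZ.
have h2 : abssum (fun t => complex.Im w * complex.Im (g t)) by exact: abssumZ.
have e : (fun t => dotc (g t) w) =
    (fun t => complex.Re w * complex.Re (g t) + complex.Im w * complex.Im (g t)).
  by apply/funext => t; rewrite /dotc; ring.
rewrite e; split; first exact: abssumD.
by rewrite rsumD// !rsumZ// /dotc /csum /=; ring.
Qed.

End ComplexSum.

Lemma csum_reindex {R : realType} {T T' : choiceType} (e : T -> T') (g : T' -> R[i]) :
  bijective e -> csum g = csum (fun t => g (e t)).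
Proof.
by move=> be; rewrite /csum (rsum_reindex _ be) (rsum_reindex (fun t => complex.Im (g t)) be).
Qed.

Section Relabel.
Context {R : realType} {X X' : choiceType} (e : X -> X') (be : bijective e).
Implicit Types f g : X' -> R[i].

Lemma l2_relabel f : l2 f <-> l2 (f \o e).
Proof. by rewrite /l2 (nsum_reindex (fun x => Normc.normc (f x) ^+ 2) be). Qed.

Lemma l2norm_relabel f : l2norm (f \o e) = l2norm f.
Proof. by rewrite /l2norm (nsum_reindex (fun x => Normc.normc (f x) ^+ 2) be). Qed.

Lemma ip_relabel f g : ip (f \o e) (g \o e) = ip f g.
Proof. by rewrite /ip [RHS](rsum_reindex _ be). Qed.

End Relabel.

(** * A Schur test for weighted superpositions *)

Section Young.
Context {R : realType} {X Y : choiceType}.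
Variables (a : Y -> R[i]) (u : X -> Y -> R[i]) (k : Y -> R) (K : R).
Hypothesis a1 : csummable a.
Hypothesis ul : forall y, l2 (u ^~ y).
Hypothesis uk : forall y, l2norm (u ^~ y) ^+ 2 <= k y.
Hypothesis kK : forall y, k y <= K.

Let al y := Normc.normc (a y).
Let q x y := al y * dotc (u x y) (u x y).

Let al0 y : 0 <= al y. Proof. exact: normc_ge0. Qed.
Let q0 x y : 0 <= q x y. Proof. by rewrite mulr_ge0// dotc_ge0. Qed.
Let k0 y : 0 <= k y. Proof. by apply: le_trans (uk y); rewrite sqr_ge0. Qed.

Lemma nfin_weight : nfin (fun y => al y * k y).
Proof.
have K0 (y : Y) : 0 <= K by exact: (le_trans (k0 y) (kK y)).
have [y|noY] := pselect (exists y : Y, True); last first.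
  by rewrite /nfin esum1 ?ltry// => y; exfalso; apply: noY; exists y.
case: y => y _.
have : nfin (fun y => K * al y) by apply: nfinZ => //; exact: K0 y.
by apply: nfin_le => z; rewrite mulrC ler_wpM2r.
Qed.

Let qy y : nfin (q ^~ y) /\ nsum (q ^~ y) <= al y * k y.
Proof.
have /l2E h := ul y; have d0 x : 0 <= dotc (u x y) (u x y) by exact: dotc_ge0.
split; first exact: nfinZ.
rewrite nsumZ// ler_wpM2l//; apply: le_trans (uk y).
by rewrite l2norm2 /ip rsum_nonneg.
Qed.

Let exch : [/\ forall x, nfin (q x), nfin (fun x => nsum (q x)) &
      nsum (fun x => nsum (q x)) = nsum (fun y => nsum (q ^~ y))].
Proof.
apply: nsum_exchange => // [y|]; first exact: (qy y).1.
by apply: nfin_le nfin_weight => y; exact: (qy y).2.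
Qed.

Lemma young_summable x : csummable (fun y => a y * u x y).
Proof.
have [qx _ _] := exch.
have : nfin (fun y => al y + q x y) by apply: nfinD.
apply: nfin_le => y; rewrite Normc.normcM -/(al y) /q -normc2.
have := sqr_ge0 (Normc.normc (u x y) - 1).
have := al0 y => h1 h2.
rewrite -[X in X + _]mulr1 -mulrDr ler_wpM2l//.
by move: h2; rewrite sqrrB1; have := normc_ge0 (u x y); lra.
Qed.

(** Cauchy-Schwarz in [y] with the weights [al y], followed by an exchange of sums. The family [u]
    is arbitrary so that one bound serves convolutions and commutators, and [k] records which [y]
    contribute little. *)
Lemma young : l2 (fun x => csum (fun y => a y * u x y)) /\
  l2norm (fun x => csum (fun y => a y * u x y)) ^+ 2 <=
    2 * nsum al * nsum (fun y => al y * k y).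
Proof.
have [qx qX qE] := exch.
pose F x := csum (fun y => a y * u x y).
have Fx x : dotc (F x) (F x) <= (2 * nsum al) * nsum (q x).
  apply: le_trans (csum_dotc_le (young_summable x)) _.
  rewrite -mulrA ler_pM2l// mulrC.
  have sm := young_summable x.
  have -> : nsum (fun y => Normc.normc (a y * u x y)) = rsum (fun y => Normc.normc (a y * u x y)).
    by rewrite rsum_nonneg// => y; exact: normc_ge0.
  apply: discr_le; [exact: nsum_ge0|exact: nsum_ge0|move=> t].
  have abs1 : abssum (fun y => 2 * t * Normc.normc (a y * u x y)).
    by apply: abssumZ; apply: nfin_le sm => y; rewrite ger0_norm// normc_ge0.
  have abs2 : abssum (q x) by apply: nfin_le (qx x) => y; rewrite ger0_norm.
  have abs3 : abssum (fun y => t ^+ 2 * al y).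
    by apply: abssumZ; apply: nfin_le a1 => y; rewrite ger0_norm// normc_ge0.
  (* The quadratic polynomial in [t] is the sum over [y] of |a y| (|u x y| + t)^2. *)
  have -> : nsum (q x) + 2 * t * rsum (fun y => Normc.normc (a y * u x y)) + t ^+ 2 * nsum al
     = rsum (fun y => q x y + 2 * t * Normc.normc (a y * u x y) + t ^+ 2 * al y).
    rewrite !rsumD//; last exact: abssumD.
    rewrite !rsumZ//; last 2 first.
    - by apply: nfin_le a1 => y; rewrite ger0_norm// normc_ge0.
    - by apply: nfin_le sm => y; rewrite ger0_norm// normc_ge0.
    have nn y : 0 <= Normc.normc (a y * u x y) by exact: normc_ge0.
    by rewrite (rsum_nonneg (q0 x)) (rsum_nonneg nn) (rsum_nonneg al0).
  rewrite rsum_nonneg; first apply: nsum_ge0; move=> y;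
    rewrite Normc.normcM /q -normc2 -/(al y);
    have := mulr_ge0 (al0 y) (sqr_ge0 (Normc.normc (u x y) + t)); rewrite sqrrD; lra.
have c0 : 0 <= 2 * nsum al by rewrite mulr_ge0// nsum_ge0.
have nf : nfin (fun x => (2 * nsum al) * nsum (q x)).
  by apply: nfinZ => // x; exact: nsum_ge0.
have Fl : l2 F by apply/l2E; exact: nfin_le nf.
split => //; rewrite -/F l2norm2 /ip rsum_nonneg => [|x]; last exact: dotc_ge0.
apply: le_trans (nsum_le (fun x => dotc_ge0 (F x)) Fx nf) _.
rewrite nsumZ//; last by move=> x; exact: nsum_ge0.
rewrite ler_wpM2l// qE; apply: nsum_le => [y|y|]; [exact: nsum_ge0|exact: (qy y).2|exact: nfin_weight].
Qed.

End Young.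

(** Dominated convergence in uniform form: [F] is chosen before the weights [k] and serves all of
    them. *)
Lemma nsum_weight_small {R : realType} {Y : choiceType} (a : Y -> R[i]) (d : R) :
  csummable a -> 0 < d -> exists2 F : seq Y, uniq F &
  forall (k : Y -> R) (K eta : R), 0 <= K -> (forall y, 0 <= k y <= K) -> 0 <= eta ->
    (forall y, y \in F -> k y <= eta) ->
    nsum (fun y => Normc.normc (a y) * k y) <=
      eta * nsum (fun y => Normc.normc (a y)) + K * d.
Proof.
move=> a1 d0; have [F uF Fd] := nsum_tail (fun y => normc_ge0 (a y)) a1 d0.
exists F => // k K eta K0 kK eta0 kF.
pose t y := if y \in F then 0 else Normc.normc (a y).
have t0 y : 0 <= t y by rewrite /t; case: ifP => // _; exact: normc_ge0.
have tf : nfin t by apply: nfin_le a1 => y; rewrite /t; case: ifP => // _; exact: normc_ge0.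
have n0 y : 0 <= Normc.normc (a y) by exact: normc_ge0.
have : nsum (fun y => Normc.normc (a y) * k y) <= nsum (fun y => eta * Normc.normc (a y) + K * t y).
  apply: nsum_le => [y|y|].
  - by have /andP[h _] := kK y; rewrite mulr_ge0.
  - have /andP[h1 h2] := kK y; rewrite /t; case: ifPn => yF.
      by rewrite mulr0 addr0 mulrC ler_wpM2r// kF.
    by rewrite -[leLHS]add0r lerD ?mulr_ge0// mulrC ler_wpM2r.
  - by apply: nfinD => [y|y||]; rewrite ?mulr_ge0//; exact: nfinZ.
move=> /le_trans; apply.
rewrite nsumD ?nsumZ//; do ?[by move=> y; rewrite mulr_ge0]; do ?exact: nfinZ.
by rewrite lerD2l ler_wpM2l.
Qed.

Section ConvOp.
Context {R : realType} {Y : choiceType} {G : zmodType}.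
Implicit Types (a : Y -> R[i]) (p : Y -> G) (W : G -> R) (f g : G -> R[i]).

(* Y indexes hops: the shift p y need not determine y, so that changes of coordinates and passage
   to fibres only modify p and a. *)
Definition convol a p f : G -> R[i] := fun x => csum (fun y => a y * f (x - p y)).

Definition conv_op a p W f : G -> R[i] := fun x => convol a p f x + (W x)%:C * f x.

Lemma bij_translate (y : G) : bijective (fun x : G => x - y).
Proof. by exists (fun x => x + y) => x; rewrite ?subrK ?addrK. Qed.

Lemma l2_transl f y : l2 f -> l2 (fun x => f (x - y)).
Proof. by move=> /(l2_relabel (bij_translate y)). Qed.

Lemma l2norm_transl f y : l2norm (fun x => f (x - y)) = l2norm f.
Proof. exact: (l2norm_relabel (bij_translate y) f). Qed.

Lemma conv_summable a p f x : csummable a -> l2 f ->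
  csummable (fun y => a y * f (x - p y)).
Proof.
move=> a1 fl; apply: (@young_summable _ _ _ a (fun x y => f (x - p y))
   (fun=> l2norm f ^+ 2) (l2norm f ^+ 2)) => //.
- by move=> y; exact: l2_transl.
- by move=> y; rewrite (l2norm_transl f (p y)).
Qed.

Lemma conv_l2 a p f : csummable a -> l2 f -> l2 (convol a p f) /\
  l2norm (convol a p f) <= 2 * nsum (fun y => Normc.normc (a y)) * l2norm f.
Proof.
move=> a1 fl.
have [y|y|cl cn] := @young _ _ _ a (fun x y => f (x - p y))
   (fun=> l2norm f ^+ 2) (l2norm f ^+ 2) a1 (fun y => l2_transl (p y) fl).
- by rewrite (l2norm_transl f (p y)).
- by [].
split => //; set N := nsum _ in cn *.
have N0 : 0 <= N by apply: nsum_ge0 => y; exact: normc_ge0.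
rewrite -(@ler_pXn2r _ 2) ?nnegrE ?mulr_ge0 ?l2norm_ge0//.
apply: le_trans cn _.
have -> : nsum (fun y => Normc.normc (a y) * l2norm f ^+ 2) = l2norm f ^+ 2 * N.
  rewrite -nsumZ// ?sqr_ge0//; last by move=> y; exact: normc_ge0.
  by congr nsum; apply/funext => y; rewrite mulrC.
have := mulr_ge0 (sqr_ge0 N) (sqr_ge0 (l2norm f)); rewrite !exprMn; lra.
Qed.

Lemma conv_lin a p c f g : csummable a -> l2 f -> l2 g ->
  convol a p (scal c f + g) = scal c (convol a p f) + convol a p g.
Proof.
move=> a1 fl gl; apply/funext => x.
have h1 := conv_summable p x a1 fl; have h2 := conv_summable p x a1 gl.
change (csum (fun y => a y * (c * f (x - p y) + g (x - p y))) = c * convol a p f x + convol a p g x).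
rewrite /convol -csumZ// -csumD//; last exact: csummableZ.
by congr csum; apply/funext => y; ring.
Qed.

(** [s] reverses a hop. It is given as data because several hops may share a shift, so that [p]
    alone does not determine the reverse hop. *)
Record herm_kernel a p (s : Y -> Y) : Prop := HermKernel {
  hk_sum : csummable a;
  hk_inv : involutive s;
  hk_conj : forall y, a (s y) = (a y)^*;
  hk_opp : forall y, p (s y) = - p y }.

Lemma conv_adj a p s f g : herm_kernel a p s -> l2 f -> l2 g ->
  ip (convol a p f) g = ip f (convol a p g).
Proof.
move=> [a1 sK sa sp].
have dc (f0 g0 : G -> R[i]) x : l2 f0 -> l2 g0 ->
   dotc (convol a p f0 x) (g0 x) = rsum (fun y => dotc (a y * f0 (x - p y)) (g0 x)).
  by move=> fl gl; rewrite (dotc_csum _ (conv_summable p x a1 fl)).2.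
have ex f0 g0 : l2 f0 -> l2 g0 -> ip (convol a p f0) g0 =
    rsum (fun y => ip (scal (a y) (fun x => f0 (x - p y))) g0).
  move=> fl gl; rewrite /ip.
  have -> : (fun x => dotc (convol a p f0 x) (g0 x)) =
      (fun x => rsum (fun y => dotc (a y * f0 (x - p y)) (g0 x))).
    by apply/funext => x; exact: dc.
  have sl y : l2 (scal (a y) (fun x => f0 (x - p y))).
    by apply: l2_scal; exact: l2_transl.
  apply: (rsum_exchange (g := fun x y => dotc (a y * f0 (x - p y)) (g0 x))).
  - by move=> y; exact: (l2_dotc (sl y) gl).
  - have g2 : nfin (fun x => Normc.normc (g0 x) ^+ 2) by exact: gl.
    have f2 y : nfin (fun x => Normc.normc (f0 (x - p y)) ^+ 2) by exact: (l2_transl (p y) fl).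
    have n0 (h : G -> R[i]) x : 0 <= Normc.normc (h x) ^+ 2 by exact: sqr_ge0.
    have nE (h : G -> R[i]) : nsum (fun x => Normc.normc (h x) ^+ 2) = l2norm h ^+ 2.
      rewrite l2norm2 /ip rsum_nonneg => [|x]; last exact: dotc_ge0.
      by congr nsum; apply/funext => x; rewrite normc2.
    have : nfin (fun y => (l2norm f0 ^+ 2 + l2norm g0 ^+ 2) * Normc.normc (a y)).
      by apply: nfinZ => // [|y]; rewrite ?addr_ge0 ?sqr_ge0 ?normc_ge0.
    apply: nfin_le => y; rewrite mulrC -(nE g0) -(l2norm_transl f0 (p y)) -nE.
    rewrite -nsumD//.
    rewrite -nsumZ ?normc_ge0//; last 2 first.
    - by move=> x; rewrite addr_ge0 ?sqr_ge0.
    - by apply: nfinD => // x; exact: sqr_ge0.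
    apply: nsum_le => // [x|].
      apply: le_trans (dotc_le_normc _ _) _; rewrite Normc.normcM -mulrA.
      rewrite ler_wpM2l ?normc_ge0//.
      have := sqr_ge0 (Normc.normc (f0 (x - p y)) - Normc.normc (g0 x)); rewrite sqrrB.
      have := mulr_ge0 (normc_ge0 (f0 (x - p y))) (normc_ge0 (g0 x)); lra.
    apply: nfinZ => [|x|]; [exact: normc_ge0|by rewrite addr_ge0 ?sqr_ge0|].
    by apply: nfinD => // x; exact: sqr_ge0.
  - by move=> x; exact: (dotc_csum _ (conv_summable p x a1 fl)).1.
move=> fl gl; rewrite ex// (ipC f) ex//.
(* Reversing the hops on one side matches the translation by [p y] and the conjugate coefficient on
   the other. *)
rewrite [RHS](rsum_reindex _ (inv_bij sK)); congr rsum; apply/funext => y.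
rewrite sa sp.
have e1 : scal (a y)^* (fun x => g (x - - p y)) \o (fun x => x - p y) = scal (a y)^* g.
  by apply/funext => x; rewrite /scal /= opprK subrK.
rewrite -[RHS](ip_relabel (bij_translate (p y))) e1 [RHS]ip_scall conjcK [RHS]ipC.
by [].
Qed.

Lemma normc_real_mul_le (r c : R) (z : R[i]) : `|r| <= c ->
  Normc.normc (r%:C * z) <= Normc.normc (c%:C * z).
Proof.
move=> rc; rewrite (Normc.normcM r%:C) (Normc.normcM c%:C) !normc_real.
by rewrite ler_wpM2r ?normc_ge0// (le_trans rc)// ler_norm.
Qed.

Lemma mulW_l2 W M f : (forall x, `|W x| <= M) -> l2 f ->
  l2 (fun x => (W x)%:C * f x) /\ l2norm (fun x => (W x)%:C * f x) <= M * l2norm f.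
Proof.
move=> WM fl; have M0 : 0 <= M by apply: le_trans (WM 0).
have eM : M = Normc.normc M%:C by rewrite normc_real ger0_norm.
rewrite [M in _ <= M * _]eM -l2norm_scal//; apply: l2_le => [x|]; last exact: l2_scal.
by rewrite !Normc.normcM !normc_real ler_wpM2r ?normc_ge0// (ger0_norm M0).
Qed.

Lemma conv_op_sym a p s W M : herm_kernel a p s -> (forall x, `|W x| <= M) ->
  sym_op (conv_op a p W).
Proof.
move=> hk WM; have a1 := hk_sum hk.
have l f : l2 f -> l2 (conv_op a p W f).
  by move=> fl; apply: l2_add; [exact: (conv_l2 p a1 fl).1|exact: (mulW_l2 WM fl).1].
have lin c f g : l2 f -> l2 g ->
    conv_op a p W (scal c f + g) = scal c (conv_op a p W f) + conv_op a p W g.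
  move=> fl gl; apply/funext => x; rewrite /conv_op (conv_lin p c a1 fl gl).
  change (c * convol a p f x + convol a p g x + (W x)%:C * (c * f x + g x) =
    c * (convol a p f x + (W x)%:C * f x) + (convol a p g x + (W x)%:C * g x)); ring.
split => //.
- exists (2 * nsum (fun y => Normc.normc (a y)) + M) => f fl.
  suff h : l2norm (conv_op a p W f) <= (2 * nsum (fun y => Normc.normc (a y)) + M) * l2norm f by [].
  have [l1 n1] := conv_l2 p a1 fl; have [l2' n2] := mulW_l2 WM fl.
  apply: le_trans (l2normD l1 l2') _; rewrite mulrDl; exact: lerD.
- move=> f g fl gl.
  have [l1 _] := conv_l2 p a1 fl; have [l2' _] := mulW_l2 WM fl.
  have [l1g _] := conv_l2 p a1 gl; have [l2g _] := mulW_l2 WM gl.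
  rewrite [LHS](ipDl l1 l2' gl) [RHS](ipDr fl l1g l2g) (conv_adj hk fl gl); congr (_ + _).
  congr rsum; apply/funext => x; rewrite /dotc.
  by case: (f x) (g x) => [? ?] [? ?] /=; ring.
Qed.

End ConvOp.

(** * Localization and the essential spectrum of lattice operators *)

Section Product.
Context {R : realType} {T X : choiceType}.

Lemma l2_slices (F : T * X -> R[i]) : (forall t, l2 (fun x => F (t, x))) ->
  (\esum_(z in [set: (T * X)%type]) (Normc.normc (F z) ^+ 2)%:E =
   \esum_(t in [set: T]) (l2norm (fun x => F (t, x)) ^+ 2)%:E)%E.
Proof.
move=> Fl.
have -> : (fun z => (Normc.normc (F z) ^+ 2)%:E) =
    (fun z : T * X => ((fun t x => Normc.normc (F (t, x)) ^+ 2) z.1 z.2)%:E).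
  by apply/funext => -[].
rewrite -(esum_prod (g := fun t x => Normc.normc (F (t, x)) ^+ 2)); last first.
  by move=> *; rewrite sqr_ge0.
apply: eq_esum => t _; rewrite nsumE; last 2 first.
- by move=> x; rewrite sqr_ge0.
- exact: Fl.
congr EFin; rewrite l2norm2 /ip rsum_nonneg => [|x]; last exact: dotc_ge0.
by congr nsum; apply/funext => x; rewrite normc2.
Qed.

Lemma l2norm_nsum (Z : choiceType) (f : Z -> R[i]) :
  l2norm f ^+ 2 = nsum (fun x => Normc.normc (f x) ^+ 2).
Proof.
rewrite l2norm2 /ip rsum_nonneg => [|x]; last exact: dotc_ge0.
by congr nsum; apply/funext => x; rewrite normc2.
Qed.

Lemma l2_prod (F : T * X -> R[i]) : (forall t, l2 (fun x => F (t, x))) ->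
  nfin (fun t => l2norm (fun x => F (t, x)) ^+ 2) ->
  l2 F /\ l2norm F ^+ 2 = nsum (fun t => l2norm (fun x => F (t, x)) ^+ 2).
Proof.
move=> Fl Ff; have E := l2_slices Fl; split; first by rewrite /l2 E.
by rewrite l2norm_nsum /nsum E.
Qed.

Lemma l2_prod_nfin (F : T * X -> R[i]) : (forall t, l2 (fun x => F (t, x))) ->
  l2 F -> nfin (fun t => l2norm (fun x => F (t, x)) ^+ 2) /\
  l2norm F ^+ 2 = nsum (fun t => l2norm (fun x => F (t, x)) ^+ 2).
Proof.
move=> Fl Ff; have E := l2_slices Fl; split; first by rewrite /nfin -E.
by rewrite l2norm_nsum /nsum E.
Qed.

Definition tens (phi : T -> R[i]) (g : X -> R[i]) : T * X -> R[i] :=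
  fun z => phi z.1 * g z.2.

Lemma l2_tens phi g : l2 phi -> l2 g ->
  l2 (tens phi g) /\ l2norm (tens phi g) = l2norm phi * l2norm g.
Proof.
move=> pl gl.
have sl t : l2norm (fun x => tens phi g (t, x)) ^+ 2 = l2norm g ^+ 2 * Normc.normc (phi t) ^+ 2.
  by rewrite -[fun x => _]/(scal (phi t) g) l2norm_scal// exprMn mulrC.
have n0 t : 0 <= Normc.normc (phi t) ^+ 2 by rewrite sqr_ge0.
have [||l n] := @l2_prod (tens phi g).
- by move=> t; exact: (l2_scal (phi t) gl).
- rewrite (_ : (fun t => _) = (fun t => l2norm g ^+ 2 * Normc.normc (phi t) ^+ 2)); last exact/funext.
  by apply: nfinZ => //; exact: sqr_ge0.
split => //; apply/eqP; rewrite -(@eqrXn2 _ 2) ?mulr_ge0 ?l2norm_ge0// n exprMn.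
rewrite (_ : (fun t => _) = (fun t => l2norm g ^+ 2 * Normc.normc (phi t) ^+ 2)); last exact/funext.
by rewrite nsumZ ?sqr_ge0// (l2norm_nsum phi) mulrC.
Qed.

End Product.

(** * Almost invariant functions on an abelian group *)

Section Folner.
Context {R : realType} {G : zmodType}.
Implicit Types (psi : G -> R).

Lemma nsum_transl psi y : nfin psi -> nfin (fun x => psi (x - y)) /\
  nsum (fun x => psi (x - y)) = nsum psi.
Proof. by rewrite /nfin /nsum -(nsum_reindex psi (bij_translate y)). Qed.

Lemma nsum_sum (n : nat) (g : nat -> G -> R) : (forall j x, 0 <= g j x) ->
  (forall j, nfin (g j)) ->
  nfin (fun x => \sum_(j < n) g j x) /\
  nsum (fun x => \sum_(j < n) g j x) = \sum_(j < n) nsum (g j).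
Proof.
move=> g0 gf; elim: n => [|n [IH1 IH2]].
  rewrite big_ord0 (_ : (fun x => _) = (fun=> 0)); last by apply/funext => x; rewrite big_ord0.
  by split; [rewrite /nfin esum1|rewrite /nsum esum1].
rewrite (_ : (fun x => _) = (fun x => (\sum_(j < n) g j x) + g n x)); last first.
  by apply/funext => x; rewrite big_ord_recr.
have s0 x : 0 <= \sum_(j < n) g j x by exact: sumr_ge0.
by split; [exact: nfinD|rewrite nsumD// IH2 big_ord_recr].
Qed.

(* Averaging psi over its translates by j y, j < n, makes it almost invariant under y and keeps
   its invariance under the other translations. *)
Lemma reiter (F : seq G) (eta : R) : 0 < eta -> exists psi (s : seq G),
  [/\ forall x, 0 <= psi x, forall x, x \notin s -> psi x = 0, nfin psi, nsum psi = 1 &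
      forall y, y \in F -> nfin (fun x => `|psi (x - y) - psi x|) /\
        nsum (fun x => `|psi (x - y) - psi x|) <= eta].
Proof.
move=> eta0; elim: F => [|y F [psi [s [p0 ps pf p1 pF]]]].
  have [|f1 f2] := @nsum_finsupp _ _ (fun x : G => (x == 0)%:R : R) [:: 0] (fun x => ler0n _ _) isT.
    by move=> x; rewrite inE => /negbTE ->.
  exists (fun x => (x == 0)%:R), [:: 0]; split => //.
    by move=> x; rewrite inE => /negbTE ->.
  by rewrite f2 big_seq1 eqxx.
(* With [L] translates, the difference under [y] telescopes to two terms of total mass at most 2,
   whence the requirement [2 / L <= eta]. *)
have [n hn] := archimed_small (divr_gt0 eta0 (ltr0Sn R 1)).
pose L := n.+1.
have L0 : 0 < (L%:R : R)^-1 by rewrite invr_gt0 ltr0Sn.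
pose g j x := psi (x - y *+ j).
have g0 j x : 0 <= g j x by exact: p0.
have gf j : nfin (g j) by exact: (nsum_transl (y *+ j) pf).1.
have g1 j : nsum (g j) = 1 by rewrite -p1 /g (nsum_transl (y *+ j) pf).2.
have [Sf Sn] := nsum_sum L g0 gf.
have S0 x : 0 <= \sum_(j < L) g j x by exact: sumr_ge0.
exists (fun x => L%:R^-1 * \sum_(j < L) g j x).
exists [seq x + y *+ j | x <- s, j <- iota 0 L].
split.
- by move=> x; rewrite mulr_ge0// ltW.
- move=> x xs; rewrite big1 ?mulr0// => j _; apply: ps.
  apply: contra xs => xs; apply/allpairsP; exists (x - y *+ j, val j); split.
  - exact: xs.
  - by rewrite mem_iota add0n; exact: ltn_ord.
  - by rewrite /= subrK.
- by apply: nfinZ => //; exact: ltW.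
- rewrite nsumZ ?(ltW L0)// Sn (eq_bigr (fun=> 1)) => [|j _]; last exact: g1.
  by rewrite sumr_const card_ord mulVf// pnatr_eq0.
have abs_scale z : (fun x => `|L%:R^-1 * \sum_(j < L) g j (x - z) - L%:R^-1 * \sum_(j < L) g j x|)
    = (fun x => L%:R^-1 * `|\sum_(j < L) g j (x - z) - \sum_(j < L) g j x|).
  by apply/funext => x; rewrite -mulrBr normrM gtr0_norm.
move=> z; rewrite in_cons => /orP[/eqP ->|zF].
- rewrite abs_scale.
  have tel x : \sum_(j < L) g j (x - y) - \sum_(j < L) g j x = g L x - g 0%N x.
    rewrite -sumrB (eq_bigr (fun j : 'I_L => g j.+1 x - g j x)) => [|j _].
      by rewrite -(big_mkord xpredT (fun j => g j.+1 x - g j x)) telescope_sumr.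
    by rewrite /g mulrS opprD addrA.
  rewrite (_ : (fun x => _) = (fun x => L%:R^-1 * `|g L x - g 0%N x|)); last first.
    by apply/funext => x; rewrite tel.
  have df : nfin (fun x => g L x + g 0%N x) by exact: nfinD.
  have dle x : `|g L x - g 0%N x| <= g L x + g 0%N x.
    by apply: le_trans (ler_normB _ _) _; rewrite !ger0_norm.
  have df' : nfin (fun x => `|g L x - g 0%N x|) by apply: nfin_le df.
  split; first by apply: nfinZ => //; exact: ltW.
  rewrite nsumZ ?(ltW L0)//.
  have : nsum (fun x => `|g L x - g 0%N x|) <= 2.
    by apply: le_trans (nsum_le _ dle df) _ => //; rewrite nsumD// !g1.
  move=> h; apply: (@le_trans _ _ (L%:R^-1 * 2)); first by rewrite ler_wpM2l// ltW.
  by rewrite -ler_pdivlMr.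
- rewrite abs_scale; have [zf zn] := pF z zF.
  pose h j x := `|psi (x - y *+ j - z) - psi (x - y *+ j)|.
  have hf j : nfin (h j) by exact: (nsum_transl (y *+ j) zf).1.
  have h1 j : nsum (h j) <= eta.
    by apply: le_trans zn; rewrite -(nsum_transl (y *+ j) zf).2.
  have h0 j x : 0 <= h j x by exact: normr_ge0.
  have [Hf Hn] := nsum_sum L h0 hf.
  have le1 x : `|\sum_(j < L) g j (x - z) - \sum_(j < L) g j x| <= \sum_(j < L) h j x.
    rewrite -sumrB; apply: le_trans (ler_norm_sum _ _ _) _.
    by apply: ler_sum => j _; rewrite /g /h addrAC.
  have df' : nfin (fun x => `|\sum_(j < L) g j (x - z) - \sum_(j < L) g j x|) by apply: nfin_le Hf.
  split; first by apply: nfinZ => //; exact: ltW.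
  rewrite nsumZ ?(ltW L0)// ler_pdivrMl ?ltr0Sn//.
  apply: le_trans (nsum_le _ le1 Hf) _ => //.
  rewrite Hn; apply: le_trans (ler_sum _ (fun (j : 'I_L) _ => h1 j)) _.
  by rewrite sumr_const card_ord mulr_natl.
Qed.

(** The square root of a probability density has l2 norm 1, and |sqrt b - sqrt c|^2 <= |b - c| turns
    almost invariance in l1 into almost invariance in l2. *)
Lemma folner (F : seq G) (eta : R) : 0 < eta -> exists (phi : G -> R[i]) (s : seq G),
  [/\ forall x, x \notin s -> phi x = 0, l2 phi, l2norm phi = 1 &
      forall y, y \in F -> l2norm ((fun x => phi (x - y)) - phi) ^+ 2 <= eta].
Proof.
move=> eta0; have [psi [s [p0 ps pf p1 pF]]] := reiter F eta0.
exists (fun x => (Num.sqrt (psi x))%:C), s.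
have n2 x : Normc.normc (Num.sqrt (psi x))%:C ^+ 2 = psi x.
  by rewrite normc_real real_normK ?num_real// sqr_sqrtr.
split.
- by move=> x /ps ->; rewrite sqrtr0.
- by rewrite /l2 (_ : (fun x => _) = (fun x => (psi x)%:E)) //; apply/funext => x; rewrite n2.
- apply/eqP; rewrite -(@eqrXn2 _ 2) ?l2norm_ge0// l2norm_nsum expr1n -p1; apply/eqP.
  by congr nsum; apply/funext.
move=> y /pF[yf yn]; rewrite l2norm_nsum; apply: le_trans yn; apply: nsum_le => //.
- by move=> x; rewrite sqr_ge0.
move=> x.
change (Normc.normc ((Num.sqrt (psi (x - y)))%:C - (Num.sqrt (psi x))%:C) ^+ 2 <= `|psi (x - y) - psi x|).
rewrite -rmorphB normc_real real_normK ?num_real//.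
move: (p0 (x - y)) (p0 x); move: (psi (x - y)) (psi x) => b c b0 c0.
have := sqr_sqrtr b0; have := sqr_sqrtr c0; have := sqrtr_ge0 b; have := sqrtr_ge0 c.
move: (Num.sqrt b) (Num.sqrt c) => sb sc sc0 sb0 <- <-.
rewrite subr_sqr normrM [X in _ * X]ger0_norm ?addr_ge0//.
rewrite -real_normK ?num_real// expr2 ler_wpM2l//.
by apply: le_trans (ler_normB _ _) _; rewrite !ger0_norm.
Qed.

End Folner.

(* Commutators of convolutions with multiplication by phi only involve the differences
   phi (x - q y) - phi x. *)
Lemma folner_young {R : realType} {Y : choiceType} {T : zmodType} (a : Y -> R[i]) (q : Y -> T)
    (e : R) : csummable a -> 0 < e -> exists (phi : T -> R[i]) (sp : seq T),
  [/\ forall x, x \notin sp -> phi x = 0, l2 phi, l2norm phi = 1 &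
      forall (X : choiceType) (u : X -> Y -> R[i]) (m : R), 0 <= m ->
        (forall y, l2 (u ^~ y) /\
           l2norm (u ^~ y) = l2norm ((fun x => phi (x - q y)) - phi) * m) ->
        l2 (fun x => csum (fun y => a y * u x y)) /\
        l2norm (fun x => csum (fun y => a y * u x y)) <= e * m].
Proof.
move=> a1 e0.
pose N := nsum (fun y => Normc.normc (a y)).
have N0 : 0 <= N by apply: nsum_ge0 => y; exact: normc_ge0.
have e20 : 0 < e ^+ 2 by rewrite exprn_gt0.
(* [young] multiplies the weighted sum by [2 * N], so that sum has to stay below [b]. One half of
   [b] is left to the hops in [F], through [eta]; the other half to the tail, of mass [b / 8] and
   weight at most (1 + 1)^2 = 4. *)
pose b := e ^+ 2 / (2 * (N + 1)).
have b0 : 0 < b by rewrite divr_gt0// mulr_gt0// ltr_wpDl.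
have d0 : 0 < b / 8 by rewrite divr_gt0.
pose eta := b / (2 * (N + 1)).
have eta0 : 0 < eta by rewrite divr_gt0// mulr_gt0// ltr_wpDl.
have [F uF FP] := nsum_weight_small a1 d0.
have [phi [sp [ps pl p1 pF]]] := folner [seq q y | y <- F] eta0.
exists phi, sp; split => // X u m m0 ulk.
pose k y := l2norm ((fun x => phi (x - q y)) - phi) ^+ 2.
have k4 y : 0 <= k y <= 4.
  rewrite /k sqr_ge0/=.
  have := l2normB (l2_transl (q y) pl) pl; rewrite (l2norm_transl phi (q y)) p1 => h.
  have -> : 4 = (1 + 1) ^+ 2 :> R by ring.
  by rewrite ler_pXn2r ?nnegrE ?l2norm_ge0//.
have [|y|y|Cl Cn] := @young _ _ _ a u (fun y => k y * m ^+ 2) (4 * m ^+ 2) a1.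
- by move=> y; exact: (ulk y).1.
- by rewrite (ulk y).2 exprMn.
- by have /andP[_ h] := k4 y; rewrite ler_wpM2r ?sqr_ge0.
split => //.
have em0 : 0 <= e * m by rewrite mulr_ge0// ltW.
rewrite -(@ler_pXn2r _ 2) ?nnegrE ?l2norm_ge0//.
apply: le_trans Cn _; rewrite -/N exprMn.
have -> : nsum (fun y => Normc.normc (a y) * (k y * m ^+ 2)) =
    m ^+ 2 * nsum (fun y => Normc.normc (a y) * k y).
  rewrite -nsumZ ?sqr_ge0//.
  - by congr nsum; apply/funext => y; ring.
  - by move=> y; have /andP[h _] := k4 y; rewrite mulr_ge0 ?normc_ge0.
  - have : nfin (fun y => 4 * Normc.normc (a y)) by apply: nfinZ => // y; exact: normc_ge0.
    by apply: nfin_le => y; have /andP[_ h] := k4 y; rewrite mulrC ler_wpM2r ?normc_ge0.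
have := FP k 4 eta (ler0n _ _) k4 (ltW eta0) (fun y yF => pF _ (map_f q yF)).
rewrite -/N => h.
have h2 : eta * N <= b / 2.
  rewrite /eta mulrAC ler_pdivrMr; last by rewrite mulr_gt0// ltr_wpDl.
  have := mulr_ge0 (ltW b0) N0; have := b0; lra.
have h3 : nsum (fun y => Normc.normc (a y) * k y) <= b by lra.
rewrite mulrA mulrAC ler_wpM2r ?sqr_ge0//.
apply: (@le_trans _ _ (2 * (N + 1) * b)).
  apply: ler_pM => //; [by rewrite mulr_ge0| |by lra].
  by apply: nsum_ge0 => y; have /andP[h4 _] := k4 y; rewrite mulr_ge0 ?normc_ge0.
by rewrite /b mulrC divfK// gt_eqF// mulr_gt0// ltr_wpDl.
Qed.

Lemma bdd_below_dense {R : realType} {X : choiceType} (A : (X -> R[i]) -> X -> R[i]) lam (c : R) :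
  sym_op A -> 0 <= c ->
  (forall (s : seq X) f, (forall x, x \notin s -> f x = 0) -> l2 f ->
     c * l2norm f <= l2norm (A f - scal lam%:C f)) -> bdd_below A lam c.
Proof.
move=> sA c0 H f fl; have sT := sym_shift lam sA.
have [M _ [M0 TM]] := ap_bound sT 0.
apply/ler_addgt0Pr => e e0.
have d0 : 0 < e / (c + M) by rewrite divr_gt0// ltr_wpDl.
have [s us tl] := l2_tail fl d0.
have [gl _] := l2_rest (mem s) fl; have [hl _] := l2_rest (fun x => x \notin s) fl.
have fE := rest_split (mem s) f.
set g := rest (mem s) f in gl fE; set h := rest _ f in hl tl fE.
have := H s g _ gl; rewrite -/(opshift A lam%:C g) -/(opshift A lam%:C f) => h1.
have {}h1 : c * l2norm g <= l2norm (opshift A lam%:C g).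
  by apply: h1 => x xs; rewrite /g /rest /= (negbTE xs).
have h2 : l2norm f <= l2norm g + l2norm h by rewrite {1}fE; exact: l2normD.
have h3 : l2norm (opshift A lam%:C g) <= l2norm (opshift A lam%:C f) + M * l2norm h.
  have -> : opshift A lam%:C g = opshift A lam%:C f - opshift A lam%:C h.
    by rewrite -(ap_sub sT fl hl); congr (opshift _ _ _); rewrite fE addrK.
  apply: le_trans (l2normB (ap_l2 sT fl) (ap_l2 sT hl)) _.
  by rewrite lerD2l; exact: (TM _ hl).1.
have h4 := ler_wpM2l c0 h2.
have h5 : (c + M) * l2norm h <= e by rewrite mulrC -ler_pdivlMr// ltr_wpDl.
lra.
Qed.

(** * Comparison of an operator with its limits at infinity *)

Section HVZ.
Context {R : realType} {Y : choiceType} {G V : zmodType} {I : finType}.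
Variables (a : Y -> R[i]) (p : Y -> G) (s : Y -> Y) (hk : herm_kernel a p s).
Variables (pi : I -> G -> V) (w : I -> V -> R).
Hypothesis piB : forall al x y, pi al (x - y) = pi al x - pi al y.
Hypothesis w0 : forall al (e : R), 0 < e -> exists B : seq V, forall v, v \notin B -> `|w al v| <= e.

Definition pot (J : {set I}) (x : G) : R := \sum_(al in J) w al (pi al x).

Notation opJ J := (conv_op a p (pot J)).

Let pi0 al : pi al 0 = 0.
Proof. by have := piB al 0 0; rewrite !subrr. Qed.

Let piN al x : pi al (- x) = - pi al x.
Proof. by have := piB al 0 x; rewrite pi0 !sub0r. Qed.

Let piD al x y : pi al (x + y) = pi al x + pi al y.
Proof. by have := piB al x (- y); rewrite piN !opprK. Qed.

Let piM al x n : pi al (x *+ n) = pi al x *+ n.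
Proof. by elim: n => [|n IH]; rewrite ?mulr0n ?pi0// !mulrS piD IH. Qed.

Lemma pot_bounded J : exists M, forall x, `|pot J x| <= M.
Proof.
have wb al : exists M, forall v, `|w al v| <= M.
  have [B BP] := w0 al ltr01; exists (1 + \sum_(v <- B) `|w al v|) => v.
  have [vB|vB] := boolP (v \in B); last first.
    by apply: le_trans (BP v vB) _; rewrite lerDl sumr_ge0.
  rewrite (big_rem v)//= addrCA lerDl addr_ge0// sumr_ge0//.
have [M MP] := choice wb; exists (\sum_(al in J) M al) => x.
by apply: le_trans (ler_norm_sum _ _ _) _; exact: ler_sum.
Qed.

Lemma opJ_sym J : sym_op (opJ J).
Proof. by have [M MP] := pot_bounded J; exact: (conv_op_sym hk MP). Qed.

Lemma weights_small (e : R) : 0 < e ->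
  exists B : I -> seq V, forall al v, v \notin B al -> `|w al v| <= e / (#|I|.+1)%:R.
Proof.
move=> e0; have h al := w0 al (divr_gt0 e0 (ltr0Sn R #|I|)).
by have [B BP] := choice h; exists B.
Qed.

Lemma pot_far (J J0 : {set I}) (e : R) (B : I -> seq V) x : 0 <= e -> J \subset J0 ->
  (forall al v, v \notin B al -> `|w al v| <= e / (#|I|.+1)%:R) ->
  (forall al, al \in J0 -> al \notin J -> pi al x \notin B al) ->
  `|pot J0 x - pot J x| <= e.
Proof.
move=> e0 JJ BP xB.
have -> : pot J0 x - pot J x = \sum_(al in J0 :\: J) w al (pi al x).
  by rewrite /pot (big_setID J)/= (finset.setIidPr JJ) addrAC subrr add0r.
apply: le_trans (ler_norm_sum _ _ _) _.
apply: le_trans (_ : \sum_(al in J0 :\: J) e / (#|I|.+1)%:R <= e).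
  by apply: ler_sum => al; rewrite finset.in_setD => /andP[aJ aJ0]; apply: BP; exact: xB.
rewrite sumr_const -(mulr_natr (e / _)) -mulrA -[leRHS]mulr1; apply: ler_wpM2l => //.
rewrite mulrC ler_pdivrMr ?ltr0Sn// mul1r ler_nat; apply: leqW; exact: max_card.
Qed.

Lemma opJ_diff J J0 f : conv_op a p (pot J0) f - conv_op a p (pot J) f =
  (fun x => (pot J0 x - pot J x)%:C * f x).
Proof.
apply/funext => x.
change ((convol a p f x + (pot J0 x)%:C * f x) - (convol a p f x + (pot J x)%:C * f x) =
  (pot J0 x - pot J x)%:C * f x).
by rewrite rmorphB; ring.
Qed.

Lemma uniform_bdd_below (JJ : {set I} -> Prop) lam :
  (forall J, JJ J -> ~ real_spectrum (opJ J) lam) ->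
  exists2 c : R, 0 < c & forall J, JJ J -> bdd_below (opJ J) lam c.
Proof.
move=> H.
have HJ J : exists c : R, 0 < c /\ (JJ J -> bdd_below (opJ J) lam c).
  by have [/H/not_real_spectrum[c c0 b]|n] := pselect (JJ J); [exists c|exists 1].
have [c cP] := choice HJ.
(* [(1 + S)^-1] lies below each of the finitely many [c J]. *)
pose S := \sum_(J : {set I}) (c J)^-1.
have S0 : 0 <= S by apply: sumr_ge0 => J _; rewrite invr_ge0 ltW// (cP J).1.
exists (1 + S)^-1; first by rewrite invr_gt0 ltr_pwDl.
move=> J JP; apply: bdd_below_le ((cP J).2 JP).
have cJ := (cP J).1; rewrite -[leRHS]invrK lef_pV2 ?posrE ?invr_gt0 ?ltr_pwDl//.
rewrite /S (bigD1 J)//= addrCA lerDl addr_ge0//.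
by apply: sumr_ge0 => K _; rewrite invr_ge0 ltW// (cP K).1.
Qed.

Lemma bij_shear : bijective (fun z : G * G => (z.2 - z.1, z.2)).
Proof. by exists (fun z : G * G => (z.2 - z.1, z.2)) => -[t x] /=; rewrite opprB addrC subrK. Qed.

(** With [z = (t, x)], this collects the cut-offs of [g] by all translates of [phi]. Their squares
    add up to the square of [l2norm phi] at every [x]: a quadratic partition of unity. *)
Lemma l2_shear (phi g : G -> R[i]) : l2 phi -> l2 g ->
  l2 (fun z : G * G => phi (z.2 - z.1) * g z.2) /\
  l2norm (fun z : G * G => phi (z.2 - z.1) * g z.2) = l2norm phi * l2norm g.
Proof.
move=> pl gl; have [l n] := l2_tens pl gl; split.
  exact: ((l2_relabel bij_shear (tens phi g)).1 l).
by rewrite -n -(l2norm_relabel bij_shear (tens phi g)).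
Qed.

(** At [(t, x)]: the commutator of the convolution with multiplication by the translate of [phi] by
    [t], applied to [f] and evaluated at [x]. *)
Definition commutator (phi f : G -> R[i]) (z : G * G) : R[i] :=
  csum (fun y => a y * ((phi (z.2 - p y - z.1) - phi (z.2 - z.1)) * f (z.2 - p y))).

Lemma commutator_bound (e : R) : 0 < e -> exists (phi : G -> R[i]) (sp : seq G),
  [/\ forall x, x \notin sp -> phi x = 0, l2 phi, l2norm phi = 1 &
      forall f, l2 f -> l2 (commutator phi f) /\ l2norm (commutator phi f) <= e * l2norm f].
Proof.
move=> e0; have [phi [sp [ps pl p1 H]]] := folner_young p (hk_sum hk) e0.
exists phi, sp; split => // f fl.
apply: (H _ (fun (z : G * G) y => (phi (z.2 - p y - z.1) - phi (z.2 - z.1)) * f (z.2 - p y)));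
  first exact: l2norm_ge0.
move=> y; pose chi : G -> R[i] := (fun x => phi x - phi (x - - p y)).
have e1 : (fun z : G * G => (phi (z.2 - p y - z.1) - phi (z.2 - z.1)) * f (z.2 - p y)) =
    (fun z : G * G => chi (z.2 - z.1) * f z.2) \o (fun z : G * G => (z.1, z.2 - p y)).
  apply/funext => -[t x]; rewrite /chi /=; congr ((_ - phi _) * _).
  by rewrite opprK addrAC subrK.
have bj : bijective (fun z : G * G => (z.1, z.2 - p y)).
  by exists (fun z : G * G => (z.1, z.2 + p y)) => -[t x] /=; rewrite ?subrK ?addrK.
have chil : l2 chi by apply: l2_sub => //; exact: l2_transl.
have [l n] := l2_shear chil fl.
split; first by rewrite e1; exact: ((l2_relabel bj _).1 l).
rewrite e1 (l2norm_relabel bj) n; congr (_ * _).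
rewrite -(l2norm_transl chi (p y)); congr l2norm; apply/funext => x.
by rewrite /chi opprK subrK.
Qed.

Lemma hvz_incl (JJ : {set I} -> Prop) (J0 : {set I}) lam :
  (forall J, JJ J -> J \subset J0) ->
  (forall B : I -> seq V, exists S : seq G, forall t, t \notin S -> exists2 J, JJ J &
     forall al, al \in J0 -> al \notin J -> pi al t \notin B al) ->
  (forall J, JJ J -> ~ real_spectrum (opJ J) lam) -> bdd_below_off (opJ J0) lam.
Proof.
move=> JJ0 far /uniform_bdd_below[c c0 cP].
have a1 := hk_sum hk; have sA := opJ_sym J0; have sT := sym_shift lam sA.
set T := opshift (opJ J0) lam%:C in sT.
have c20 : 0 < c / 2 by rewrite divr_gt0.
have c40 : 0 < c / 4 by rewrite divr_gt0.
have [phi [sp [ps pl p1 pC]]] := commutator_bound c40.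
have [B BP] := weights_small c20.
(* The finite sets are enlarged by the support of [phi], so that for [t] outside [S] all points of
   the cut-off around [t] are far, not only [t] itself. *)
have [S SP] := far (fun al => [seq v - pi al b | v <- B al, b <- sp]).
(* Vanishing on [S + sp] kills the cut-offs around points of [S]. Of the bound [c], one half is lost
   to the change of potential and one quarter to the commutators. *)
exists [seq t + b | t <- S, b <- sp], (c / 4); split => // f fl fS.
rewrite -/(T f).
pose g t : G -> R[i] := fun x => phi (x - t) * f x.
have [shl shn] := l2_shear pl fl.
have gl t : l2 (g t).
  have [|h1 h2] := @l2_le _ _ (g t) (scal (l2norm phi)%:C f) _ (l2_scal _ fl) => // x.
  rewrite /g /scal !Normc.normcM normc_real ger0_norm ?l2norm_ge0//.
  by rewrite ler_wpM2r ?normc_ge0//; exact: l2norm_pt.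
have lower t : (c / 2) * l2norm (g t) <= l2norm (T (g t)).
  have [tS|tS] := boolP (t \in S).
    have -> : g t = 0.
      apply/funext => x; rewrite /g; have [xs|xs] := boolP (x - t \in sp).
        rewrite fS ?mulr0//; apply/allpairsP; exists (t, x - t); split => //=.
        by rewrite addrC subrK.
      by rewrite ps// mul0r.
    by rewrite l2norm0 mulr0 l2norm_ge0.
  have [J JP Jfar] := SP t tS.
  have h1 := cP J JP (g t) (gl t).
  have -> : T (g t) = (opJ J (g t) - scal lam%:C (g t)) + (opJ J0 (g t) - opJ J (g t)).
    by rewrite /T /opshift [in RHS]addrC addrA subrK.
  have sJ := opJ_sym J; have l1 := ap_l2 (sym_shift lam sJ) (gl t).
  have l2' : l2 (opJ J0 (g t) - opJ J (g t)).
    by apply: l2_sub; [exact: (ap_l2 sA)|exact: (ap_l2 sJ)].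
  have h2 : l2norm (opJ J0 (g t) - opJ J (g t)) <= (c / 2) * l2norm (g t).
    rewrite opJ_diff.
    have -> : c / 2 * l2norm (g t) = l2norm (scal (c / 2)%:C (g t)).
      by rewrite l2norm_scal// normc_real gtr0_norm.
    apply: (l2_le _ (l2_scal _ (gl t))).2 => x.
    have [xs|xs] := boolP (x - t \in sp); last by rewrite /scal /g ps// mul0r !mulr0.
    apply: normc_real_mul_le.
    apply: (pot_far (ltW c20) (JJ0 J JP) BP) => al aJ0 aJ.
    apply: contra (Jfar al aJ0 aJ) => xB; apply/allpairsP; exists (pi al x, x - t); split => //=.
    by rewrite -piB opprB addrC subrK.
  have := l2norm_lbD l1 l2'; lra.
pose P : G * G -> R[i] := fun z => phi (z.2 - z.1) * T f z.2.
have Tl := ap_l2 sT fl.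
have [Pl Pn] := l2_shear pl Tl; rewrite -/P in Pl Pn.
have [Cl Cn] := pC f fl.
pose Psi : G * G -> R[i] := fun z => T (g z.1) z.2.
have PsiE : Psi = P + commutator phi f.
  apply/funext => -[t x].
  change (convol a p (g t) x + (pot J0 x)%:C * (phi (x - t) * f x) - lam%:C * (phi (x - t) * f x) =
    phi (x - t) * (convol a p f x + (pot J0 x)%:C * f x - lam%:C * f x) + commutator phi f (t, x)).
  have sm := conv_summable p x a1 fl; have smg := conv_summable p x a1 (gl t).
  have -> : commutator phi f (t, x) = convol a p (g t) x - phi (x - t) * convol a p f x.
    have -> : commutator phi f (t, x) =
        csum (fun y => a y * g t (x - p y) + (- phi (x - t)) * (a y * f (x - p y))).
      by congr csum; apply/funext => y; rewrite /g /=; ring.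
    by rewrite (csumD smg (csummableZ _ sm)) (csumZ _ sm) mulNr.
  ring.
have Psil : l2 Psi by rewrite PsiE; exact: l2_add.
have Psin : l2norm Psi <= l2norm (T f) + c / 4 * l2norm f.
  rewrite PsiE; apply: le_trans (l2normD Pl Cl) _.
  by rewrite Pn p1 mul1r lerD2l.
have [Pf PE] := @l2_prod_nfin _ _ _ Psi (fun t => ap_l2 sT (gl t)) Psil.
have [Sf SE] := @l2_prod_nfin _ _ _ (fun z : G * G => phi (z.2 - z.1) * f z.2) gl shl.
have key : (c / 2) * l2norm f <= l2norm Psi.
  have cf0 : 0 <= c / 2 * l2norm f by apply: mulr_ge0; [exact: ltW|exact: l2norm_ge0].
  rewrite -(@ler_pXn2r _ 2) ?nnegrE ?l2norm_ge0//.
  rewrite exprMn PE.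
  have -> : l2norm f ^+ 2 = nsum (fun t => l2norm (g t) ^+ 2) by rewrite -SE shn p1 mul1r.
  rewrite -nsumZ ?sqr_ge0//; last by move=> t; exact: sqr_ge0.
  apply: nsum_le => // [t|t]; first by rewrite mulr_ge0 ?sqr_ge0.
  rewrite -exprMn; apply: lerXn2r; rewrite ?nnegrE ?l2norm_ge0//.
  by apply: mulr_ge0; [exact: ltW|exact: l2norm_ge0].
lra.
Qed.

Definition torsion_free (H : zmodType) := forall (x : H) n, x *+ n.+1 = 0 -> x = 0.

Lemma multiples_leave (H : zmodType) (x : H) (L : seq H) : torsion_free H -> x != 0 ->
  exists N, forall n, (N <= n)%N -> x *+ n \notin L.
Proof.
move=> tf x0; elim: L => [|l L [N NP]]; first by exists 0%N.
have [[n0 en0]|no] := pselect (exists n, x *+ n = l); last first.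
  exists N => n /NP h; rewrite in_cons negb_or h andbT; apply/eqP => e; apply: no; by exists n.
exists (maxn N n0.+1) => n; rewrite geq_max => /andP[/NP h nn0].
rewrite in_cons negb_or h andbT; apply/eqP => e; move/eqP: x0; apply.
apply: (tf x (n - n0.+1)%N); apply: (@addrI _ (x *+ n0)).
by rewrite -mulrnDr addnS -addSn subnKC// addr0 e.
Qed.

(** Test functions of finite support suffice, and for them leaving [S] and the reach of the weights
    outside [J] amounts to finitely many conditions. Torsion-freeness lets one large multiple of
    [x0] meet them all, and translation along [x0] preserves the potential of [J]. *)
Lemma hvz_conv (J0 : {set I}) (x0 : G) lam : torsion_free G -> torsion_free V -> x0 != 0 ->
  bdd_below_off (opJ J0) lam -> ~ real_spectrum (opJ [set al in J0 | pi al x0 == 0]%SET) lam.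
Proof.
move=> tG tV x00 [S [c [c0 H]]]; set J := [set al in J0 | _]%SET.
have sA := opJ_sym J0; have sJ := opJ_sym J.
have c20 : 0 < c / 2 by rewrite divr_gt0.
suff b : bdd_below (opJ J) lam (c / 2) by move=> /(_ _ c20).
apply: bdd_below_dense => // [|F f Ff fl]; first exact: ltW.
have [B BP] := weights_small c20.
have [N0 N0P] := multiples_leave [seq y - x | y <- S, x <- F] tG x00.
have [NI NIP] : exists NI : I -> nat, forall al, al \in J0 -> al \notin J -> forall n,
    (NI al <= n)%N -> pi al x0 *+ n \notin [seq v - pi al x | v <- B al, x <- F].
  suff : forall al, exists N, al \in J0 -> al \notin J -> forall n, (N <= n)%N ->
      pi al x0 *+ n \notin [seq v - pi al x | v <- B al, x <- F].
    by move=> /choice[NI NIP]; exists NI.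
  move=> al; have [e|ne] := eqVneq (pi al x0) 0.
    by exists 0%N => aJ0; rewrite inE aJ0 e eqxx.
  by have [N NP] := multiples_leave [seq v - pi al x | v <- B al, x <- F] tV ne; exists N.
pose n := maxn N0 (\max_al NI al).
have nI al : (NI al <= n)%N by rewrite leq_max leq_bigmax orbT.
have nN0 : (N0 <= n)%N by rewrite leq_max leqnn.
pose z := x0 *+ n.
pose g : G -> R[i] := fun x => f (x - z).
have gl : l2 g by exact: l2_transl.
have gn : l2norm g = l2norm f by exact: l2norm_transl.
have potinv x : pot J (x - z) = pot J x.
  apply: eq_bigr => al; rewrite inE => /andP[_ /eqP e].
  by rewrite piB piM e mul0rn subr0.
have comm : opJ J g - scal lam%:C g = fun x => (opJ J f - scal lam%:C f) (x - z).
  apply/funext => x.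
  change (convol a p g x + (pot J x)%:C * f (x - z) - lam%:C * f (x - z) =
    convol a p f (x - z) + (pot J (x - z))%:C * f (x - z) - lam%:C * f (x - z)).
  rewrite potinv; congr (_ + _ - _); congr csum; apply/funext => y.
  by rewrite /g addrAC.
have fin (x : G) : g x != 0 -> x - z \in F.
  by move=> gx; apply: contraNT gx => /Ff h; rewrite /g h.
have -> : l2norm (opJ J f - scal lam%:C f) = l2norm (opJ J g - scal lam%:C g).
  by rewrite comm; exact: esym (l2norm_transl (opJ J f - scal lam%:C f) z).
rewrite -gn.
have h1 : c * l2norm g <= l2norm (opJ J0 g - scal lam%:C g).
  apply: H => // x xS; apply/eqP; apply: contraT => /fin xF.
  have := N0P n nN0; rewrite -/z => /negP; case; apply/allpairsP; exists (x, x - z); split => //=.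
  by rewrite opprB addrC subrK.
have h2 : l2norm (opJ J0 g - opJ J g) <= (c / 2) * l2norm g.
  rewrite opJ_diff.
  have -> : c / 2 * l2norm g = l2norm (scal (c / 2)%:C g).
    by rewrite l2norm_scal// normc_real gtr0_norm.
  apply: (l2_le _ (l2_scal _ gl)).2 => x.
  have [gx|/fin xF] := eqVneq (g x) 0; first by rewrite /scal gx !mulr0.
  apply: normc_real_mul_le.
  apply: (pot_far (ltW c20) _ BP) => [|al aJ0 aJ].
    by apply/fintype.subsetP => al; rewrite inE => /andP[].
  apply: contra (NIP al aJ0 aJ n (nI al)) => xB.
  apply/allpairsP; exists (pi al x, x - z); split => //=.
  by rewrite -piM -piB opprB addrC subrK.
have l1 := ap_l2 (sym_shift lam sJ) gl.
have l2' : l2 (opJ J0 g - opJ J g) by apply: l2_sub; [exact: (ap_l2 sA)|exact: (ap_l2 sJ)].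
have := l2normD l1 l2'.
rewrite /opshift [X in l2norm X](_ : _ = opJ J0 g - scal lam%:C g); last by rewrite addrC addrA subrK.
lra.
Qed.

(* Pigeonhole: if infinitely many t have pi al t in the finite set B al for the same al's, two of
   them agree under all these pi al, and their difference is the wanted direction. *)
Lemma direction_far (B : I -> seq V) : exists S : seq G, forall t, t \notin S ->
  exists2 x0 : G, x0 != 0 & forall al, pi al x0 != 0 -> pi al t \notin B al.
Proof.
(* Induction on [l], cutting [T] into the finitely many level sets of the first form. *)
have fin (l : seq I) (T : set G) : (forall t al, T t -> al \in l -> pi al t \in B al) ->
    (forall t t', T t -> T t' -> (forall al, al \in l -> pi al t = pi al t') -> t = t') ->
    finite_set T.
  elim: l T => [|al l IH] T TB Tinj.
    have [[t Tt]|no] := pselect (exists t, T t).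
      apply: (sub_finite_set (B := [set t])); last exact: finite_set1.
      by move=> t' Tt' /=; exact: Tinj.
    by apply: (sub_finite_set (B := set0)) => // t Tt; apply: no; exists t.
  apply: (sub_finite_set (B := \bigcup_(v in [set` B al]) [set t | T t /\ pi al t = v])).
    by move=> t Tt; exists (pi al t) => //=; apply: TB => //; exact: mem_head.
  apply: bigcup_finite; first exact: finite_seq.
  move=> v _; apply: IH => [t be [Tt _] bl|t t' [Tt e] [Tt' e'] h].
    by apply: TB => //; rewrite in_cons bl orbT.
  apply: Tinj => // be; rewrite in_cons => /orP[/eqP ->|/h//]; by rewrite e e'.
pose TK (K : {set I}) : set G := [set t | forall al, (al \in K) = (pi al t \in B al)].
pose good (K : {set I}) := exists2 x0 : G, x0 != 0 & forall al, al \in K -> pi al x0 = 0.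
(* [TK K] consists of the points near exactly the forms in [K]. If no nonzero vector is killed by
   all of these, they separate points and [TK K] is finite. *)
have SK (K : {set I}) : exists S : seq G, good K \/ forall t, TK K t -> t \in S.
  have [gK|nK] := pselect (good K); first by exists [::]; left.
  have /finite_seqP[S SE] : finite_set (TK K).
    apply: (fin (enum K)) => [t al Tt|t t' Tt Tt' h]; first by rewrite mem_enum Tt.
    apply: contrapT => tt'; apply: nK; exists (t - t').
      by rewrite subr_eq0; apply/eqP.
    by move=> al aK; rewrite piB h ?subrr// mem_enum.
  by exists S; right => t; rewrite SE.
have [S SP] := choice SK.
exists (flatten [seq S K | K <- enum {: {set I}}]) => t tS.
pose K := [set al | pi al t \in B al]%SET.
have [[x0 x00 KP]|inS] := SP K.
  exists x0 => // al; apply: contra => h; apply/eqP; apply: KP; by rewrite inE.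
exfalso; move/negP: tS; apply; apply/flattenP; exists (S K); first by rewrite map_f// mem_enum.
by apply: inS => al; rewrite inE.
Qed.

End HVZ.

(** * Fibres over the dual circle *)

Section Expi.
Context {R : realType}.
Implicit Types s t : R.

Lemma expi0 : expi 0 = 1 :> R[i].
Proof. by rewrite /expi cos0 sin0. Qed.

Lemma expiD s t : expi (s + t) = expi s * expi t.
Proof.
rewrite /expi cosD sinD; apply/eqP; rewrite eq_complex /=.
by apply/andP; split; apply/eqP; ring.
Qed.

Lemma conjcM (z w : R[i]) : ((z * w)^*)%C = z^*%C * w^*%C.
Proof. by case: z w => [x y] [x' y']; apply/eqP; rewrite eq_complex /=; apply/andP; split; apply/eqP; ring. Qed.

Lemma expi_conj t : (expi t)^* = expi (- t).
Proof. by rewrite /expi cosN sinN. Qed.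

Lemma normc_expi t : Normc.normc (expi t) = 1.
Proof. by rewrite /= cos2Dsin2 sqrtr1. Qed.

Lemma expi_natmul t n : expi (n%:R * t) = expi t ^+ n.
Proof.
elim: n => [|n IH]; first by rewrite mul0r expi0.
by rewrite -natr1 mulrDl mul1r expiD IH exprSr.
Qed.

Lemma expi_2pi_int (k : int) : expi (k%:~R * (2 * pi)) = 1 :> R[i].
Proof.
have h n : expi (n%:R * (2 * pi)) = 1 :> R[i].
  rewrite expi_natmul (_ : expi (2 * pi) = 1) ?expr1n// /expi.
  by rewrite mulr_natl cos2pi sin2pi.
case: k => n; first exact: h.
by rewrite NegzE mulrNz mulNr -expi_conj h conjc1.
Qed.

Lemma expi_eq1 t : `|t| < 2 * pi -> expi t = 1 -> t = 0.
Proof.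
move=> tpi; wlog t0 : t tpi / 0 <= t.
  move=> H; case: (leP 0 t) => t0; first exact: H.
  move=> e; apply/eqP; rewrite -oppr_eq0; apply/eqP; apply: H.
  - by rewrite normrN.
  - by rewrite oppr_ge0 ltW.
  - by rewrite -expi_conj e conjc1.
move=> e; have [//|tN] := eqVneq t 0; exfalso.
have t1 : 0 < t by rewrite lt_def tN.
have c1 : cos t = 1 by have := congr1 (@complex.Re R) e.
have h : 0 < sin (t / 2).
  apply: sin_gt0_pi; rewrite ?divr_gt0//.
  by rewrite ltr_pdivrMr// mulrC; rewrite ger0_norm in tpi.
have : cos t = 1 - 2 * sin (t / 2) ^+ 2.
  rewrite {1}[t](splitr t) cosD -!expr2; have := cos2Dsin2 (t / 2); lra.
by rewrite c1; have := exprn_gt0 2 h; lra.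
Qed.

Lemma root_sum (M : nat) (k : int) : (`|k| < M)%N -> k != 0 ->
  \sum_(q < M) expi (k%:~R * (2 * pi / M%:R) * q%:R) = 0 :> R[i].
Proof.
move=> kM k0.
have M0 : (0 < M)%N by case: M kM.
have MR : (M%:R : R) != 0 by rewrite pnatr_eq0 -lt0n.
set t := k%:~R * (2 * pi / M%:R).
under eq_bigr do rewrite mulrC expi_natmul.
have w1 : expi t - 1 != 0.
  rewrite subr_eq0; apply/eqP => /expi_eq1 h.
  have : t = 0.
    apply: h; rewrite /t normrM [X in _ * X]ger0_norm ?divr_ge0 ?mulr_ge0 ?pi_ge0//.
    rewrite mulrA ltr_pdivrMr ?ltr0n// mulrC ltr_pM2l ?mulr_gt0 ?pi_gt0//.
    by rewrite -intr_norm -[M%:R]/(M%:~R) ltr_int.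
  move/eqP; rewrite /t !mulf_eq0 invr_eq0 (negbTE MR) intr_eq0 (negbTE k0)/=.
  by rewrite pnatr_eq0/= gt_eqF ?pi_gt0.
apply: (mulfI w1); rewrite mulr0 -subrX1 -expi_natmul /t.
have -> : M%:R * (k%:~R * (2 * pi / M%:R)) = k%:~R * (2 * pi) :> R by field.
by rewrite expi_2pi_int subrr.
Qed.

Lemma expi_near1 (e : R) : 0 < e -> exists2 d : R, 0 < d &
  forall t, `|t| <= d -> Normc.normc (expi t - 1) <= e.
Proof.
move=> e0; have e20 : 0 < e / 2 by rewrite divr_gt0.
have := @continuous_cos R 0; rewrite /continuous_at cos0 => /cvgrPdist_le /(_ _ e20).
move=> /nbhs_ballP[d1 /= d10 H1].
have := @continuous_sin R 0; rewrite /continuous_at sin0 => /cvgrPdist_le /(_ _ e20).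
move=> /nbhs_ballP[d2 /= d20 H2].
exists (Num.min (d1 / 2) (d2 / 2)); first by rewrite lt_min !divr_gt0.
move=> t; rewrite le_min => /andP[td1 td2].
have h1 : `|1 - cos t| <= e / 2 by apply: H1; rewrite -ball_normE /= sub0r normrN; lra.
have h2 : `|0 - sin t| <= e / 2 by apply: H2; rewrite -ball_normE /= sub0r normrN; lra.
apply: (le_trans (normc_le_ReIm (expi t - 1))).
have -> : complex.Re (expi t - 1) = cos t - 1 by [].
have -> : complex.Im (expi t - 1) = sin t by rewrite /= subr0.
by rewrite distrC; rewrite sub0r normrN in h2; lra.
Qed.

Lemma expi_dist s t : Normc.normc (expi s - expi t) = Normc.normc (expi (s - t) - 1).
Proof.
have -> : expi s - expi t = (expi (s - t) - 1) * expi t.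
  by rewrite mulrBl mul1r -expiD subrK.
by rewrite Normc.normcM normc_expi mulr1.
Qed.

End Expi.

Lemma ip_suml {R : realType} {X : choiceType} (I : Type) (s : seq I) (F : I -> X -> R[i]) g :
  (forall i, l2 (F i)) -> l2 g -> ip (\sum_(i <- s) F i) g = \sum_(i <- s) ip (F i) g.
Proof.
move=> Fl gl; elim: s => [|i s IH].
  rewrite !big_nil; have := ip_real 0 (l2_0 (X := X)) gl; rewrite mul0r => <-.
  by rewrite scal0.
by rewrite !big_cons ipDl ?IH//; exact: l2_sum.
Qed.

Lemma scal_suml {R : realType} {X : choiceType} (I : Type) (s : seq I) (c : I -> R[i]) (f : X -> R[i]) :
  scal (\sum_(i <- s) c i) f = \sum_(i <- s) scal (c i) f.
Proof.
elim: s => [|i s IH]; last by rewrite !big_cons scalDl IH.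
by rewrite !big_nil; apply/funext => x; exact: mul0r.
Qed.

Definition grid {R : realType} (M : nat) (q : 'I_M) : R := 2 * pi / M%:R * q%:R.

(** Orthogonality of characters on the grid. Differences of indices in [J] stay below [M], so that
    distinct indices are not congruent modulo [M]. *)
Lemma parseval {R : realType} {X : choiceType} (M : nat) (J : seq int) (h : int -> X -> R[i]) :
  uniq J -> (forall j, l2 (h j)) ->
  (forall j j', j \in J -> j' \in J -> (`|j - j'| < M)%N) ->
  \sum_(q < M) l2norm (\sum_(j <- J) scal (expi (- (j%:~R * grid q))) (h j)) ^+ 2 =
  M%:R * \sum_(j <- J) l2norm (h j) ^+ 2.
Proof.
move=> uJ hl JM.
have sl c j : l2 (scal c (h j)) by exact: l2_scal.
have exp1 (q : 'I_M) : l2norm (\sum_(j <- J) scal (expi (- (j%:~R * grid q))) (h j)) ^+ 2 =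
    \sum_(j <- J) \sum_(j' <- J) ip (scal (expi ((j' - j)%:~R * (2 * pi / M%:R) * q%:R)) (h j)) (h j').
  rewrite l2norm2 ip_suml//; last by apply: l2_sum => j; exact: sl.
  apply: eq_bigr => j _; rewrite ipC ip_suml//; apply: eq_bigr => j' _.
  have e1 : (expi (- (j'%:~R * grid q)))^*%C * expi (- (j%:~R * grid q)) =
      expi ((j' - j)%:~R * (2 * pi / M%:R) * q%:R) :> R[i].
    by rewrite expi_conj -expiD; congr expi; rewrite /grid intrB; ring.
  by rewrite [LHS]ip_scall scalA e1 [LHS]ipC.
under eq_bigr do rewrite exp1.
rewrite exchange_big/= mulr_sumr; apply: eq_big_seq => j jJ.
rewrite exchange_big/= (bigD1_seq j)//= [X in _ + X]big1_seq ?addr0; last first.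
  move=> j' /andP[j'j j'J].
  transitivity (ip (\sum_(q < M) scal (expi ((j' - j)%:~R * (2 * pi / M%:R) * q%:R)) (h j)) (h j')).
    by rewrite ip_suml.
  rewrite -scal_suml root_sum.
  - have -> : scal 0 (h j) = 0 by apply/funext => x; exact: mul0r.
    have := ip_real 0 (l2_0 (X := X)) (hl j'); rewrite mul0r => <-.
    by rewrite scal0.
  - exact: JM.
  - by rewrite subr_eq0.
rewrite (eq_bigr (fun=> l2norm (h j) ^+ 2)) => [|q _].
  by rewrite sumr_const card_ord mulr_natl.
by rewrite subrr !mul0r expi0 scal1 l2norm2.
Qed.

(** * Operators invariant under translation in one integer coordinate *)

Section Fibres.
Context {R : realType} {Y : choiceType} {G : zmodType}.
Variables (a : Y -> R[i]) (p : Y -> int * G) (s : Y -> Y) (hk : herm_kernel a p s).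
Variables (W : G -> R) (M : R) (WM : forall x, `|W x| <= M).

Let a1 : csummable a := hk_sum hk.
Notation A := (conv_op a p (fun z => W z.2)).

(* The fibre at theta is the action on functions e^{i theta j} g(x) of (j, x). *)
Definition fibre_kernel (b : Y -> R[i]) (theta : R) (y : Y) : R[i] :=
  b y * expi (- ((p y).1%:~R * theta)).

Definition fibre (theta : R) := conv_op (fibre_kernel a theta) (fun y => (p y).2) W.

Lemma normc_fibre_kernel b theta y : Normc.normc (fibre_kernel b theta y) = Normc.normc (b y).
Proof. by rewrite Normc.normcM normc_expi mulr1. Qed.

Lemma csummable_fibre b theta : csummable b -> csummable (fibre_kernel b theta).
Proof. by apply: nfin_le => y; rewrite normc_fibre_kernel. Qed.

Lemma herm_fibre theta : herm_kernel (fibre_kernel a theta) (fun y => (p y).2) s.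
Proof.
case: hk => b1 sK sa sp; split => //; first exact: csummable_fibre.
- move=> y; rewrite /fibre_kernel sa sp conjcM expi_conj; congr (_ * expi _).
  by rewrite /= mulrNz mulNr.
- by move=> y; rewrite sp.
Qed.

Lemma fibre_sym theta : sym_op (fibre theta).
Proof. exact: (conv_op_sym (herm_fibre theta) WM). Qed.

Lemma total_sym : sym_op A.
Proof. by apply: (conv_op_sym hk (M := M)) => z. Qed.

(** The test function is phi(j) e^{i j theta} g(x) with [phi] almost invariant on the integers. The
    operator acts on it as the fibre does on [g], up to differences of [phi], which cost [c / 2]. *)
Lemma bdd_below_fibre lam (c : R) theta : 0 < c -> bdd_below A lam c -> bdd_below (fibre theta) lam (c / 2).
Proof.
move=> c0 H g gl.
have c20 : 0 < c / 2 by rewrite divr_gt0.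
have [phi [sp [ps pl p1 PH]]] := folner_young (fun y => (p y).1) a1 c20.
pose phe : int -> R[i] := fun j => phi j * expi (j%:~R * theta).
have normphe (ch : int -> R[i]) (t : int -> R) : l2 ch -> l2 (fun j => ch j * expi (t j)) /\
    l2norm (fun j => ch j * expi (t j)) = l2norm ch.
  move=> cl.
  have e j : Normc.normc (ch j * expi (t j)) = Normc.normc (ch j).
    by rewrite Normc.normcM normc_expi mulr1.
  have le1 j : Normc.normc (ch j * expi (t j)) <= Normc.normc (ch j) by rewrite e.
  have le2 j : Normc.normc (ch j) <= Normc.normc (ch j * expi (t j)) by rewrite e.
  have [l1 n1] := @l2_le _ _ (fun j => ch j * expi (t j)) ch (fun j => le1 j) cl.
  split => //; apply/eqP; rewrite eq_le n1/=.
  exact: (@l2_le _ _ ch _ (fun j => le2 j) l1).2.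
have [phel phen] := normphe phi (fun j => j%:~R * theta) pl.
have sF := sym_shift lam (fibre_sym theta).
have Tl := ap_l2 sF gl.
have [fl fn] := l2_tens phel gl; have [Pl Pn] := l2_tens phel Tl.
set f := tens _ g in fl fn; rewrite p1 in phen.
pose u (z : int * G) y := ((phi (z.1 - (p y).1) - phi z.1) *
  expi ((z.1 - (p y).1)%:~R * theta)) * g (z.2 - (p y).2).
have [|y|Cl Cn] := PH _ u (l2norm g); first exact: l2norm_ge0.
  pose chi : int -> R[i] := (fun j => phi (j - (p y).1)) - phi.
  have chil : l2 chi by apply: l2_sub => //; exact: l2_transl.
  have [cel cen] := normphe chi (fun j => (j - (p y).1)%:~R * theta) chil.
  have [l n] := l2_tens cel (l2_transl (p y).2 gl).
  by split; [exact: l|rewrite -[l2norm chi]cen -(l2norm_transl g (p y).2) -n].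
have := H f fl; rewrite fn phen mul1r.
have -> : A f - scal lam%:C f = tens phe (opshift (fibre theta) lam%:C g) +
    (fun z => csum (fun y => a y * u z y)).
  apply/funext => -[j x].
  change (convol a p f (j, x) + (W x)%:C * (phe j * g x) - lam%:C * (phe j * g x) =
    phe j * (convol (fibre_kernel a theta) (fun y => (p y).2) g x + (W x)%:C * g x - lam%:C * g x)
    + csum (fun y => a y * u (j, x) y)).
  have sm1 := conv_summable p (j, x) a1 fl.
  have sm2 := conv_summable (fun y => (p y).2) x (csummable_fibre theta a1) gl.
  have -> : csum (fun y => a y * u (j, x) y) = convol a p f (j, x) -
      phe j * convol (fibre_kernel a theta) (fun y => (p y).2) g x.
    have -> : csum (fun y => a y * u (j, x) y) =
      csum (fun y => a y * f ((j, x) - p y) +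
         (- phe j) * (fibre_kernel a theta y * g (x - (p y).2))).
      congr csum; apply/funext => y; rewrite /u /f /tens /phe /fibre_kernel /=.
      have e : expi ((j - (p y).1)%:~R * theta) = expi (j%:~R * theta) * expi (- ((p y).1%:~R * theta)).
        by rewrite intrB mulrBl expiD.
      rewrite e; ring.
    by rewrite (csumD sm1 (csummableZ _ sm2)) (csumZ _ sm2) mulNr.
  ring.
move=> h; have := l2normD Pl Cl; rewrite Pn phen mul1r => h2.
rewrite -/(opshift (fibre theta) lam%:C g); lra.
Qed.

Lemma fibre_dist (e : R) : 0 < e -> exists2 d : R, 0 < d & forall theta theta',
  `|theta - theta'| <= d -> forall g, l2 g ->
  l2norm (fibre theta g - fibre theta' g) <= e * l2norm g.
Proof.
move=> e0.
pose N := nsum (fun y => Normc.normc (a y)).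
have N0 : 0 <= N by apply: nsum_ge0 => y; exact: normc_ge0.
(* [conv_l2] doubles the weighted sum, which may therefore be [e / 2]: one [e / 4] from the hops in
   [F], through [eta], and another from the tail, where phases differ by at most 2. *)
have d0 : 0 < e / 8 by rewrite divr_gt0.
have [F uF FP] := nsum_weight_small a1 d0.
pose eta := e / (4 * (N + 1)).
have eta0 : 0 < eta by rewrite divr_gt0// mulr_gt0// ltr_wpDl.
have [d1 d10 dP] := expi_near1 eta0.
(* [P] exceeds the frequencies of all hops in [F], so changing [theta] by [d1 / P] turns each of
   their phases by at most [d1]. *)
pose P := 1 + \sum_(y <- F) `|(p y).1%:~R| : R.
have P0 : 0 < P by rewrite ltr_pwDl// sumr_ge0.
exists (d1 / P); first by rewrite divr_gt0.
move=> th th' thd g gl.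
pose b y := fibre_kernel a th y - fibre_kernel a th' y.
pose k y := Normc.normc (expi (- ((p y).1%:~R * th)) - expi (- ((p y).1%:~R * th'))).
have bk y : Normc.normc (b y) = Normc.normc (a y) * k y.
  by rewrite /b /fibre_kernel -mulrBr Normc.normcM.
have k2 y : 0 <= k y <= 2.
  rewrite normc_ge0/=; apply: le_trans (ler_normcD _ _) _.
  by rewrite normcN' !normc_expi.
have kF y : y \in F -> k y <= eta.
  move=> yF; rewrite /k expi_dist; apply: dP.
  have -> : - ((p y).1%:~R * th) - - ((p y).1%:~R * th') = - ((p y).1%:~R * (th - th')) by ring.
  rewrite normrN normrM; apply: (@le_trans _ _ (P * (d1 / P))).
    apply: ler_pM => //; rewrite /P (big_rem y)//= addrCA lerDl addr_ge0// sumr_ge0//.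
  by rewrite mulrC divfK ?gt_eqF.
have := FP k 2 eta (ler0n _ _) k2 (ltW eta0) kF; rewrite -/N => h.
have bE : (fun y => Normc.normc (b y)) = (fun y => Normc.normc (a y) * k y) by apply/funext.
have b1 : csummable b.
  have : nfin (fun y => 2 * Normc.normc (a y)) by apply: nfinZ => // y; exact: normc_ge0.
  by apply: nfin_le => y; rewrite bk mulrC ler_wpM2r ?normc_ge0//; have /andP[] := k2 y.
have -> : fibre th g - fibre th' g = convol b (fun y => (p y).2) g.
  apply/funext => x.
  change ((convol (fibre_kernel a th) (fun y => (p y).2) g x + (W x)%:C * g x) -
    (convol (fibre_kernel a th') (fun y => (p y).2) g x + (W x)%:C * g x) =
    convol b (fun y => (p y).2) g x).
  have sm := conv_summable (fun y => (p y).2) x (csummable_fibre th a1) gl.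
  have sm' := conv_summable (fun y => (p y).2) x (csummable_fibre th' a1) gl.
  have -> : convol b (fun y => (p y).2) g x = csum (fun y => fibre_kernel a th y * g (x - (p y).2) +
      (-1) * (fibre_kernel a th' y * g (x - (p y).2))).
    by congr csum; apply/funext => y; rewrite /b; ring.
  rewrite (csumD sm (csummableZ _ sm')) (csumZ _ sm') -!/(convol _ _ _ _); ring.
apply: le_trans (conv_l2 _ b1 gl).2 _; rewrite ler_wpM2r ?l2norm_ge0// bE.
have h2 : eta * N <= e / 4.
  rewrite /eta mulrAC ler_pdivrMr; last by rewrite mulr_gt0// ltr_wpDl.
  have := mulr_ge0 (ltW e0) N0; lra.
lra.
Qed.

(* Truncating the kernel to finitely many y makes A act on functions with finite support in the
   first coordinate, where the finite Fourier transform applies exactly. *)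
Lemma bdd_below_of_fibres lam (c : R) : 0 < c -> (forall theta, bdd_below (fibre theta) lam c) ->
  bdd_below A lam (c / 2).
Proof.
move=> c0 H.
(* The dropped tail has operator norm at most twice [c / 8]. It is paid once in the fibres and once
   in [A], so [c] becomes [3 * c / 4] and then [c / 2]. *)
have c80 : 0 < c / 8 by rewrite divr_gt0.
have [F uF Fd] := nsum_tail (fun y => normc_ge0 (a y)) a1 c80.
pose b y := if y \in F then a y else 0.
pose b' y := if y \in F then 0 else a y.
have b'n : nsum (fun y => Normc.normc (b' y)) <= c / 8.
  apply: le_trans Fd; rewrite le_eqVlt; apply/orP; left; apply/eqP; congr nsum.
  by apply/funext => y; rewrite /b'; case: ifP => // _; rewrite Normc.normc0.
have [b1 _] := csum_finsupp uF (fun y yF => ifN _ _ yF : b y = 0).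
have b'1 : csummable b'.
  by apply: nfin_le a1 => y; rewrite /b'; case: ifP => // _; rewrite Normc.normc0 normc_ge0.
have trunc (G' : zmodType) (q : Y -> G') (V : G' -> R) (k : Y -> R[i]) (g : G' -> R[i]) :
    (forall y, Normc.normc (k y) = 1) -> l2 g ->
    l2 (conv_op (fun y => a y * k y) q V g - conv_op (fun y => b y * k y) q V g) /\
    l2norm (conv_op (fun y => a y * k y) q V g - conv_op (fun y => b y * k y) q V g) <= c / 4 * l2norm g.
  move=> k1 gl.
  have su (b0 : Y -> R[i]) : csummable b0 -> csummable (fun y => b0 y * k y).
    by apply: nfin_le => y; rewrite Normc.normcM k1 mulr1.
  have -> : conv_op (fun y => a y * k y) q V g - conv_op (fun y => b y * k y) q V g =
      convol (fun y => b' y * k y) q g.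
    apply/funext => x.
    change ((convol (fun y => a y * k y) q g x + (V x)%:C * g x) -
      (convol (fun y => b y * k y) q g x + (V x)%:C * g x) = convol (fun y => b' y * k y) q g x).
    have sm := conv_summable q x (su _ b1) gl; have sm' := conv_summable q x (su _ b'1) gl.
    have -> : convol (fun y => a y * k y) q g x =
        convol (fun y => b y * k y) q g x + convol (fun y => b' y * k y) q g x.
      rewrite -(csumD sm sm'); congr csum; apply/funext => y.
      by rewrite /b /b'; case: ifP => _; ring.
    ring.
  have [l n] := conv_l2 q (su _ b'1) gl; split => //; apply: le_trans n _.
  rewrite ler_wpM2r ?l2norm_ge0//.
  have -> : (fun y => Normc.normc (b' y * k y)) = (fun y => Normc.normc (b' y)).
    by apply/funext => y; rewrite Normc.normcM k1 mulr1.
  by have := b'n; lra.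
pose B := conv_op b p (fun z => W z.2).
pose Bf th := conv_op (fibre_kernel b th) (fun y => (p y).2) W.
have AB f : l2 f -> l2 (A f - B f) /\ l2norm (A f - B f) <= c / 4 * l2norm f.
  move=> fl; have := trunc _ p (fun z => W z.2) (fun=> 1) f (fun=> Normc.normc1 _) fl.
  rewrite (_ : (fun y => a y * 1) = a); last by apply/funext => y; rewrite mulr1.
  by rewrite (_ : (fun y => b y * 1) = b); last by apply/funext => y; rewrite mulr1.
have fibreB th g : l2 g -> l2 (fibre th g - Bf th g) /\
    l2norm (fibre th g - Bf th g) <= c / 4 * l2norm g.
  move=> gl; have := trunc _ (fun y => (p y).2) W (fun y => expi (- ((p y).1%:~R * th))) g
    (fun y => normc_expi _) gl; exact.
have bbBf th g : l2 g -> (3 * c / 4) * l2norm g <= l2norm (Bf th g - scal lam%:C g).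
  move=> gl; have [l n] := fibreB th g gl; have := H th g gl.
  have sF := sym_shift lam (fibre_sym th); have Tl := ap_l2 sF gl.
  have -> : Bf th g - scal lam%:C g = opshift (fibre th) lam%:C g - (fibre th g - Bf th g).
    by rewrite /opshift opprB [RHS]addrC addrA subrK.
  rewrite -/(opshift (fibre th) lam%:C g); have := l2norm_lb Tl l; lra.
apply: (bdd_below_dense total_sym) => [|S f Sf fl]; first by rewrite ltW// divr_gt0.
have [Dl Dn] := AB f fl.
have sA := sym_shift lam total_sym; have Tl := ap_l2 sA fl.
pose v := opshift B lam%:C f.
have vE : v = opshift A lam%:C f - (A f - B f).
  by rewrite /v /opshift opprB [RHS]addrC addrA subrK.
have vl : l2 v by rewrite vE; exact: l2_sub.
suff key : (3 * c / 4) * l2norm f <= l2norm v.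
  have := l2normB Tl Dl; rewrite -vE -/(opshift A lam%:C f); lra.
pose J0 := [seq z.1 | z <- S].
(* [J] contains the first coordinates of the supports of both [f] and [v]. *)
pose J := undup (J0 ++ [seq j + (p y).1 | j <- J0, y <- F]).
have uJ : uniq J by exact: undup_uniq.
have fJ0 j x : j \notin J0 -> f (j, x) = 0.
  by move=> jJ; apply: Sf; apply: contra jJ => h; apply/mapP; exists (j, x).
have fJ j x : j \notin J -> f (j, x) = 0.
  by move=> jJ; apply: fJ0; apply: contra jJ => h; rewrite mem_undup mem_cat h.
have fJy j x y : y \in F -> j \notin J -> f (j - (p y).1, x) = 0.
  move=> yF jJ; apply: fJ0; apply: contra jJ => h; rewrite mem_undup mem_cat; apply/orP; right.
  by apply/allpairsP; exists (j - (p y).1, y); split => //=; rewrite subrK.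
have convB (T : zmodType) (q : Y -> T) (k : Y -> R[i]) (g : T -> R[i]) x :
    convol (fun y => b y * k y) q g x = \sum_(y <- F) a y * k y * g (x - q y).
  rewrite /convol.
  have [|_ ->] := @csum_finsupp _ _ (fun y => b y * k y * g (x - q y)) F uF.
    by move=> y yF; rewrite /b (negbTE yF) !mul0r.
  by apply: eq_big_seq => y yF; rewrite /b yF.
have vval j x : v (j, x) = \sum_(y <- F) a y * f (j - (p y).1, x - (p y).2) +
    (W x)%:C * f (j, x) - lam%:C * f (j, x).
  change (convol b p f (j, x) + (W x)%:C * f (j, x) - lam%:C * f (j, x) =
   \sum_(y <- F) a y * f (j - (p y).1, x - (p y).2) + (W x)%:C * f (j, x) - lam%:C * f (j, x)).
  have := convB _ p (fun=> 1) f (j, x).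
  rewrite (_ : (fun y => b y * 1) = b); last by apply/funext => y; rewrite mulr1.
  by move=> ->; congr (_ + _ - _); apply: eq_bigr => y _; rewrite mulr1.
have vJ j x : j \notin J -> v (j, x) = 0.
  move=> jJ; rewrite vval big1_seq; last by move=> y /andP[_ yF]; rewrite fJy// mulr0.
  by rewrite fJ// !mulr0 addr0 subr0.
(* More than any difference of two elements of [J], as [parseval] requires. *)
pose m := (2 * \sum_(j <- J) `|j|)%N.+1.
have Jm j j' : j \in J -> j' \in J -> (`|j - j'| < m)%N.
  move=> jJ j'J; rewrite ltnS; apply: (@leq_trans (`|j| + `|j'|)%N).
    by have := leqD_dist j 0 j'; rewrite subr0 sub0r abszN.
  rewrite mul2n -addnn; apply: leq_add.
    by rewrite (big_rem j)//= leq_addr.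
  by rewrite (big_rem j')//= leq_addr.
have slice (F0 : int * G -> R[i]) j : l2 F0 -> l2 (fun x => F0 (j, x)).
  move=> F0l.
  apply: (l2_partial (l2norm_ge0 F0) _).1 => s' us'; rewrite l2norm_nsum.
  apply: le_trans (partial_nsum (s := [seq (j, x) | x <- s']) _ F0l _) => [|z|].
  - by rewrite big_map; apply: ler_sum => x _; rewrite normc2.
  - exact: sqr_ge0.
  - by rewrite map_inj_uniq// => x x' [].
have norm_slices (F0 : int * G -> R[i]) : l2 F0 -> (forall j x, j \notin J -> F0 (j, x) = 0) ->
    l2norm F0 ^+ 2 = \sum_(j <- J) l2norm (fun x => F0 (j, x)) ^+ 2.
  move=> F0l F0J; have [_ ->] := l2_prod_nfin (fun j => slice F0 j F0l) F0l.
  have [|_ ->//] := @nsum_finsupp _ _ (fun j => l2norm (fun x => F0 (j, x)) ^+ 2) J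
    (fun j => sqr_ge0 _) uJ.
  move=> j jJ; have -> : (fun x => F0 (j, x)) = 0 by apply/funext => x; exact: F0J.
  by rewrite l2norm0 expr0n.
pose hat (F0 : int * G -> R[i]) th := \sum_(j <- J) scal (expi (- (j%:~R * th))) (fun x => F0 (j, x)).
have hatl F0 th : l2 F0 -> l2 (hat F0 th).
  by move=> F0l; apply: l2_sum => j; apply: l2_scal; exact: slice.
have hatE F0 th x : hat F0 th x = \sum_(j <- J) expi (- (j%:~R * th)) * F0 (j, x).
  by rewrite /hat fct_sumE.
(* Hops in the first coordinate become phases; summing over [J] leaves no boundary terms, since [J]
   contains all shifted indices. *)
have hatv th : hat v th = Bf th (hat f th) - scal lam%:C (hat f th).
  apply/funext => x.
  change (hat v th x = convol (fibre_kernel b th) (fun y => (p y).2) (hat f th) x +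
    (W x)%:C * hat f th x - lam%:C * hat f th x).
  rewrite [convol _ _ _ _]convB hatE.
  under eq_bigr do rewrite vval mulrBr mulrDr.
  rewrite sumrB big_split/= !hatE !mulr_sumr; congr (_ + _ - _); last 2 first.
  - by apply: eq_bigr => j _; rewrite mulrCA.
  - by apply: eq_bigr => j _; rewrite mulrCA.
  under eq_bigr do rewrite mulr_sumr.
  rewrite exchange_big/=; apply: eq_big_seq => y yF.
  rewrite hatE mulr_sumr.
  have e1 : \sum_(j <- J) expi (- (j%:~R * th)) * f (j - (p y).1, x - (p y).2) =
      expi (- ((p y).1%:~R * th)) * \sum_(j <- J) expi (- (j%:~R * th)) * f (j, x - (p y).2).
    have [|s1 <-] := @csum_finsupp _ _ (fun j => expi (- (j%:~R * th)) * f (j - (p y).1, x - (p y).2)) J uJ.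
      by move=> j jJ; rewrite fJy ?mulr0.
    have [|s2 <-] := @csum_finsupp _ _ (fun j => expi (- (j%:~R * th)) * f (j, x - (p y).2)) J uJ.
      by move=> j jJ; rewrite fJ ?mulr0.
    rewrite -csumZ// (csum_reindex _ (bij_translate (- (p y).1))).
    congr csum; apply/funext => j; rewrite opprK addrK mulrA -expiD; congr (expi _ * _).
    by rewrite intrD; ring.
  transitivity (a y * \sum_(j <- J) expi (- (j%:~R * th)) * f (j - (p y).1, x - (p y).2)).
    by rewrite mulr_sumr; apply: eq_bigr => j _; rewrite mulrCA.
  by rewrite e1 !mulr_sumr; apply: eq_bigr => j _; rewrite !mulrA.
have Pv := parseval uJ (fun j => slice v j vl) Jm.
have Pf := parseval uJ (fun j => slice f j fl) Jm.
have kc0 : 0 <= 3 * c / 4 * l2norm f by rewrite mulr_ge0 ?l2norm_ge0// divr_ge0// mulr_ge0// ltW.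
rewrite -(@ler_pXn2r _ 2) ?nnegrE ?l2norm_ge0//.
have m0 : 0 < (m%:R : R) by rewrite ltr0n.
rewrite -(ler_pM2l m0) exprMn mulrCA (norm_slices f)// (norm_slices v)// -Pv -Pf.
rewrite mulr_sumr; apply: ler_sum => q _.
rewrite -exprMn; apply: lerXn2r; rewrite ?nnegrE ?l2norm_ge0//.
  by rewrite mulr_ge0 ?l2norm_ge0// divr_ge0// mulr_ge0// ltW.
rewrite -/(hat f (grid q)) -/(hat v (grid q)) hatv; apply: bbBf; exact: hatl.
Qed.

End Fibres.

(** * Components of the spectrum *)

Section RealSets.
Context {R : realType}.
Implicit Types (E F : set R).

Definition linked E x y := forall t, Num.min x y <= t <= Num.max x y -> E t.

Lemma linkedC E x y : linked E x y -> linked E y x.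
Proof. by rewrite /linked minC maxC. Qed.

Lemma linked_trans E y x z : linked E x y -> linked E y z -> linked E x z.
Proof.
move=> xy yz t; rewrite ge_min le_max => /andP[h1 h2].
have [h|h] := pselect (Num.min x y <= t <= Num.max x y); first exact: xy.
apply: yz; move/negP: h; rewrite negb_and -!ltNge !lt_min !gt_max => h.
rewrite ge_min le_max; move: h1 h2 h => /orP h1 /orP h2 /orP h; apply/andP; split; apply/orP.
  case: h => /andP[h h']; first by case: h1 => ?; [lra|right].
  by left; exact: ltW.
case: h => /andP[h h']; first by left; exact: ltW.
by case: h2 => ?; [lra|right].
Qed.

(* E is a union of countably many intervals, of which g enumerates points. *)
Definition countably_connected E := exists g : nat -> R,
  forall x, E x -> exists n, linked E x (g n).

Lemma countably_connected_countType E (K : countType) (g : K -> R) :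
  (forall x, E x -> exists k, linked E x (g k)) ->
  countably_connected E.
Proof.
move=> H; exists (fun n => if unpickle n is Some k then g k else 0) => x /H[k kP].
by exists (pickle k); rewrite pickleK.
Qed.

(** An isolated point is the only point of [E] between two suitable rationals, and that pair names
    it. *)
Lemma isolated_countable E : exists g : rat * rat -> R, forall x, E x ->
  (exists2 r : R, 0 < r & forall y, 0 < `|y - x| -> `|y - x| < r -> ~ E y) ->
  exists k, g k = x.
Proof.
pose P (k : rat * rat) x := [/\ E x, ratr k.1 < x, x < ratr k.2 &
  forall y, E y -> ratr k.1 < y -> y < ratr k.2 -> y = x].
have : forall k, exists y, forall x, P k x -> y = x.
  move=> k; have [[y Py]|no] := pselect (exists y, P k y); last first.
    by exists 0 => x Px; exfalso; apply: no; exists x.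
  by exists y => x [Ex h1 h2 _]; have [Ey h3 h4 u] := Py; apply/esym/u.
move=> /choice[g gP]; exists g => x Ex [r r0 iso].
have [q1] : exists q, ratr q \in `]x - r, x[ by apply: rat_in_itvoo; lra.
have [q2] : exists q, ratr q \in `]x, x + r[ by apply: rat_in_itvoo; lra.
rewrite !in_itv /= => /andP[h1 h2] /andP[h3 h4].
exists (q1, q2); apply: gP; split => //= y Ey y1 y2.
apply: contrapT => yx; apply: (iso y) => //.
  by rewrite normr_gt0 subr_eq0; apply/eqP.
by rewrite ltr_norml; apply/andP; split; lra.
Qed.

(** Closedness, in the metric form that lower bounds of operators provide. *)
Definition far_closed F := forall y, ~ F y -> exists2 c : R, 0 < c & forall z, F z -> c <= `|z - y|.

(** [F] stands for the spectrum of one fibre inside the spectrum [E]. Being closed, [F] has a first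
    point at or after [x], and a point missing from [E] before it serves as [b]. If there is none,
    any point beyond the bound of [E] does. *)
Lemma right_gap E F x M : (forall y, F y -> E y) -> far_closed F ->
  (forall y, E y -> y < M) ->
  E x -> (forall nu, F nu -> x <= nu -> exists2 t, x <= t <= nu & ~ E t) ->
  exists b, [/\ x < b, ~ E b & forall nu, F nu -> ~ (x <= nu <= b)].
Proof.
move=> FE Fc EM Ex H.
pose S := [set nu | F nu /\ x <= nu].
have [[nu0 Snu0]|no] := pselect (exists nu, S nu); last first.
  exists (Num.max M (x + 1)); split.
  - by rewrite lt_max; apply/orP; right; rewrite ltrDl.
  - by move=> /EM; rewrite ltNge le_max lexx.
  - by move=> nu Fnu /andP[xnu _]; apply: no; exists nu.
have Slb : has_lbound S by exists x => y [].
have Sinf : has_inf S by split => //; exists nu0.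
pose q := inf S.
have xq : x <= q by apply: lb_le_inf; [exists nu0|move=> y []].
have Fq : F q.
  apply: contrapT => /Fc[c c0 cP].
  have [z [Fz xz] zq] := inf_adherent c0 Sinf.
  have qz : q <= z by apply: ge_inf.
  by have := cP z Fz; rewrite ger0_norm ?subr_ge0// leNgt => /negP; apply; rewrite ltrBlDl.
have [t /andP[xt tq] nEt] := H q Fq xq.
have tx : t != x by apply/eqP => e; apply: nEt; rewrite e.
exists t; split => //; first by rewrite lt_def tx.
move=> nu Fnu /andP[xnu nut].
have qnu : q <= nu by apply: ge_inf.
apply: nEt; have -> : t = nu by apply/eqP; rewrite eq_le nut (le_trans tq).
exact: FE.
Qed.

Lemma left_gap E F x M : (forall y, F y -> E y) -> far_closed F ->
  (forall y, E y -> M < y) ->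
  E x -> (forall nu, F nu -> nu <= x -> exists2 t, nu <= t <= x & ~ E t) ->
  exists b, [/\ b < x, ~ E b & forall nu, F nu -> ~ (b <= nu <= x)].
Proof.
move=> FE Fc EM Ex H.
have [|||||b [xb nEb bP]] := @right_gap [set y | E (- y)] [set y | F (- y)] (- x) (- M).
- by move=> y; exact: FE.
- move=> y /Fc[c c0 cP]; exists c => // z Fz.
  by have := cP (- z) Fz; rewrite opprK addrC distrC.
- by move=> y /EM; rewrite ltrNr.
- by rewrite /= opprK.
- move=> nu Fnu xnu; have [|t /andP[t1 t2] nEt] := H (- nu) Fnu; first by rewrite lerNl.
  by exists (- t) => /=; rewrite ?opprK// lerN2 t2 lerNl t1.
exists (- b); split => //; first by rewrite ltrNl.
by move=> nu Fnu /andP[h1 h2]; apply: (bP (- nu)); rewrite /= ?opprK// lerN2 h2 lerNl h1.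
Qed.

End RealSets.

(** * The spectrum as a closed bounded set, and its stability *)

Section RealSpectrum.
Context {R : realType} {X : choiceType}.
Implicit Types (A : (X -> R[i]) -> X -> R[i]).

Lemma real_spectrum_far A : sym_op A -> far_closed (real_spectrum A).
Proof.
move=> sA y /not_real_spectrum[c c0 b]; exists c => // z zP; rewrite leNgt; apply/negP => h.
apply: (zP (c - `|y - z|)); first by rewrite subr_gt0 distrC.
exact: bdd_below_perturb.
Qed.

Lemma real_spectrum_bounded A : sym_op A -> exists M : R, forall y, real_spectrum A y -> `|y| < M.
Proof.
move=> sA; have [M _ [M0 AM]] := ap_bound sA 0; exists (M + 1) => y yP.
rewrite ltNge; apply/negP => h; apply: (yP 1) => // f fl.
have l1 := ap_l2 sA fl; have l3 : l2 (scal y%:C f) by exact: l2_scal.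
have := l2norm_lb l3 l1; rewrite l2norm_subC l2norm_scal// normc_real.
have [h1 _] := AM f fl; have := ler_wpM2r (l2norm_ge0 f) h; rewrite mulrDl; lra.
Qed.

Lemma bdd_below_op_perturb A A' lam (c e : R) : sym_op A -> sym_op A' -> bdd_below A lam c ->
  (forall g, l2 g -> l2norm (A g - A' g) <= e * l2norm g) -> bdd_below A' lam (c - e).
Proof.
move=> sA sA' H De f fl.
have l1 := ap_l2 (sym_shift lam sA') fl.
have l3 : l2 (A f - A' f) by apply: l2_sub; [exact: (ap_l2 sA)|exact: (ap_l2 sA')].
have := H f fl; have := De f fl; have := l2normD l1 l3.
have -> : opshift A' lam%:C f + (A f - A' f) = A f - scal lam%:C f.
  by rewrite /opshift addrC addrA subrK.
rewrite -/(opshift A' lam%:C f); lra.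
Qed.

End RealSpectrum.

Lemma real_spectrum_relabel {R : realType} {X X' : choiceType} (e : X -> X')
    (A : (X' -> R[i]) -> X' -> R[i]) (A' : (X -> R[i]) -> X -> R[i]) : bijective e ->
  (forall f, l2 f -> A' (f \o e) = (A f) \o e) -> real_spectrum A' = real_spectrum A.
Proof.
move=> be H.
have eqn lam f : l2 f -> l2norm (A' (f \o e) - scal lam%:C (f \o e)) = l2norm (A f - scal lam%:C f).
  by move=> fl; rewrite H// -(l2norm_relabel be).
have bbE lam c : bdd_below A' lam c <-> bdd_below A lam c.
  split => h f fl.
    have := h (f \o e) ((l2_relabel be f).1 fl).
    by rewrite eqn// (l2norm_relabel be).
  have [e' eK e'K] := be.
  have fE : f = (f \o e') \o e by apply/funext => x /=; rewrite eK.
  have gl : l2 (f \o e') by apply/(l2_relabel be); rewrite -fE.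
  by rewrite fE eqn// (l2norm_relabel be); exact: h.
by apply/seteqP; split => lam lP c c0 /bbE; exact: lP.
Qed.

(** * Linking the spectrum of an operator to that of one fibre *)

Section FibreSpectrum.
Context {R : realType} {Y : choiceType} {G : zmodType}.
Variables (a : Y -> R[i]) (p : Y -> int * G) (s : Y -> Y) (hk : herm_kernel a p s).
Variables (W : G -> R) (M : R) (WM : forall x, `|W x| <= M).

Notation A := (conv_op a p (fun z => W z.2)).
Notation fib := (fibre a p W).

Lemma real_spectrum_fibre theta nu : real_spectrum (fib theta) nu -> real_spectrum A nu.
Proof.
move=> h c c0 b; apply: (h (c / 2)); first by rewrite divr_gt0.
exact: (bdd_below_fibre hk WM).
Qed.

(** Continuation in the parameter: the step [d] does not depend on [theta], and after each step the
    bound at the midpoint, weakened by [c / 4], is restored by [bdd_below_gap], because every fibre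
    keeps the bound [c / 2] at both ends. *)
Lemma fibres_bdd_below_gap (al be c : R) : al < be -> 0 < c -> bdd_below A al c -> bdd_below A be c ->
  bdd_below (fib 0) ((al + be) / 2) ((be - al) / 2) ->
  forall theta, bdd_below (fib theta) ((al + be) / 2) ((be - al) / 2).
Proof.
move=> ab c0 ba b_ b0 theta.
have c40 : 0 < c / 4 by rewrite divr_gt0.
have [d d0 dP] := fibre_dist hk W c40.
have step th th' : `|th - th'| <= d -> bdd_below (fib th) ((al + be) / 2) ((be - al) / 2) ->
    bdd_below (fib th') ((al + be) / 2) ((be - al) / 2).
  move=> thd h; have c20 : 0 < c / 2 by rewrite divr_gt0.
  apply: (bdd_below_gap (fibre_sym hk WM th') ab c20 (bdd_below_fibre hk WM th' c0 ba) (bdd_below_fibre hk WM th' c0 b_)).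
  have -> : c / 2 / 2 = c / 4 by field.
  exact: (bdd_below_op_perturb (fibre_sym hk WM th) (fibre_sym hk WM th') h (dP _ _ thd)).
have [n hn] : exists n : nat, `|theta| <= d * n%:R.
  have t1 : 0 < `|theta| + 1 by rewrite ltr_wpDl.
  have [n hn] := archimed_small (divr_gt0 d0 t1).
  exists n.+1; move: hn; rewrite ler_pdivlMr ?ltr_wpDl// mulrC ler_pdivrMr ?ltr0Sn//; lra.
have main k : bdd_below (fib (theta * (k%:R / n.+1%:R))) ((al + be) / 2) ((be - al) / 2).
  elim: k => [|k IH]; first by rewrite mul0r mulr0.
  apply: step IH; rewrite -mulrBr -mulrBl -natr1 opprD addrA subrr sub0r mulN1r mulrN normrN.
  rewrite normrM [X in _ * X]ger0_norm ?invr_ge0// ler_pdivrMr ?ltr0Sn//.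
  by apply: le_trans hn _; rewrite ler_wpM2l ?(ltW d0)// ler_nat.
have e : theta * (n.+1%:R / n.+1%:R) = theta by rewrite divff ?mulr1// pnatr_eq0.
by have := main n.+1; rewrite e.
Qed.

Lemma fibres_connected lam : real_spectrum A lam -> exists2 nu, real_spectrum (fib 0) nu &
  linked (real_spectrum A) lam nu.
Proof.
move=> lamP; apply: contrapT => no.
have sA := total_sym hk WM.
have bad nu : real_spectrum (fib 0) nu -> exists2 t, Num.min lam nu <= t <= Num.max lam nu & ~ real_spectrum A t.
  move=> nuP; apply: contrapT => h; apply: no; exists nu => // t tP; apply: contrapT => nt.
  by apply: h; exists t.
have [B BP] := real_spectrum_bounded sA.
have Fc := real_spectrum_far (fibre_sym hk WM 0).
have [||be [lb nbe beP]] := @right_gap _ (real_spectrum A) (real_spectrum (fib 0)) lam B (@real_spectrum_fibre 0) Fc _ lamP.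
- by move=> y /BP; apply: le_lt_trans; exact: ler_norm.
- move=> nu nuP h; have [t tP nt] := bad nu nuP; exists t => //.
  by move: tP; rewrite (min_idPl h) (max_idPr h).
have [||al [la nal alP]] := @left_gap _ (real_spectrum A) (real_spectrum (fib 0)) lam (- B) (@real_spectrum_fibre 0) Fc _ lamP.
- by move=> y /BP; rewrite ltr_norml => /andP[].
- move=> nu nuP h; have [t tP nt] := bad nu nuP; exists t => //.
  by move: tP; rewrite (min_idPr h) (max_idPl h).
have [c1 c10 b1] := not_real_spectrum nal; have [c2 c20 b2] := not_real_spectrum nbe.
pose c := Num.min c1 c2.
have c0 : 0 < c by rewrite lt_min c10.
have b1' : bdd_below A al c by apply: bdd_below_le b1; rewrite ge_min lexx.
have b2' : bdd_below A be c by apply: bdd_below_le b2; rewrite ge_min lexx orbT.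
have ab : al < be by exact: lt_trans lb.
have bf0 : bdd_below (fib 0) ((al + be) / 2) ((be - al) / 2).
  apply: contrapT => nb; have [|nu nuP] := spectrum_near (fibre_sym hk WM 0) _ nb; first lra.
  rewrite ltr_norml => /andP[h1 h2].
  case: (leP lam nu) => h.
    by apply: (beP nu nuP); rewrite h/=; lra.
  by apply: (alP nu nuP); rewrite (ltW h) andbT; lra.
have bth := fibres_bdd_below_gap ab c0 b1' b2' bf0.
(* The distance of [lam] from the nearer of [al] and [be]. *)
pose rho := (be - al) / 2 - `|(al + be) / 2 - lam|.
have rho0 : 0 < rho.
  rewrite /rho subr_gt0 ltr_norml; apply/andP; split; lra.
apply: (lamP (rho / 2)); first by rewrite divr_gt0.
apply: (bdd_below_of_fibres hk WM rho0) => th.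
exact: (bdd_below_perturb lam (fibre_sym hk WM th) (bth th)).
Qed.

End FibreSpectrum.

Lemma torsion_free_int_mx m n : torsion_free 'M[int]_(m, n).
Proof.
move=> x k /matrixP h; apply/matrixP => i j; have := h i j.
by rewrite mulmxnE mxE => /eqP; rewrite mulrn_eq0 => /eqP.
Qed.

(* By the Smith normal form, s0 is a multiple of a vector that is part of a basis of Z^(r+1). *)
Lemma split_direction r (s0 : 'rV[int]_(r.+1)) : s0 != 0 ->
  exists (e : int * 'rV[int]_r -> 'rV[int]_(r.+1)) (e' : 'rV[int]_(r.+1) -> int * 'rV[int]_r) (c : int),
  [/\ cancel e e', cancel e' e, forall x y, e (x - y) = e x - e y,
      c != 0 & s0 = e (c, 0)].
Proof.
move=> s00.
have [L _ [Q Qu [d _ sE]]] := int_Smith_normal_form s0.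
pose e (z : int * 'rV[int]_r) : 'rV[int]_(r.+1) := (row_mx (z.1%:M : 'M[int]_1) z.2 : 'rV[int]_(1 + r)%N) *m Q.
pose e' (v : 'rV[int]_(r.+1)) : int * 'rV[int]_r :=
  let u : 'rV[int]_(1 + r)%N := v *m invmx Q in ((lsubmx u) 0 0, rsubmx u).
pose c := L 0 0 * d`_0.
have sc : s0 = e (c, 0).
  rewrite sE /e; congr (_ *m _); apply/matrixP => i j; rewrite !mxE big_ord1 !mxE ord1 /=.
  case: splitP => k; rewrite ?ord1 => jk.
    by rewrite !mxE jk eqxx !mulr1n.
  by rewrite mxE jk /= mulr0n mulr0.
exists e, e', c; split => //.
- by move=> [j x]; rewrite /e' /e mulmxK// row_mxKl row_mxKr mxE eqxx mulr1n.
- move=> v; rewrite /e /e' /=; set u := v *m invmx Q.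
  have -> : (lsubmx (u : 'rV[int]_(1 + r)%N) 0 0)%:M = lsubmx (u : 'rV[int]_(1 + r)%N) by rewrite -mx11_scalar.
  by rewrite hsubmxK /u mulmxKV.
- by move=> [j x] [j' x']; rewrite /e -mulmxBl opp_row_mx add_row_mx -raddfN -raddfD.
- apply: contraNneq s00 => c0; rewrite sc c0 /e /=.
  by rewrite (_ : 0%:M = 0) ?row_mx0 ?mul0mx//; apply/matrixP => i j; rewrite !mxE mul0rn.
Qed.

(** * Induction on the rank of the lattice *)

Section SpectrumCountablyConnected.
Context {R : realType} {Y : choiceType} {V : zmodType} {I : finType}.
Variables (w : I -> V -> R) (tV : torsion_free V).
Hypothesis w0 : forall al (e : R), 0 < e -> exists B : seq V, forall v, v \notin B -> `|w al v| <= e.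

Definition additive_family {G : zmodType} (pi : I -> G -> V) :=
  forall al x y, pi al (x - y) = pi al x - pi al y.

(** The direction [x0] is a multiple by [c] of a basis vector; this transfers the vanishing of a
    form from [x0] to the basis vector itself. *)
Lemma int_additive_eq0 (h : int -> V) (c : int) : (forall j k, h (j - k) = h j - h k) ->
  c != 0 -> h c = 0 -> forall j, h j = 0.
Proof.
move=> hB c0 hc.
have h00 : h 0 = 0 by have := hB 0 0; rewrite !subrr.
have hN j : h (- j) = - h j by have := hB 0 j; rewrite h00 !sub0r.
have hn n : h n%:Z = h 1 *+ n.
  elim: n => [|n IH]; first by rewrite mulr0n.
  by rewrite intS -[n%:Z]opprK hB hN opprK IH mulrS.
have h1 : h 1 = 0.
  case: c c0 hc => n c0 hc.
    case: n c0 hc => [|n] // _; rewrite -[Posz _]/(n.+1%:Z) hn; exact: tV.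
  by move: hc; rewrite NegzE hN hn => /eqP; rewrite oppr_eq0 => /eqP; exact: tV.
by case=> n; rewrite ?NegzE ?hN -?[Posz n]/(n%:Z) hn h1 mul0rn ?oppr0.
Qed.

Lemma real_spectrum_not_bdd_below_off (X : choiceType) (A : (X -> R[i]) -> X -> R[i]) lam :
  ~ bdd_below_off A lam -> real_spectrum A lam.
Proof.
by move=> nb c c0 b; apply: nb; exists [::], c; split => // f fl _; exact: b.
Qed.

Lemma spectrum_countably_connected r (a : Y -> R[i]) (p : Y -> 'rV[int]_r) s
    (pi : I -> 'rV[int]_r -> V) (J0 : {set I}) : herm_kernel a p s -> additive_family pi ->
  countably_connected (real_spectrum (conv_op a p (pot pi w J0))).
Proof.
elim: r a p s pi J0 => [|r IH] a p s pi J0 hk piB.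
all: have sA := opJ_sym hk pi w0 J0.
all: pose JJ (J : {set I}) := exists2 x0 : 'rV[int]__, x0 != 0 & J = [set al in J0 | pi al x0 == 0]%SET.
all: have incl lam : (forall J, JJ J -> ~ real_spectrum (conv_op a p (pot pi w J)) lam) ->
   bdd_below_off (conv_op a p (pot pi w J0)) lam.
1,3: apply: (hvz_incl hk piB w0) => [J [x0 _ ->]|B];
  [by apply/fintype.subsetP => al; rewrite inE => /andP[]
  |have [S SP] := direction_far piB B; exists S => t /SP[x0 x00 h];
   exists [set al in J0 | pi al x0 == 0]%SET; [by exists x0
   |by move=> al aJ0; rewrite inE aJ0 => /h]].
all: have [g gP] := isolated_countable (real_spectrum (conv_op a p (pot pi w J0))).
all: have disc lam : real_spectrum (conv_op a p (pot pi w J0)) lam -> bdd_below_off (conv_op a p (pot pi w J0)) lam ->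
   exists k, g k = lam.
1,3: by move=> lamP boff; have [iso _ _] := bdd_below_off_disc sA boff lamP; exact: gP.
  (* In rank 0 there is no direction, so the hypothesis of [incl] is empty and every point of the
     spectrum is isolated. *)
  apply: (@countably_connected_countType _ _ _ g) => lam lamP.
  have [|k kP] := disc lam lamP.
    by apply: incl => J [x0 x00]; exfalso; move/eqP: x00; apply; apply/matrixP => i [].
  by exists k => t; rewrite kP minxx maxxx => /le_anti <-.
have conv x0 lam : x0 != 0 -> real_spectrum (conv_op a p (pot pi w [set al in J0 | pi al x0 == 0]%SET)) lam ->
    real_spectrum (conv_op a p (pot pi w J0)) lam.
  move=> x00 h; apply: real_spectrum_not_bdd_below_off => boff.
  exact: (hvz_conv hk piB w0 (@torsion_free_int_mx _ _) tV x00 boff h).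
have ccJ J : exists gJ : nat -> R, JJ J -> forall lam, real_spectrum (conv_op a p (pot pi w J)) lam ->
    exists n, linked (real_spectrum (conv_op a p (pot pi w J))) lam (gJ n).
  have [[x0 x00 JE]|no] := pselect (JJ J); last by exists (fun=> 0) => /no.
  have [e [e' [c [eK e'K eB c0 x0E]]]] := split_direction x00.
  have be : bijective e by exists e'.
  have e'B x y : e' (x - y) = e' x - e' y.
    by apply: (can_inj eK); rewrite eB !e'K.
  have e0 : e 0 = 0 by have := eB 0 0; rewrite !subrr.
  have e'0 : e' 0 = 0 by rewrite -e0 eK.
  have e'N x : e' (- x) = - e' x by have := e'B 0 x; rewrite e'0 !sub0r.
  (* In the coordinates [(j, x)] the forms indexed by [J] do not depend on [j], so the potential of
     [J] lives on the remaining coordinates; [piE] holds for these forms only. *)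
  pose pi' al (x : 'rV[int]_r) := pi al (e (0, x)).
  have pi'B : additive_family pi'.
    by move=> al x y; rewrite /pi' -piB -eB; congr (pi al (e _)); congr pair; rewrite subrr.
  have piE al j x : al \in J -> pi al (e (j, x)) = pi' al x.
    rewrite JE inE => /andP[_ /eqP px0].
    have h0 : pi al (e (j, 0)) = 0.
      apply: (@int_additive_eq0 (fun j => pi al (e (j, 0))) c) => //.
        by move=> i k; rewrite -piB -eB; congr (pi al (e _)); congr pair; rewrite subrr.
      by rewrite -x0E.
    have -> : (j, x) = (0, x) - (- j, 0) by congr pair; rewrite /= ?sub0r ?opprK ?subr0.
    rewrite eB piB.
    have -> : pi al (e (- j, 0)) = 0.
      apply: (@int_additive_eq0 (fun j => pi al (e (j, 0))) c) => //.
        by move=> i k; rewrite -piB -eB; congr (pi al (e _)); congr pair; rewrite subrr.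
      by rewrite -x0E.
    by rewrite subr0.
  have hk' : herm_kernel a (e' \o p) s.
    by case: hk => a1 sK sa sp; split => // y; rewrite /= sp e'N.
  have [M WM] := pot_bounded pi' w0 J.
  have relab : real_spectrum (conv_op a (e' \o p) (fun z => pot pi' w J z.2)) =
      real_spectrum (conv_op a p (pot pi w J)).
    apply: (real_spectrum_relabel be) => f fl; apply/funext => -[j x].
    rewrite /conv_op /=; congr (_ + _%:C * _).
      by congr csum; apply/funext => y /=; rewrite eB e'K.
    by apply: eq_bigr => al aJ; rewrite piE.
  (* The fibre at 0 is an operator of the same kind in rank [r]; by [fibres_connected], enumerating
     its components is enough for the whole operator. *)
  have [gJ gJP] := IH _ _ _ pi' J (herm_fibre hk' 0) pi'B.
  exists gJ => _ lam; rewrite -relab => lamP.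
  have [nu nuP nuseg] := fibres_connected hk' WM lamP.
  have [n nP] := gJP nu nuP; exists n.
  apply: (linked_trans nuseg) => t /nP; exact: (real_spectrum_fibre hk' WM).
have [G GP] := choice ccJ.
pose g' (k : (rat * rat) + ({set I} * nat)) := match k with inl q => g q | inr (J, n) => G J n end.
apply: (@countably_connected_countType _ _ _ g') => lam lamP.
have [boff|nb] := pselect (bdd_below_off (conv_op a p (pot pi w J0)) lam).
  have [k kP] := disc lam lamP boff; exists (inl k) => t /=.
  by rewrite kP minxx maxxx => /le_anti <-.
have [J [x0 x00 JE] JP] : exists2 J, JJ J & real_spectrum (conv_op a p (pot pi w J)) lam.
  apply: contrapT => no; apply: nb; apply: incl => J JP h; apply: no; by exists J.
have [n nP] := GP J (ex_intro2 _ _ x0 x00 JE) lam JP.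
(* A segment in the spectrum of the operator of [J] lies in that of [J0], by [conv]. *)
exists (inr (J, n)) => t /= /nP; rewrite JE; exact: conv.
Qed.

End SpectrumCountablyConnected.

(** * Segments of a closed bounded set with countably many components *)

Section Components.
Context {R : realType}.
Implicit Types (E : set R).

Lemma right_end E q M : far_closed E -> (forall y, E y -> y < M) -> E q ->
  exists b, [/\ q <= b, forall t, q <= t <= b -> E t &
    forall x, q <= x -> (forall t, q <= t <= x -> E t) -> x <= b].
Proof.
move=> Ec EM Eq.
pose S := [set x | q <= x /\ forall t, q <= t <= x -> E t].
have Sq : S q by split => // t /le_anti <-.
have Sub : has_ubound S.
  by exists M => x [qx xE]; apply/ltW/EM/xE; rewrite qx lexx.
have Ssup : has_sup S by split => //; exists q.
have qb : q <= sup S by exact: ub_le_sup.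
have below t : q <= t -> t < sup S -> E t.
  move=> qt tb; have t0 : 0 < sup S - t by rewrite subr_gt0.
  have [x [qx xE] tx] := sup_adherent t0 Ssup.
  apply: xE; rewrite qt/=; apply/ltW; move: tx; rewrite opprB addrC subrK; exact.
exists (sup S); split => //.
- move=> t /andP[qt]; rewrite le_eqVlt => /orP[/eqP ->|]; last exact: below.
  apply: contrapT => /Ec[c c0 cP].
  have [x [qx xE] bx] := sup_adherent c0 Ssup.
  have xb : x <= sup S by exact: ub_le_sup.
  have := cP x (xE x _); rewrite qx lexx => /(_ isT); rewrite distrC ger0_norm ?subr_ge0//; lra.
- by move=> x qx xE; apply: ub_le_sup.
Qed.

Lemma left_end E q M : far_closed E -> (forall y, E y -> M < y) -> E q ->
  exists a, [/\ a <= q, forall t, a <= t <= q -> E t &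
    forall x, x <= q -> (forall t, x <= t <= q -> E t) -> a <= x].
Proof.
move=> Ec EM Eq.
have [|||b [qb bE bmax]] := @right_end [set y | E (- y)] (- q) (- M).
- by move=> y /Ec[c c0 cP]; exists c => // z Fz; have := cP (- z) Fz; rewrite opprK addrC distrC.
- by move=> y /EM; rewrite ltrNr.
- by rewrite /= opprK.
exists (- b); split; first by rewrite lerNl.
- by move=> t /andP[h1 h2]; have := bE (- t); rewrite /= opprK; apply; rewrite lerN2 h2 lerNl.
- move=> x xq xE; rewrite lerNl; apply: bmax; first by rewrite lerN2.
  by move=> t /andP[h1 h2]; apply: xE; rewrite lerNr h2 lerNl.
Qed.

(** [I] keeps the least index of a point [g n] in each component, which makes the segments disjoint;
    closedness and boundedness provide their ends. *)
Lemma components E M : far_closed E -> (forall y, E y -> `|y| < M) ->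
  countably_connected E -> exists (I : set nat) (a b : nat -> R),
  [/\ forall k, I k -> a k <= b k,
      trivIset I (fun k => segment (a k) (b k)) &
      [set x%:C | x in E] = \bigcup_(k in I) segment (a k) (b k)].
Proof.
move=> Ec EM [g gP].
have EM1 y : E y -> y < M by move=> /EM; apply: le_lt_trans; exact: ler_norm.
have EM2 y : E y -> - M < y by move=> /EM; rewrite ltr_norml => /andP[].
have [ab abP] : exists ab : nat -> R * R, forall n, E (g n) ->
    [/\ (ab n).1 <= g n, g n <= (ab n).2, forall t, (ab n).1 <= t <= (ab n).2 -> E t &
      forall x, linked E x (g n) -> (ab n).1 <= x <= (ab n).2].
  suff : forall n, exists ab : R * R, E (g n) ->
    [/\ ab.1 <= g n, g n <= ab.2, forall t, ab.1 <= t <= ab.2 -> E t &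
      forall x, linked E x (g n) -> ab.1 <= x <= ab.2] by move=> /choice[ab abP]; exists ab.
  move=> n; have [Eg|nE] := pselect (E (g n)); last by exists (0, 0).
  have [b [qb bE bmax]] := right_end Ec EM1 Eg.
  have [a [aq aE amin]] := left_end Ec EM2 Eg.
  exists (a, b) => _; split => //=.
    move=> t /andP[h1 h2]; case: (leP t (g n)) => h; first by apply: aE; rewrite h1.
    by apply: bE; rewrite h2 ltW.
  move=> x xg; case: (leP x (g n)) => h.
    rewrite (le_trans h qb) andbT; apply: amin => // t th; apply: xg.
    by rewrite (min_idPl h) (max_idPr h).
  rewrite (le_trans aq (ltW h))/=; apply: bmax => [|t th]; first exact: ltW.
  by apply: xg; rewrite (min_idPr (ltW h)) (max_idPl (ltW h)).
have linkedab n x : E (g n) -> (ab n).1 <= x <= (ab n).2 -> linked E x (g n).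
  move=> Eg /andP[h1 h2] t; have [h3 h4 h5 _] := abP n Eg.
  rewrite ge_min le_max => /andP[/orP k1 /orP k2]; apply: h5; apply/andP; split.
    by case: k1 => ?; lra.
  by case: k2 => ?; lra.
pose I := [set k | E (g k) /\ forall j, (j < k)%N -> E (g j) -> ~ linked E (g k) (g j)].
exists I, (fun k => (ab k).1), (fun k => (ab k).2); split.
- by move=> k [/abP[h1 h2 _ _] _]; exact: le_trans h2.
- move=> k l [Ek kP] [El lP] [z [[x xk <-] [y yl /complexI e]]]; subst y.
  move: xk yl; rewrite /= !in_itv /= => /(linkedab _ _ Ek) xk /(linkedab _ _ El) xl.
  have kl : linked E (g k) (g l) by apply: (linked_trans _ xl); exact: linkedC.
  case: (ltngtP k l) => // h; last by exfalso; apply: (kP l).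
  by exfalso; apply: (lP k) => //; exact: linkedC.
apply/seteqP; split => z.
  move=> [x Ex <-]; have ex : exists n, `[< linked E x (g n) >].
    by have [n nP] := gP x Ex; exists n; apply/asboolP.
  case: (ex_minnP ex) => n /asboolP xn nmin.
  have Egn : E (g n) by apply: xn; rewrite ge_min le_max !lexx !orbT.
  exists n; last first.
    by have [_ _ _ h] := abP n Egn; exists x => //=; rewrite in_itv /=; exact: h.
  split => // j jn Egj nj; move: jn; rewrite ltnNge => /negP; apply; apply: nmin.
  by apply/asboolP; exact: linked_trans xn nj.
move=> [k [Ek _] [x]]; rewrite /= in_itv /= => xk <-; exists x => //.
by have [_ _ h _] := abP k Ek; exact: h.
Qed.

End Components.

(** The essential spectrum is closed, because a small change of [lam] weakens the bound without
    changing the exceptional set [S]. *)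
Lemma bdd_below_off_far {R : realType} {X : choiceType} (A : (X -> R[i]) -> X -> R[i]) :
  sym_op A -> far_closed [set lam | ~ bdd_below_off A lam].
Proof.
move=> sA y /= /contrapT[S [c [c0 H]]]; exists c => // z nz.
rewrite leNgt; apply/negP => h; apply: nz; exists S, (c - `|y - z|); split.
  by rewrite subr_gt0 distrC.
move=> f fl fS; have := H f fl fS.
have l1 := ap_l2 (sym_shift z sA) fl.
have l3 : l2 (scal (y - z)%:C f) by exact: l2_scal.
have -> : A f - scal y%:C f = opshift A z%:C f - scal (y - z)%:C f.
  by rewrite /opshift -addrA; congr (_ + _); rewrite -opprD -scalDl -rmorphD addrC subrK.
have := l2normB l1 l3; rewrite l2norm_scal// normc_real -/(opshift A z%:C f); lra.
Qed.

(** * Operators that agree on l2 *)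

Section Ext.
Context {R : realType} {X : choiceType} (A A' : (X -> R[i]) -> X -> R[i]).
Hypothesis AA' : forall f, l2 f -> A f = A' f.

(** The Hamiltonian is identified with a convolution operator on l2 only, where the sums
    converge. *)
Lemma spectrum_ext : spectrum A = spectrum A'.
Proof.
rewrite /spectrum; congr (~` _); apply/seteqP; split => z [B [bB H]]; exists B; split => // f fl;
  have [h1 h2] := H f fl; have [l2B _ _] := bB.
  by split; [rewrite -AA'|rewrite -AA'//; exact: l2B].
by split; [rewrite AA'|rewrite AA'//; exact: l2B].
Qed.

Lemma eigenspace_ext z : op_eigenspace A z = op_eigenspace A' z.
Proof. by apply/seteqP; split => f [fl e]; split => //; rewrite ?AA'// -AA'. Qed.

Lemma disc_spectrum_ext : disc_spectrum A = disc_spectrum A'.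
Proof.
rewrite /disc_spectrum spectrum_ext; apply/seteqP; split => z [h1 h2 h3]; split => //.
- by move: h2; rewrite /op_eigenvalue eigenspace_ext.
- by move: h3; rewrite /finite_multiplicity eigenspace_ext.
- by move: h2; rewrite /op_eigenvalue eigenspace_ext.
- by move: h3; rewrite /finite_multiplicity eigenspace_ext.
Qed.

Lemma ess_spectrum_ext : ess_spectrum A = ess_spectrum A'.
Proof. by rewrite /ess_spectrum spectrum_ext disc_spectrum_ext. Qed.

End Ext.

(* A limit point of the discrete spectrum lies in the essential spectrum, and cannot be interior
   to one of its segments because the discrete spectrum is disjoint from it. *)
Lemma disc_limit_point {R : realType} {X : choiceType} (A : (X -> R[i]) -> X -> R[i])
    (I : set nat) (a b : nat -> R) : sym_op A ->
  ess_spectrum A = \bigcup_(k in I) segment (a k) (b k) ->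
  forall z : R[i], limit_point (disc_spectrum A : set R[i]^o) z ->
  exists2 k, I k & z = (a k)%:C \/ z = (b k)%:C.
Proof.
move=> sA essE z zlim.
have near (r : R) : 0 < r -> exists mu : R, [/\ mu%:C != z, disc_spectrum A mu%:C,
    real_spectrum A mu & Normc.normc (mu%:C - z) < r].
  move=> r0; have [|y [yz yd yr]] := zlim [set w | Normc.normc (w - z) < r].
    by apply/nbhs_complexE; exists r.
  have [iso _ _] := yd; have := isolatedS iso; rewrite spectrumE// => -[mu muP e].
  by exists mu; rewrite e.
have Im0 : complex.Im z = 0.
  apply: contrapT => /eqP h; have [|mu [_ _ _]] := near `|complex.Im z|; first by rewrite normr_gt0.
  rewrite ltNge => /negP; apply; apply: le_trans (Im_normc _).
  by case: (z) => x y /=; rewrite add0r normrN.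
pose lam := complex.Re z.
have ez : z = lam%:C by case: z Im0 @lam {zlim near} => x y /= ->.
have near' (r : R) : 0 < r -> exists mu : R, [/\ 0 < `|mu - lam|, disc_spectrum A mu%:C,
    real_spectrum A mu & `|mu - lam| < r].
  move=> /near[mu [h1 h2 h3 h4]]; exists mu; split => //.
    by rewrite normr_gt0 subr_eq0; apply: contra h1 => /eqP ->; rewrite ez.
  by move: h4; rewrite ez -rmorphB normc_real.
have : ess_spectrum A z.
  rewrite ess_spectrumE//; exists lam => // boff.
  have [lamP|/(real_spectrum_far sA)[c c0 cP]] := pselect (real_spectrum A lam).
    have [[r r0 iso] _ _] := bdd_below_off_disc sA boff lamP.
    by have [mu [h1 _ h3 h4]] := near' r r0; exact: (iso mu).
  by have [mu [_ _ /cP h3 h4]] := near' c c0; move: h3; rewrite leNgt h4.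
rewrite essE => -[k Ik [x]]; rewrite /= in_itv /= => /andP[ax xb] e.
exists k => //; move: e; rewrite ez => /complexI e; subst x.
have [->|la] := eqVneq lam (a k); first by left.
have [->|lb] := eqVneq lam (b k); first by right.
exfalso; have al : a k < lam by rewrite lt_def la.
have lbk : lam < b k by rewrite lt_def eq_sym lb.
have [|mu [_ mud _ h]] := near' (Num.min (lam - a k) (b k - lam)).
  by rewrite lt_min !subr_gt0 al.
have : ess_spectrum A mu%:C.
  rewrite essE; exists k => //; exists mu => //=; rewrite in_itv /=.
  move: h; rewrite lt_min !ltr_norml => /andP[/andP[h1 h2] /andP[h3 h4]].
  by apply/andP; split; lra.
by move=> [_]; exact.
Qed.

Lemma countably_connected_union {R : realType} {T : finType} (P : T -> Prop) (E : T -> set R) :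
  (forall t, P t -> countably_connected (E t)) ->
  countably_connected [set x | exists2 t, P t & E t x].
Proof.
move=> H.
have : forall t, exists g : nat -> R, P t -> forall x, E t x ->
    exists n, linked (E t) x (g n).
  by move=> t; have [/H[g gP]|no] := pselect (P t); [exists g|exists (fun=> 0)].
move=> /choice[g gP].
apply: (@countably_connected_countType _ _ _ (fun k : T * nat => g k.1 k.2)) => x [t Pt Ex].
have [n nP] := gP t Pt x Ex; exists (t, n) => u /nP Eu; by exists t.
Qed.

(** * Sums over a finite index times a lattice *)

Section FiniteProduct.
Context {R : realType} {I : finType} {T : choiceType}.

Lemma nsum_finprod (g : I * T -> R) : (forall z, 0 <= g z) ->
  (forall i, nfin (fun t => g (i, t))) ->
  nfin g /\ nsum g = \sum_(i : I) nsum (fun t => g (i, t)).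
Proof.
move=> g0 gf.
have s0 i : 0 <= nsum (fun t => g (i, t)) by apply: nsum_ge0.
have [|sf sE] := @nsum_finsupp _ _ (fun i : I => nsum (fun t => g (i, t))) (enum I) s0 (enum_uniq _).
  by move=> i; rewrite mem_enum.
have E : (\esum_(z in [set: (I * T)%type]) (g z)%:E =
    (nsum (fun i => nsum (fun t => g (i, t))))%:E)%E.
  rewrite -nsumE//.
  have -> : (fun z => (g z)%:E) = (fun z : I * T => ((fun i t => g (i, t)) z.1 z.2)%:E).
    by apply/funext => -[].
  rewrite -(esum_prod (g := fun i t => g (i, t)))//.
  by apply: eq_esum => i _; rewrite -nsumE.
split; first by rewrite /nfin E ltry.
by rewrite /nsum E -/(nsum _) sE big_enum.
Qed.

Lemma csum_finprod (g : I * T -> R[i]) : (forall i, csummable (fun t => g (i, t))) ->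
  csummable g /\ csum g = \sum_(i : I) csum (fun t => g (i, t)).
Proof.
move=> gf.
have rs (h : I * T -> R) : (forall i, abssum (fun t => h (i, t))) ->
    rsum h = \sum_(i : I) rsum (fun t => h (i, t)).
  move=> hf; rewrite rsum_pn.
  have [|i|_ ->] := @nsum_finprod (fun z => Num.max (h z) 0).
  - by move=> z; rewrite le_max lexx orbT.
  - exact: (abssum_pos (hf i)).
  have [|i|_ ->] := @nsum_finprod (fun z => Num.max (- h z) 0).
  - by move=> z; rewrite le_max lexx orbT.
  - exact: (abssum_neg (hf i)).
  by rewrite -sumrB.
have [|i|sm _] := @nsum_finprod (fun z => Normc.normc (g z)).
- by move=> z; exact: normc_ge0.
- exact: gf.
split => //; rewrite /csum (rs (fun z => complex.Re (g z))); last by move=> i; exact: csummable_Re (gf i).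
rewrite (rs (fun z => complex.Im (g z))); last by move=> i; exact: csummable_Im (gf i).
elim: (index_enum I) => [|i l IH]; first by rewrite !big_nil.
by rewrite !big_cons -IH.
Qed.

End FiniteProduct.

Lemma summable_vanish {R : realType} {T : choiceType} (v : T -> R) (e : R) :
  summable [set: T] (fun y => (v y)%:E) -> 0 < e ->
  exists B : seq T, forall y, y \notin B -> `|v y| <= e.
Proof.
move=> vs e0; have vf : nfin (fun y => `|v y|) by exact: vs.
have [B _ Be] := nsum_tail (fun y => normr_ge0 (v y)) vf e0.
exists B => y yB; apply: le_trans Be.
pose h (t : T) := if t \in B then 0 else `|v t|.
have h0 t : 0 <= h t by rewrite /h; case: ifP.
have hf : nfin h by apply: nfin_le vf => t; rewrite /h; case: ifP.
by have := nsum_term y h0 hf; rewrite {1}/h (negbTE yB).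
Qed.

(** * The N-particle Hamiltonian *)

Section NParticleOperator.
Context {R : realType} {d n : nat}.
Variables (m : 'I_n.+1 -> \bar R) (eps : 'I_n.+1 -> 'rV[int]_d -> R[i]).
Variables (v : 'I_n.+1 -> 'I_n.+1 -> 'rV[int]_d -> R) (K : 'rV[R]_d).
Hypothesis eps_conj : forall i y, eps i y = (eps i (- y))^*%C.
Hypothesis eps_sum : forall i, csummable (eps i).
Hypothesis v_l1 : forall i j : 'I_n.+1, (i < j)%N ->
  summable [set: 'rV[int]_d] (fun y => (v i j y)%:E).

Notation conf := 'M[int]_(n, d).
Notation idx := ('I_n.+1 * 'rV[int]_d)%type.

(* The last particle is pinned at the origin, so displacing it by y translates all the others by
   -y and produces the phase e^{i K . y}. *)
Definition last_shift (z : idx) : 'rV[int]_d := if ord_max == z.1 then z.2 else 0.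

Definition hop_shift (z : idx) : conf :=
  \matrix_(k < n) ((if lift ord_max k == z.1 then z.2 else 0) - last_shift z).

Definition hop_coef (z : idx) : R[i] :=
  ((fine (m z.1)^-1%E)%:C * ((2 * pi) `^ (- (d%:R / 2)))%:C) *
  (eps z.1 z.2 * expi (torus_dot K (last_shift z))).

Definition hop_flip (z : idx) : idx := (z.1, - z.2).

Lemma torus_dotN (y : 'rV[int]_d) : torus_dot K (- y) = - torus_dot K y.
Proof.
rewrite /torus_dot -sumrN; apply: eq_bigr => l _.
by rewrite mxE mulrNz mulrN.
Qed.

Lemma last_shift_flip z : last_shift (hop_flip z) = - last_shift z.
Proof. by rewrite /last_shift /=; case: ifP => // _; rewrite oppr0. Qed.

Lemma hop_slice i : csummable (fun y => hop_coef (i, y)).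
Proof.
have h := csummableZ ((fine (m i)^-1%E)%:C * ((2 * pi) `^ (- (d%:R / 2)))%:C) (eps_sum i).
apply: nfin_le h => y; rewrite /hop_coef !Normc.normcM normc_expi mulr1.
exact: lexx.
Qed.

Lemma hop_herm : herm_kernel hop_coef hop_shift hop_flip.
Proof.
split.
- by have [] := csum_finprod hop_slice.
- by move=> [i y]; rewrite /hop_flip /= opprK.
- move=> [i y]; rewrite /hop_coef last_shift_flip torus_dotN -expi_conj !conjcM !conjc_real.
  by rewrite /hop_flip /= (eps_conj i (- y)) opprK.
- move=> [i y]; apply/matrixP => k l; rewrite !mxE last_shift_flip /hop_flip /=.
  by rewrite !mxE; case: ifP => _; rewrite ?mxE ?opprB ?opprD ?opprK// addrC.
Qed.

Lemma row_pin_max (x : conf) : row ord_max (pin x) = 0.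
Proof. by apply/rowP => l; rewrite !mxE unlift_none mxE. Qed.

Lemma row_pin_lift (x : conf) k : row (lift ord_max k) (pin x) = row k x.
Proof. by apply/rowP => l; rewrite !mxE liftK mxE. Qed.

Lemma free_hamiltonianE (f : conf -> R[i]) : l2 f ->
  free_hamiltonian m eps K f = convol hop_coef hop_shift f.
Proof.
move=> fl; apply/funext => x; rewrite /free_hamiltonian /convol.
have sm i := conv_summable (fun y => hop_shift (i, y)) x (hop_slice i) fl.
have [_ ->] := @csum_finprod _ _ _ (fun z => hop_coef z * f (x - hop_shift z)) sm.
apply: eq_bigr => i _; rewrite /dispersion mulrA.
have fibE y : fibre_coef K f (translate (pin x) i (- y)) =
    expi (torus_dot K (last_shift (i, y))) * f (x - hop_shift (i, y)).
  have rE k : row k (translate (pin x) i (- y)) = row k (pin x) - (if k == i then y else 0).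
    by apply/rowP => l; rewrite !mxE; case: ifP => _; rewrite ?mxE ?oppr0.
  rewrite /fibre_coef rE row_pin_max sub0r torus_dotN opprK -/(last_shift (i, y)).
  congr (_ * f _); apply/matrixP => k l; rewrite mxE rE row_pin_lift !mxE opprK opprB addrAC addrA.
  by rewrite addrAC.
under eq_fun do rewrite fibE.
have c0 : csummable (fun y => eps i y * (expi (torus_dot K (last_shift (i, y))) * f (x - hop_shift (i, y)))).
  have : csummable (fun y => eps i y * expi (torus_dot K (last_shift (i, y)))).
    by apply: nfin_le (eps_sum i) => y; rewrite Normc.normcM normc_expi mulr1.
  move=> /(conv_summable (fun y => hop_shift (i, y)) x)/(_ fl).
  by apply: nfin_le => y; rewrite mulrA.
rewrite -csumZ//; congr csum; apply/funext => y; rewrite /hop_coef /=; ring.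
Qed.

Definition pair_form (al : 'I_n.+1 * 'I_n.+1) (x : conf) : 'rV[int]_d :=
  row al.1 (pin x) - row al.2 (pin x).

(** The index runs over all ordered pairs, while decay of [v i j] is assumed for [i < j]; the value
    0 elsewhere makes every weight vanish at infinity. The sign is that of the interaction in the
    Hamiltonian. *)
Definition pair_weight (al : 'I_n.+1 * 'I_n.+1) (y : 'rV[int]_d) : R :=
  if (al.1 < al.2)%N then - v al.1 al.2 y else 0.

Definition pairs : {set 'I_n.+1 * 'I_n.+1} := [set al : 'I_n.+1 * 'I_n.+1 | (al.1 < al.2)%N]%SET.

Definition cluster_pairs (D : {set {set 'I_n.+1}}) : {set 'I_n.+1 * 'I_n.+1} :=
  [set al in pairs | finset.pblock D al.1 == finset.pblock D al.2]%SET.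

Lemma row_pinB i (x y : conf) : row i (pin (x - y)) = row i (pin x) - row i (pin y).
Proof.
apply/rowP => l; rewrite !mxE; case: (unlift ord_max i) => [k|]; rewrite !mxE//.
Qed.

Lemma pair_formB al (x y : conf) : pair_form al (x - y) = pair_form al x - pair_form al y.
Proof.
rewrite /pair_form !row_pinB !opprB [X in _ + X = _]addrC addrACA; congr (_ + _).
exact: addrC.
Qed.

Lemma pair_weight_vanish al (e : R) : 0 < e ->
  exists B : seq 'rV[int]_d, forall y, y \notin B -> `|pair_weight al y| <= e.
Proof.
move=> e0; rewrite /pair_weight; have [h|_] := boolP (al.1 < al.2)%N.
  by have [B BP] := summable_vanish (v_l1 h) e0; exists B => y yB /=; rewrite normrN; exact: BP.
by exists [::] => y _ /=; rewrite normr0 ltW.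
Qed.

Lemma hamiltonianE (f : conf -> R[i]) : l2 f ->
  hamiltonian m eps v K f = conv_op hop_coef hop_shift (pot pair_form pair_weight pairs) f.
Proof.
move=> fl; apply/funext => x; rewrite /hamiltonian free_hamiltonianE// /conv_op; congr (_ + _).
rewrite pair_big_dep /= -sumrN /pot rmorph_sum mulr_suml.
apply: eq_big => [[i j]|[i j] /= ij]; first by rewrite inE.
by rewrite /pair_potential /pair_weight /= ij /pair_form /= rmorphN mulNr.
Qed.

Lemma cluster_hamiltonianE D (f : conf -> R[i]) : l2 f ->
  cluster_hamiltonian m eps v K D f =
  conv_op hop_coef hop_shift (pot pair_form pair_weight (cluster_pairs D)) f.
Proof.
move=> fl; apply/funext => x; rewrite /cluster_hamiltonian hamiltonianE// /conv_op -addrA; congr (_ + _).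
have -> : pot pair_form pair_weight pairs x = pot pair_form pair_weight (cluster_pairs D) x +
    \sum_(al : 'I_n.+1 * 'I_n.+1 | (al.1 < al.2)%N && (finset.pblock D al.1 != finset.pblock D al.2)) pair_weight al (pair_form al x).
  rewrite /pot (bigID (fun al => finset.pblock D al.1 == finset.pblock D al.2))/=.
  by congr (_ + _); apply: eq_bigl => al; rewrite !inE.
rewrite rmorphD mulrDl -addrA -[RHS]addr0; congr (_ + _).
rewrite pair_big_dep /= rmorph_sum mulr_suml -big_split /= big1// => -[i j] /= /andP[ij _].
by rewrite /pair_potential /pair_weight /= ij rmorphN mulNr addNr.
Qed.

Lemma total_countably_connected J :
  countably_connected (real_spectrum (conv_op hop_coef hop_shift (pot pair_form pair_weight J))).
Proof.
(* The induction on the rank runs over row vectors, so configurations are flattened. *)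
have be : bijective (vec_mx : 'rV[int]_(n * d)%N -> conf).
  by exists mxvec; [exact: vec_mxK|exact: mxvecK].
pose pi' al (x : 'rV[int]_(n * d)%N) := pair_form al (vec_mx x).
have hk' : herm_kernel hop_coef (fun z => mxvec (hop_shift z)) hop_flip.
  have [h1 h2 h3 h4] := hop_herm; split => // y; by rewrite h4 linearN.
have pi'B : additive_family pi' by move=> al x y; rewrite /pi' linearB pair_formB.
rewrite -(@real_spectrum_relabel _ _ _ _ (conv_op hop_coef hop_shift (pot pair_form pair_weight J))
  (conv_op hop_coef (fun z => mxvec (hop_shift z)) (pot pi' pair_weight J)) be).
  exact: (spectrum_countably_connected (@torsion_free_int_mx 1 d) pair_weight_vanish J hk' pi'B).
move=> f fl; apply/funext => x; rewrite /conv_op /=; congr (_ + _).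
by congr csum; apply/funext => y /=; rewrite linearB /= mxvecK.
Qed.

(** One cluster consists of the particles that [x0] leaves with the last one. The other may itself
    be torn apart by [x0], which is why [hvz_incl] only constrains the pairs outside [J]. *)
Lemma two_clusters_of_direction (x0 : conf) : x0 != 0 -> exists D : {set {set 'I_n.+1}},
  [/\ finset.partition D [set: 'I_n.+1]%SET, #|D| = 2%N &
      forall al, al \in pairs -> al \notin cluster_pairs D -> pair_form al x0 != 0].
Proof.
move=> x00.
pose C : {set 'I_n.+1} := [set i | row i (pin x0) == 0]%SET.
have lastC : ord_max \in C by rewrite inE row_pin_max.
have [k kC] : exists k, k \notin C.
  apply: contrapT => no; move/eqP: x00; apply; apply/row_matrixP => k.
  rewrite row0 -row_pin_lift; apply/eqP; apply: contraT => h; exfalso; apply: no.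
  by exists (lift ord_max k); rewrite inE.
have CC : C != (~: C)%SET by apply/eqP => e; have := lastC; rewrite e inE lastC.
pose D : {set {set 'I_n.+1}} := [set C; ~: C]%SET.
have pD : finset.partition D [set: 'I_n.+1]%SET.
  apply/and3P; split.
  - apply/eqP/setP => i; rewrite inE; apply/finset.bigcupP.
    have [iC|iC] := boolP (i \in C).
      by exists C => //; rewrite !inE eqxx.
    exists (~: C)%SET; first by rewrite !inE eqxx orbT.
    by rewrite finset.in_setC.
  - apply/finset.trivIsetP => A B; rewrite !inE => /orP[/eqP->|/eqP->] /orP[/eqP->|/eqP->];
      rewrite ?eqxx// => _; rewrite -setI_eq0 ?setICr// finset.setIC; first by rewrite finset.setIC finset.setICr.
    by rewrite finset.setICr.
  - rewrite !inE negb_or; apply/andP; split; apply/eqP => e.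
      by move: lastC; rewrite -e inE.
    have : k \in (~: C)%SET by rewrite inE.
    by rewrite -e inE.
exists D; split => //; first by rewrite cards2 CC.
move=> [i j] ijp; rewrite inE ijp /= => ij; apply/eqP => e; move/eqP: ij; apply.
have /and3P[_ tD _] := pD.
have ijC : (i \in C) = (j \in C) by rewrite !inE; move/subr0_eq: e => /= ->.
have [iC|iC] := boolP (i \in C).
  rewrite (finset.def_pblock tD _ iC) ?(finset.def_pblock tD (B := C) _ (_ : j \in C)) -?ijC//; by rewrite !inE eqxx.
have iC' : i \in (~: C)%SET by rewrite inE.
have jC' : j \in (~: C)%SET by rewrite inE -ijC.
by rewrite (finset.def_pblock tD _ iC') ?(finset.def_pblock tD _ jC')//; rewrite !inE eqxx orbT.
Qed.

(** The cluster without the last particle is moved rigidly by a nonzero vector, available because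
    [d] is positive. Since it is the only other cluster, exactly the pairs inside a cluster keep
    their relative position, as [hvz_conv] demands. *)
Lemma direction_of_two_clusters (D : {set {set 'I_n.+1}}) : (1 <= d)%N ->
  finset.partition D [set: 'I_n.+1]%SET -> #|D| = 2%N -> exists x0 : conf,
  x0 != 0 /\ cluster_pairs D = [set al in pairs | pair_form al x0 == 0]%SET.
Proof.
move=> d1 pD D2.
have /and3P[/eqP cD tD D0] := pD.
have inD i : finset.pblock D i \in D by apply: finset.pblock_mem; rewrite cD inE.
have memD i : i \in finset.pblock D i by rewrite finset.mem_pblock cD inE.
pose C := finset.pblock D ord_max.
have pbE i : (i \in C) = (finset.pblock D i == C).
  apply/idP/eqP => [iC|<-]; last exact: memD.
  by apply: (finset.def_pblock tD) => //; exact: inD.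
pose u : 'rV[int]_d := const_mx 1.
have u0 : u != 0.
  by apply/eqP => /rowP /(_ (Ordinal d1)); rewrite !mxE.
pose x0 : conf := \matrix_(k < n) (if lift ord_max k \in C then 0 else u).
have rE i : row i (pin x0) = if i \in C then 0 else u.
  case: (unliftP ord_max i) => [k ->|->]; last by rewrite row_pin_max memD.
  by rewrite row_pin_lift; apply/rowP => l; rewrite !mxE.
have blocks A B : A \in D -> B \in D -> A != C -> B != C -> A = B.
  move=> AD BD AC BC; apply/eqP; apply: contraT => AB.
  have : (#|[set A; B; C]%SET| <= #|D|)%N.
    apply: subset_leq_card; apply/fintype.subsetP => Z; rewrite !inE => /orP[/orP[]|] /eqP-> //.
    exact: inD.
  by rewrite D2 -finset.setUA finset.cardsU1 !inE negb_or AB AC/= finset.cards2 BC.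
exists x0; split.
  have [B BD BC] : exists2 B, B \in D & B != C.
    apply: contrapT => no; have : (#|D| <= #|[set C]%SET|)%N.
      apply: subset_leq_card; apply/fintype.subsetP => B BD; rewrite inE; apply: contraT => h.
      by exfalso; apply: no; exists B.
    by rewrite D2 cards1.
  have [i iB] : exists i, i \in B.
    apply/finset.set0Pn; apply: contraNneq D0 => e; by rewrite -e.
  apply: contraNneq u0 => e; have := rE i.
  have -> : (i \in C) = false.
    by rewrite pbE (finset.def_pblock tD BD iB) (negbTE BC).
  move=> <-; rewrite e; apply/eqP/rowP => l; rewrite !mxE.
  by case: (unlift ord_max i) => [k|]; rewrite !mxE.
apply/setP => -[i j]; rewrite !inE /=; case: (i < j)%N => //=.
rewrite /pair_form /= !rE !pbE.
have [iC|iC] := eqVneq (finset.pblock D i) C; have [jC|jC] := eqVneq (finset.pblock D j) C.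
- by rewrite iC jC subrr !eqxx.
- by rewrite iC sub0r oppr_eq0 (negbTE u0) eq_sym (negbTE jC).
- by rewrite jC subr0 (negbTE u0) (negbTE iC).
- by rewrite subrr eqxx (blocks _ _ (inD i) (inD j) iC jC) eqxx.
Qed.

End NParticleOperator.

(** For nonzero [y] the factor |y|^gamma is at least 1; the term at 0 is added separately. *)
Lemma moment_csummable {R : realType} {d : nat} (e : 'rV[int]_d -> R[i]) (gamma : R) :
  summable [set: 'rV[int]_d] (fun y => ((l1norm y)%:R `^ gamma * Normc.normc (e y))%:E) ->
  0 < gamma -> csummable e.
Proof.
move=> es g0.
have h0 (y : 'rV[int]_d) : 0 <= (l1norm y)%:R `^ gamma * Normc.normc (e y).
  by rewrite mulr_ge0 ?powR_ge0 ?normc_ge0.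
have es' : nfin (fun y => (l1norm y)%:R `^ gamma * Normc.normc (e y)).
  have : nfin (fun y => `|(l1norm y)%:R `^ gamma * Normc.normc (e y)|) by exact: es.
  by apply: nfin_le => y; exact: ler_norm.
pose dl (y : 'rV[int]_d) := if y == 0 then Normc.normc (e y) else 0.
have dl0 y : 0 <= dl y by rewrite /dl; case: ifP => // _; exact: normc_ge0.
have [|df _] := @nsum_finsupp _ _ dl [:: 0] dl0 isT.
  by move=> y; rewrite inE /dl => /negbTE ->.
apply: nfin_le (nfinD h0 dl0 es' df) => y; rewrite /dl; case: ifPn => [_|y0].
  by rewrite lerDr.
rewrite addr0 -[leLHS]mul1r ler_wpM2r ?normc_ge0//.
have y1 : (1 <= l1norm y)%N.
  rewrite lt0n; apply: contra y0; rewrite /l1norm sum_nat_eq0 => /forallP h.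
  by apply/eqP/rowP => l; rewrite mxE; have := h l; rewrite /= absz_eq0 => /eqP.
have := @ge0_ler_powR R gamma (ltW g0) 1 (l1norm y)%:R.
by rewrite powR1; apply; rewrite ?nnegrE ?ler1n.
Qed.

Unset Implicit Arguments.

Theorem theorem3p1 (R : realType) (d n : nat)
  (m : 'I_n.+1 -> \bar R)
  (eps : 'I_n.+1 -> 'rV[int]_d -> R[i])
  (v : 'I_n.+1 -> 'I_n.+1 -> 'rV[int]_d -> R)
  (d_ge1 : (1 <= d)%N)
  (N_ge2 : (2 <= n.+1)%N)
  (m_gt0 : forall i, (0 < m i)%E)
  (eps_conj : forall i y, eps i y = (eps i (- y))^*)
  (eps_moment : exists2 gamma : R, 0 < gamma &
     forall i, summable [set: 'rV[int]_d]
       (fun y => ((l1norm y)%:R `^ gamma * Normc.normc (eps i y))%:E))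
  (v_l1 : forall i j : 'I_n.+1, (i < j)%N ->
     summable [set: 'rV[int]_d] (fun y => (v i j y)%:E))
  (v_even : forall i j : 'I_n.+1, (i < j)%N -> forall y, v i j (- y) = v i j y)
  (K : 'rV[R]_d) (K_torus : torus K) :
  (exists (I : set nat) (a b : nat -> R),
     [/\ forall k, I k -> a k <= b k,
         trivIset I (fun k => segment (a k) (b k)),
         ess_spectrum (hamiltonian m eps v K) =
           \bigcup_(k in I) segment (a k) (b k)
       & forall z : R[i],
           limit_point (disc_spectrum (hamiltonian m eps v K) : set R[i]^o) z ->
           exists2 k, I k & z = (a k)%:C \/ z = (b k)%:C]) /\
  ess_spectrum (hamiltonian m eps v K) =
    \bigcup_(D in [set D | cluster_decompositions D /\ #|D| = 2%N])
      spectrum (cluster_hamiltonian m eps v K D).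
Proof.
have eps_sum i : csummable (eps i).
  by have [gamma g0 h] := eps_moment; exact: moment_csummable (h i) g0.
have hk := hop_herm m K eps_conj eps_sum.
have w0 := pair_weight_vanish v_l1.
have piB := @pair_formB d n.
pose A J := conv_op (hop_coef m eps K) (@hop_shift d n) (pot (@pair_form d n) (pair_weight v) J).
have sA J : sym_op (A J) := opJ_sym hk _ w0 J.
pose two (D : {set {set 'I_n.+1}}) := cluster_decompositions D /\ #|D| = 2%N.
have HE f : l2 f -> hamiltonian m eps v K f = A (pairs (n := n)) f by exact: hamiltonianE.
(* The pairs of a two-cluster decomposition fit both comparisons: far from the origin one such set
   accounts for the remaining potential, and each is the set of pairs fixed by some direction. *)
have essE : [set lam | ~ bdd_below_off (A (pairs (n := n))) lam] =
    [set lam | exists2 D, two D & real_spectrum (A (cluster_pairs D)) lam].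
  apply/seteqP; split => lam /=.
    move=> nb; apply: contrapT => no; apply: nb.
    apply: (hvz_incl hk piB w0 (JJ := fun J => exists2 D, two D & J = cluster_pairs D)).
    - by move=> J [D _ ->]; apply/fintype.subsetP => al; rewrite inE => /andP[].
    - move=> B; have [S SP] := direction_far piB B; exists S => t /SP[x0 x00 h].
      have [D [pD D2 DP]] := two_clusters_of_direction x00.
      by exists (cluster_pairs D); [exists D|move=> al a1 a2; apply: h; exact: DP].
    - by move=> J [D tD ->] h; apply: no; exists D.
  move=> [D [pD D2] DP] boff.
  have [x0 [x00 DE]] := direction_of_two_clusters d_ge1 pD D2.
  apply: (hvz_conv hk piB w0 (@torsion_free_int_mx _ _) (@torsion_free_int_mx _ _) x00 boff).
  by rewrite -DE.
have ess : ess_spectrum (hamiltonian m eps v K) =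
    [set lam%:C | lam in [set lam | ~ bdd_below_off (A (pairs (n := n))) lam]].
  by rewrite (ess_spectrum_ext HE) ess_spectrumE.
split; last first.
  rewrite ess essE; apply/seteqP; split => z.
    move=> [lam [D tD DP] <-]; exists D => //.
    by rewrite (spectrum_ext (cluster_hamiltonianE m v K eps_sum D)) (spectrumE (sA (cluster_pairs D))); exists lam.
  move=> [D tD]; rewrite (spectrum_ext (cluster_hamiltonianE m v K eps_sum D)) (spectrumE (sA (cluster_pairs D))) => -[lam lamP <-].
  by exists lam => //; exists D.
have cc : countably_connected [set lam | ~ bdd_below_off (A (pairs (n := n))) lam].
  rewrite essE; apply: countably_connected_union => D _.
  exact: total_countably_connected.
have [M MP] := real_spectrum_bounded (sA (pairs (n := n))).
have [|I [a [b [h1 h2 h3]]]] := components (bdd_below_off_far (sA (pairs (n := n)))) _ cc (M := M).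
  by move=> y /real_spectrum_not_bdd_below_off /MP.
exists I, a, b; split => //; first by rewrite ess.
rewrite (disc_spectrum_ext HE); apply: disc_limit_point => //.
by rewrite -(ess_spectrum_ext HE) ess.
Qed.
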